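(* The assignment \[ \mathbf E_{\mathbf Q}\colon M_{\mathbf Q}\mapsto\bigl(\mathbf E_{\mathbf Q[\sqrt{-1}]}(M_{\mathbf Q[\sqrt{-1}]}),\varphi_\bullet\bigr) \] (case $\ell=0$, defined in the context) from $\mathrm{HC}_0(\mathfrak g,K)_{\mathbf Q}$ to the category of $\mathbf Q$-rational finite-dimensional nilpotent representations of the $\mathbf Q$-rational cyclic quiver is well-defined and an equivalence of categories.
   Context: Write $i=\sqrt{-1}$, $F=\mathbf Q[\sqrt{-1}]$, and let $c$ be the non-trivial element of $G=\operatorname{Gal}(F/\mathbf Q)$. **Harish-Chandra modules.** Let $\mathfrak g_{\mathbf Q}=\mathfrak{sl}_{2,\mathbf Q}$ and $K_{\mathbf Q}=\mathrm{SO}(2)_{\mathbf Q}=\operatorname{Spec}\mathbf Q[x,y]/(x^2+y^2-1)$, the point $(x,y)$ corresponding to $\begin{pmatrix} x & -y \\ y & x \end{pmatrix}$. A $(\mathfrak g,K)$-module over $\mathbf Q$ is a $\mathbf Q$-vector space $M_{\mathbf Q}$ which is a rational (algebraic, locally finite) representation of $K_{\mathbf Q}$ with a $\mathbf Q$-linear action of $\mathfrak g_{\mathbf Q}$ which is $K_{\mathbf Q}$-equivariant for the adjoint action and restricts on $\operatorname{Lie}K_{\mathbf Q}$ to the differential of the $K_{\mathbf Q}$-action. Put $M_F=F\otimes_{\mathbf Q}M_{\mathbf Q}$ with semi-linear involution $c(a\otimes m)=c(a)\otimes m$. Let \[ H=\begin{pmatrix} 0 & -i \\ i & 0 \end{pmatrix},\quad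 X=\tfrac12\begin{pmatrix} 1 & i \\ i & -1 \end{pmatrix},\quad Y=\tfrac12\begin{pmatrix} 1 & -i \\ -i & -1 \end{pmatrix} \] in $F\otimes\mathfrak g_{\mathbf Q}$, so $[H,X]=2X$, $[H,Y]=-2Y$, $[X,Y]=H$, and $cH=-H$, $cX=Y$, $cY=X$. Let $C=H^2-2H+4XY+1\in U(\mathfrak g_{\mathbf Q})$. For $n\in\mathbf Z$ let $M_n\subseteq M_F$ be the eigenspace of $H$ with eigenvalue $n$; $M_F=\bigoplus_nM_n$ and $cM_n=M_{-n}$. $M_{\mathbf Q}$ is a Harish-Chandra module if it is finitely generated over $U(\mathfrak g_{\mathbf Q})$ and all $M_n$ are finite-dimensional. $\mathrm{HC}_0(\mathfrak g,K)_{\mathbf Q}$ is the full subcategory of Harish-Chandra modules over $\mathbf Q$ with $C^mM_{\mathbf Q}=0$ for some $m\ge0$ on which $-1_2\in\mathrm{SO}(2)$ acts as $-1$. **Quiver.** The cyclic quiver has vertices $-,+$ and arrows $a\colon-\to+$, $b\colon+\to-$. The $\mathbf Q$-rational cyclic quiver is this quiver with the $G$-action $c\pm=\mp$, $ca=b$, $cb=a$. A $\mathbf Q$-rational finite-dimensional representation consists of finite-dimensional $F$-vector spaces $M(\pm)$, $F$-linear maps $\phi_a\colon M(-)\to M(+)$, $\phi_b\colon M(+)\to M(-)$, and $c$-semi-linear isomorphisms $\varphi_\pm\colon M(\pm)\to M(\mp)$ with $\varphi_\mp\varphi_\pm=\mathbf 1$, $\phi_b\varphi_-=\varphi_+\phi_a$,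 $\phi_a\varphi_+=\varphi_-\phi_b$. It is nilpotent if the compositions of the maps along all sufficiently long paths vanish. Morphisms are pairs of $F$-linear maps commuting with all $\phi$'s and $\varphi$'s. **The assignment.** $\mathbf E_F(M_F)$ is given by $M(-)=M_{-1}$, $M(+)=M_1$, $\phi_a=X|_{M_{-1}}$, $\phi_b=Y|_{M_1}$, and the rational structure is $\varphi_\pm=c\colon M(\pm)\to M(\mp)$. On morphisms, $\mathbf E_{\mathbf Q}$ is extension of scalars to $F$ followed by restriction to $M_{\pm1}$. *)

(* Defs.v *)
From HB Require Import structures.
From mathcomp Require Import all_boot all_order all_algebra.
From mathcomp Require Import generic_quotient.
From mathcomp Require Import boolp.
From mathcomp Require Import complex.
From mathcomp Require Import ring.

Set Implicit Arguments.
Unset Strict Implicit.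
Unset Printing Implicit Defensive.

Import GRing.Theory.

Local Open Scope ring_scope.
Local Open Scope quotient_scope.

(* MathComp has no tensor product of modules of infinite rank.  An element of
   R (x)_Q M is a finite formal sum of pairs (a, m), and two formal sums are
   identified when no Q-balanced biadditive map separates them.  The lemmas
   [bc_balanced], [bc_liftE] and [bc_lift_uniq] are the universal property. *)

Section BaseChange.
Variables (R : comAlgType rat) (M : lmodType rat).

Definition balanced (N : zmodType) (b : R -> M -> N) : Prop :=
  [/\ forall a a' m, b (a + a') m = b a m + b a' m,
      forall a m m', b a (m + m') = b a m + b a m'
    & forall (q : rat) a m, b (q *: a) m = b a (q *: m)].

Definition fsum (N : zmodType) (b : R -> M -> N) (s : seq (R * M)) : N :=
  \sum_(p <- s) b p.1 p.2.

Definition bc_eqv (s t : seq (R * M)) : bool :=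
  `[< forall (N : zmodType) (b : R -> M -> N),
        balanced b -> fsum b s = fsum b t >].

Fact bc_eqv_refl : reflexive bc_eqv.
Proof. by move=> s; apply/asboolP. Qed.

Fact bc_eqv_sym : symmetric bc_eqv.
Proof.
by move=> s t; apply/asboolP/asboolP => h N b hb; rewrite (h N b hb).
Qed.

Fact bc_eqv_trans : transitive bc_eqv.
Proof.
move=> t s u /asboolP h1 /asboolP h2; apply/asboolP => N b hb.
by rewrite (h1 N b hb) (h2 N b hb).
Qed.

Definition bc_equiv := EquivRel bc_eqv bc_eqv_refl bc_eqv_sym bc_eqv_trans.

Definition bc : Type := {eq_quot bc_equiv}.

HB.instance Definition _ := Choice.on bc.

Definition bc_pi (s : seq (R * M)) : bc := \pi_{eq_quot bc_equiv} s.
Definition bc_repr (u : bc) : seq (R * M) := repr (u : {eq_quot bc_equiv}).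

Lemma bc_reprK u : bc_pi (bc_repr u) = u.
Proof. exact: reprK. Qed.

Lemma bc_piP s t :
  (forall (N : zmodType) (b : R -> M -> N), balanced b -> fsum b s = fsum b t)
  <-> bc_pi s = bc_pi t.
Proof.
split=> [h|h].
  by apply/eqP; rewrite /bc_pi eqmodE; apply/asboolP.
by move/eqP: h; rewrite /bc_pi eqmodE => /asboolP.
Qed.

Definition bc_lift (N : zmodType) (b : R -> M -> N) (u : bc) : N :=
  fsum b (bc_repr u).

Lemma bc_lift_pi (N : zmodType) (b : R -> M -> N) s :
  balanced b -> bc_lift b (bc_pi s) = fsum b s.
Proof. by move=> hb; apply: (bc_piP _ _).2 => //; rewrite bc_reprK. Qed.

Lemma bc_ext (u v : bc) :
  (forall (N : zmodType) (b : R -> M -> N),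
     balanced b -> bc_lift b u = bc_lift b v) -> u = v.
Proof. by move=> h; rewrite -(bc_reprK u) -(bc_reprK v); apply/bc_piP. Qed.

Definition bc_zero : bc := bc_pi [::].
Definition bc_add (u v : bc) : bc := bc_pi (bc_repr u ++ bc_repr v).
Definition bc_scale (a : R) (u : bc) : bc :=
  bc_pi [seq (a * p.1, p.2) | p <- bc_repr u].
Definition bc_opp (u : bc) : bc := bc_scale (-1) u.

Lemma balanced_scale (N : zmodType) (b : R -> M -> N) a :
  balanced b -> balanced (fun x m => b (a * x) m).
Proof.
case=> b1 b2 b3; split=> [x x' m|x m m'|q x m]; first by rewrite mulrDr b1.
  by rewrite b2.
by rewrite -scalerAr b3.
Qed.

Lemma bc_lift_zero (N : zmodType) (b : R -> M -> N) :
  balanced b -> bc_lift b bc_zero = 0.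
Proof. by move=> hb; rewrite bc_lift_pi // /fsum big_nil. Qed.

Lemma bc_lift_add (N : zmodType) (b : R -> M -> N) u v :
  balanced b -> bc_lift b (bc_add u v) = bc_lift b u + bc_lift b v.
Proof. by move=> hb; rewrite bc_lift_pi // /fsum big_cat. Qed.

Lemma bc_lift_scale (N : zmodType) (b : R -> M -> N) a u :
  balanced b -> bc_lift b (bc_scale a u) = bc_lift (fun x m => b (a * x) m) u.
Proof. by move=> hb; rewrite bc_lift_pi // /fsum big_map. Qed.

Lemma balancedN (N : zmodType) (b : R -> M -> N) a m :
  balanced b -> b (- a) m = - b a m.
Proof.
case=> b1 _ _; apply: (addrI (b a m)); rewrite -b1 !subrr.
by apply: (addIr (b 0 m)); rewrite -b1 !add0r.
Qed.

Lemma bc_lift_opp (N : zmodType) (b : R -> M -> N) u :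
  balanced b -> bc_lift b (bc_opp u) = - bc_lift b u.
Proof.
move=> hb; rewrite bc_lift_scale // /bc_lift /fsum -sumrN.
by apply: eq_bigr => p _; rewrite mulN1r balancedN.
Qed.

Fact bc_addA : associative bc_add.
Proof. by move=> u v w; apply: bc_ext => N b hb; rewrite !bc_lift_add ?addrA. Qed.

Fact bc_addC : commutative bc_add.
Proof. by move=> u v; apply: bc_ext => N b hb; rewrite !bc_lift_add // addrC. Qed.

Fact bc_add0 : left_id bc_zero bc_add.
Proof.
by move=> u; apply: bc_ext => N b hb; rewrite bc_lift_add // bc_lift_zero ?add0r.
Qed.

Fact bc_addN : left_inverse bc_zero bc_opp bc_add.
Proof.
move=> u; apply: bc_ext => N b hb.
by rewrite bc_lift_add // bc_lift_zero // bc_lift_opp // addNr.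
Qed.

HB.instance Definition _ :=
  GRing.isZmodule.Build bc bc_addA bc_addC bc_add0 bc_addN.

Fact bc_scaleA a a' u : bc_scale a (bc_scale a' u) = bc_scale (a * a') u.
Proof.
apply: bc_ext => N b hb.
rewrite !bc_lift_scale //; last exact: balanced_scale.
by apply: eq_bigr => p _; rewrite mulrA.
Qed.

Fact bc_scale1 : left_id 1 bc_scale.
Proof.
move=> u; apply: bc_ext => N b hb; rewrite bc_lift_scale //.
by apply: eq_bigr => p _; rewrite mul1r.
Qed.

Fact bc_scaleDr : right_distributive bc_scale +%R.
Proof.
move=> a u v; apply: bc_ext => N b hb; have hb' := balanced_scale a hb.
by rewrite !(bc_lift_scale, bc_lift_add).
Qed.

Fact bc_scaleDl u : {morph bc_scale^~ u : a a' / a + a'}.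
Proof.
move=> a a'; apply: bc_ext => N b hb.
rewrite !(bc_lift_scale, bc_lift_add) // /bc_lift /fsum -big_split /=.
by apply: eq_bigr => p _; case: hb => b1 _ _; rewrite mulrDl b1.
Qed.

HB.instance Definition _ := GRing.Zmodule_isLmodule.Build R bc
  bc_scaleA bc_scale1 bc_scaleDr bc_scaleDl.

Definition tens (a : R) (m : M) : bc := bc_pi [:: (a, m)].

Lemma bc_liftE (N : zmodType) (b : R -> M -> N) a m :
  balanced b -> bc_lift b (tens a m) = b a m.
Proof. by move=> hb; rewrite bc_lift_pi // /fsum big_seq1. Qed.

Lemma bc_liftD (N : zmodType) (b : R -> M -> N) u v :
  balanced b -> bc_lift b (u + v) = bc_lift b u + bc_lift b v.
Proof. exact: bc_lift_add. Qed.

Lemma bc_balanced : balanced tens.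
Proof.
split=> [a a' m|a m m'|q a m]; apply: bc_ext => N b hb;
  rewrite ?bc_liftD // !bc_liftE //; by case: hb.
Qed.

Lemma scale_tens a a' m : a *: tens a' m = tens (a * a') m.
Proof.
apply: bc_ext => N b hb; rewrite bc_lift_scale // !bc_liftE //.
exact: balanced_scale.
Qed.

Lemma tens_sum (u : bc) : u = \sum_(p <- bc_repr u) tens p.1 p.2.
Proof.
rewrite -{1}(bc_reprK u); elim: (bc_repr u) => [|p s ih]; rewrite ?big_nil //.
rewrite big_cons -ih; apply: bc_ext => N b hb.
by rewrite bc_liftD // !bc_lift_pi // /fsum big_cons big_seq1.
Qed.

Lemma bc_ind (P : bc -> Prop) :
  P 0 -> (forall u v, P u -> P v -> P (u + v)) -> (forall a m, P (tens a m)) ->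
  forall u, P u.
Proof.
move=> P0 PD Pt u; rewrite (tens_sum u).
by elim: (bc_repr u) => [|p s ih]; rewrite ?big_nil // big_cons; apply: PD.
Qed.

Lemma bc_lift_uniq (N : zmodType) (f g : {additive bc -> N}) :
  (forall a m, f (tens a m) = g (tens a m)) -> f =1 g.
Proof.
move=> h; elim/bc_ind => [|u v hu hv|//]; first by rewrite !raddf0.
by rewrite !raddfD hu hv.
Qed.

End BaseChange.

Arguments tens {R M}.

Section BaseChangeLinear.
Variables (R : comAlgType rat) (M N : lmodType rat) (f : {linear M -> N}).

Definition bc_lin : bc R M -> bc R N := bc_lift (fun a m => tens a (f m)).

Fact bc_lin_balanced : balanced (fun a m => tens a (f m) : bc R N).
Proof.
have [t1 t2 t3] := bc_balanced R N.
by split=> *; rewrite ?raddfD ?linearZ ?t1 ?t2 ?t3.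
Qed.

Lemma bc_linE a m : bc_lin (tens a m) = tens a (f m).
Proof. by rewrite /bc_lin bc_liftE //; apply: bc_lin_balanced. Qed.

Fact bc_lin_linear : linear bc_lin.
Proof.
have hb := bc_lin_balanced.
move=> a u v; rewrite /bc_lin bc_liftD //; congr (_ + _).
elim/bc_ind: u => [|u w hu hw|a' m].
- by rewrite scaler0 bc_lift_zero // scaler0.
- by rewrite scalerDr !bc_liftD // hu hw scalerDr.
- by rewrite scale_tens !bc_liftE // scale_tens.
Qed.

HB.instance Definition _ := GRing.isLinear.Build R (bc R M) (bc R N) _ bc_lin
  bc_lin_linear.

End BaseChangeLinear.

Arguments bc_lin R {M N}.

Lemma bc_lin_comp (R : comAlgType rat) (M N P : lmodType rat)
    (g : {linear N -> P}) (f : {linear M -> N}) u :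
  bc_lin R (g \o f) u = bc_lin R g (bc_lin R f u).
Proof.
elim/bc_ind: u => [|u v hu hv|a m]; first by rewrite !linear0.
  by rewrite !linearD /= hu hv.
by rewrite !bc_linE.
Qed.

Lemma bc_lin_id (R : comAlgType rat) (M : lmodType rat) u :
  bc_lin R (@idfun M) u = u.
Proof.
elim/bc_ind: u => [|u v hu hv|a m]; first by rewrite !linear0.
  by rewrite !linearD /= hu hv.
by rewrite !bc_linE.
Qed.

Section BaseChangeRing.
Variables (R S : comAlgType rat) (phi : {lrmorphism R -> S}) (M : lmodType rat).

Definition bc_ring : bc R M -> bc S M := bc_lift (fun a m => tens (phi a) m).

Fact bc_ring_balanced : balanced (fun a m => tens (phi a) m : bc S M).
Proof.
have [t1 t2 t3] := bc_balanced S M.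
by split=> *; rewrite ?raddfD ?linearZ ?t1 ?t2 ?t3.
Qed.

Lemma bc_ringE a m : bc_ring (tens a m) = tens (phi a) m.
Proof. by rewrite /bc_ring bc_liftE //; apply: bc_ring_balanced. Qed.

Lemma bc_ringD u v : bc_ring (u + v) = bc_ring u + bc_ring v.
Proof. by rewrite /bc_ring bc_liftD //; apply: bc_ring_balanced. Qed.

Lemma bc_ring0 : bc_ring 0 = 0.
Proof. by apply: (addIr (bc_ring 0)); rewrite -bc_ringD !add0r. Qed.

Lemma bc_ringZ a u : bc_ring (a *: u) = phi a *: bc_ring u.
Proof.
elim/bc_ind: u => [|u w hu hw|a' m]; first by rewrite scaler0 bc_ring0 scaler0.
  by rewrite scalerDr !bc_ringD hu hw scalerDr.
by rewrite scale_tens !bc_ringE scale_tens rmorphM.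
Qed.

End BaseChangeRing.

Arguments bc_ring {R S} phi {M}.

Lemma bc_ring_lin (R S : comAlgType rat) (phi : {lrmorphism R -> S})
    (M N : lmodType rat) (f : {linear M -> N}) u :
  bc_ring phi (bc_lin R f u) = bc_lin S f (bc_ring phi u).
Proof.
elim/bc_ind: u => [|u v hu hv|a m]; first by rewrite !(raddf0, bc_ring0).
  by rewrite !(raddfD, bc_ringD) hu hv.
by rewrite !(bc_linE, bc_ringE).
Qed.

(* [Rcomplex rat] is [rat[i]] with its structure of Q-algebra. *)
Notation Qi := (Rcomplex rat).

HB.instance Definition _ := GRing.Lalgebra_isComAlgebra.Build rat (Rcomplex rat).

Definition imag : Qi := Complex 0 1.

Definition conjQi (z : Qi) : Qi := conjc z.

Fact conjQi_linear : linear conjQi.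
Proof.
move=> a [x y] [x' y']; apply/eqP; rewrite eq_complex /=.
by rewrite opprD mulrN !eqxx.
Qed.

Fact conjQi_monoid : monoid_morphism conjQi.
Proof.
split=> [|[x y] [x' y']]; apply/eqP; rewrite eq_complex /= ?oppr0 ?eqxx //.
by rewrite mulrNN mulrN mulNr opprD !eqxx.
Qed.

HB.instance Definition _ := GRing.isLinear.Build rat Qi Qi _ conjQi conjQi_linear.
HB.instance Definition _ := GRing.isMonoidMorphism.Build Qi Qi conjQi conjQi_monoid.

Section Mx2.
Variable R : comNzRingType.

Definition mx2 (a b c d : R) : 'M[R]_2 :=
  \matrix_(i, j) if i == 0 then if j == 0 then a else b
                 else if j == 0 then c else d.

Lemma mulmx2 a b c d a' b' c' d' :
  mx2 a b c d *m mx2 a' b' c' d' =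
  mx2 (a * a' + b * c') (a * b' + b * d') (c * a' + d * c') (c * b' + d * d').
Proof.
by apply/matrixP => i j; rewrite !mxE !big_ord_recl big_ord0 !mxE /= addr0;
  case: ifP; case: ifP.
Qed.

Lemma mx2_1 : mx2 1 0 0 1 = 1%:M.
Proof. by apply/matrixP => -[[|[|]] // ?] [[|[|]] // ?]; rewrite !mxE. Qed.

End Mx2.

Record SO2 (R : comNzRingType) := SO2Point {
  so_x : R;
  so_y : R;
  so_eq : so_x ^+ 2 + so_y ^+ 2 = 1
}.

Section SO2.
Variable R : comNzRingType.
Implicit Types g h : SO2 R.

Definition so_mx g : 'M[R]_2 := mx2 (so_x g) (- so_y g) (so_y g) (so_x g).

Fact so_one_eq : (1 : R) ^+ 2 + 0 ^+ 2 = 1. Proof. by ring. Qed.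
Definition so_one : SO2 R := SO2Point so_one_eq.

Fact so_neg_one_eq : (-1 : R) ^+ 2 + 0 ^+ 2 = 1. Proof. by ring. Qed.
Definition so_neg_one : SO2 R := SO2Point so_neg_one_eq.

Fact so_mul_eq g h :
  (so_x g * so_x h - so_y g * so_y h) ^+ 2
  + (so_x g * so_y h + so_y g * so_x h) ^+ 2 = 1.
Proof.
rewrite -[RHS]mulr1 -{1}(so_eq g) -(so_eq h); ring.
Qed.
Definition so_mul g h : SO2 R := SO2Point (so_mul_eq g h).

Fact so_inv_eq g : so_x g ^+ 2 + (- so_y g) ^+ 2 = 1.
Proof. by rewrite sqrrN so_eq. Qed.
Definition so_inv g : SO2 R := SO2Point (so_inv_eq g).

Lemma so_mx1 : so_mx so_one = 1%:M.
Proof. by rewrite /so_mx /= oppr0 mx2_1. Qed.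

Lemma so_mxN1 : so_mx so_neg_one = - 1%:M.
Proof.
rewrite /so_mx /= oppr0 -mx2_1.
by apply/matrixP => i j; rewrite !mxE; case: ifP; case: ifP; rewrite ?oppr0.
Qed.

Lemma so_mxM g h : so_mx (so_mul g h) = so_mx g *m so_mx h.
Proof. by rewrite mulmx2 /so_mx /=; congr mx2; ring. Qed.

Lemma so_mxV g : so_mx (so_inv g) *m so_mx g = 1%:M.
Proof.
by rewrite mulmx2 /= -mx2_1; congr mx2; rewrite -?(so_eq g); ring.
Qed.

End SO2.

Section SO2Map.
Variables (R S : comNzRingType) (phi : {rmorphism R -> S}).

Fact so_map_eq (g : SO2 R) : phi (so_x g) ^+ 2 + phi (so_y g) ^+ 2 = 1.
Proof. by rewrite -!rmorphXn -rmorphD so_eq rmorph1. Qed.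

Definition so_map (g : SO2 R) : SO2 S := SO2Point (so_map_eq g).

End SO2Map.

Section Sl2.
Variable R : comNzRingType.

Definition sl2_pred : {pred 'M[R]_2} := fun A => \tr A == 0.

Fact sl2_closed : submod_closed sl2_pred.
Proof.
split=> [|a A B /eqP hA /eqP hB]; rewrite /in_mem /= /sl2_pred ?mxtrace0 //.
by rewrite linearP /= hA hB mulr0 addr0.
Qed.

HB.instance Definition _ :=
  GRing.isSubmodClosed.Build R 'M[R]_2 sl2_pred sl2_closed.

Record sl2 := Sl2 { sl2_mx : 'M[R]_2; _ : sl2_mx \in sl2_pred }.

HB.instance Definition _ := [isSub for sl2_mx].
HB.instance Definition _ := [Choice of sl2 by <:].
HB.instance Definition _ := [SubChoice_isSubLmodule of sl2 by <:].

Fact sl2_of_pred a b c : mx2 a b c (- a) \in sl2_pred.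
Proof.
by rewrite /in_mem /= /sl2_pred /mxtrace !big_ord_recl big_ord0 !mxE /=
  addr0 subrr.
Qed.
Definition sl2_of (a b c : R) : sl2 := Sl2 (sl2_of_pred a b c).

Fact sl2_br_pred (A B : sl2) :
  sl2_mx A *m sl2_mx B - sl2_mx B *m sl2_mx A \in sl2_pred.
Proof.
by rewrite /in_mem /= /sl2_pred raddfB /= (mxtrace_mulC (sl2_mx A)) subrr.
Qed.
Definition sl2_br (A B : sl2) : sl2 := Sl2 (sl2_br_pred A B).

Fact sl2_Ad_pred (g : SO2 R) (A : sl2) :
  so_mx g *m sl2_mx A *m so_mx (so_inv g) \in sl2_pred.
Proof.
case: A => A hA; rewrite /in_mem /= /sl2_pred mxtrace_mulC mulmxA so_mxV.
by rewrite mul1mx.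
Qed.
Definition sl2_Ad g A : sl2 := Sl2 (sl2_Ad_pred g A).

Lemma sl2E (A : sl2) :
  A = sl2_of (sl2_mx A 0 0) (sl2_mx A 0 1) (sl2_mx A 1 0).
Proof.
case: A => A hA; apply/val_inj => /=; apply/matrixP => i j.
have h : A 1 1 = - A 0 0.
  have /eqP : \tr A = 0 by apply/eqP.
  rewrite /mxtrace !big_ord_recl big_ord0 addr0 addrC addr_eq0 => /eqP <-.
  by congr (A _ _); apply/val_inj.
rewrite mxE; case: i j => -[|[|//]] hi [[|[|//]] hj] /=; rewrite -?h;
  by congr (A _ _); apply/val_inj.
Qed.

Lemma sl2_br_of a b c a' b' c' :
  sl2_br (sl2_of a b c) (sl2_of a' b' c') =
  sl2_of (b * c' - c * b') ((a * b' - b * a') *+ 2) ((c * a' - a * c') *+ 2).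
Proof.
apply/val_inj; rewrite /= !mulmx2; apply/matrixP => i j; rewrite !mxE.
by case: ifP; case: ifP => _ _; ring.
Qed.

End Sl2.

Arguments sl2_of {R}.

Section Sl2Map.
Variables (R S : comNzRingType) (phi : {rmorphism R -> S}).

Fact sl2_map_pred (A : sl2 R) : map_mx phi (sl2_mx A) \in @sl2_pred S.
Proof.
case: A => A hA; have /eqP h : \tr A == 0 by [].
by rewrite /in_mem /= /sl2_pred trace_map_mx h rmorph0.
Qed.
Definition sl2_map (A : sl2 R) : sl2 S := Sl2 (sl2_map_pred A).

End Sl2Map.

Section Extend.
Variables (M : lmodType rat) (L : sl2 rat -> {linear M -> M}).
Variable R : comAlgType rat.

(* sl_2(R) = R (x) sl_2(Q) acts R-linearly; the three terms are the components
   of A on the basis diag(1,-1), E_12, E_21. *)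
Definition lie_ext (A : sl2 R) (v : bc R M) : bc R M :=
  sl2_mx A 0 0 *: bc_lin R (L (sl2_of 1 0 0)) v
  + sl2_mx A 0 1 *: bc_lin R (L (sl2_of 0 1 0)) v
  + sl2_mx A 1 0 *: bc_lin R (L (sl2_of 0 0 1)) v.

Fact lie_ext_linear A : linear (lie_ext A).
Proof.
move=> a u v; rewrite /lie_ext !linearP /= !scalerDr !scalerA.
by rewrite [in RHS]addrACA [X in _ = X + _]addrACA.
Qed.

HB.instance Definition _ A :=
  GRing.isLinear.Build R (bc R M) (bc R M) _ (lie_ext A) (lie_ext_linear A).

Lemma lie_ext_of a b c v :
  lie_ext (sl2_of a b c) v =
  a *: bc_lin R (L (sl2_of 1 0 0)) v
  + b *: bc_lin R (L (sl2_of 0 1 0)) v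
  + c *: bc_lin R (L (sl2_of 0 0 1)) v.
Proof. by rewrite /lie_ext !mxE. Qed.

Lemma lie_extD A B v : lie_ext (A + B) v = lie_ext A v + lie_ext B v.
Proof.
by rewrite /lie_ext !mxE !scalerDl [in RHS]addrACA [X in _ = X + _]addrACA.
Qed.

Lemma lie_extZ a A v : lie_ext (a *: A) v = a *: lie_ext A v.
Proof. by rewrite /lie_ext !mxE !scalerDr !scalerA. Qed.

Hypothesis L_linear : forall a A B m, L (a *: A + B) m = a *: L A m + L B m.
Hypothesis L_br : forall A B m, L (sl2_br A B) m = L A (L B m) - L B (L A m).

Lemma bc_lin_br A B C n (v : bc R M) : sl2_br A B = C *+ n ->
  bc_lin R (L A) (bc_lin R (L B) v) =
  bc_lin R (L B) (bc_lin R (L A) v) + bc_lin R (L C) v *+ n.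
Proof.
move=> hC; elim/bc_ind: v => [|u w hu hw|a m].
- by rewrite !linear0 mul0rn addr0.
- by rewrite !linearD /= hu hw mulrnDl addrACA.
have L0 : L 0 m = 0.
  have := L_linear 1 0 0 m; rewrite !scale1r !addr0 => h.
  by apply: (addrI (L 0 m)); rewrite -h addr0.
have LM k : L (C *+ k) m = L C m *+ k.
  by elim: k => [|k ih]; rewrite ?mulr0n // !mulrS -[C]scale1r L_linear !scale1r ih.
have [_ tD _] := bc_balanced R M.
have tM k (m' : M) : tens a (m' *+ k) = tens a m' *+ k :> bc R M.
  elim: k => [|k ih]; last by rewrite !mulrS tD ih.
  by apply: (addrI (tens a 0)); rewrite mulr0n -tD !addr0.
rewrite !bc_linE -tM -tD; congr (tens a _).
by rewrite -LM -hC L_br addrC subrK.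
Qed.

Lemma lie_ext_br A B v :
  lie_ext (sl2_br A B) v = lie_ext A (lie_ext B v) - lie_ext B (lie_ext A v).
Proof.
rewrite [A]sl2E [B]sl2E sl2_br_of; move: (sl2_mx A 0 0) (sl2_mx A 0 1)
  (sl2_mx A 1 0) (sl2_mx B 0 0) (sl2_mx B 0 1) (sl2_mx B 1 0) => a b c a' b' c'.
have he w := @bc_lin_br (sl2_of 1 0 0) (sl2_of 0 1 0) (sl2_of 0 1 0) 2 w.
have fh w := @bc_lin_br (sl2_of 0 0 1) (sl2_of 1 0 0) (sl2_of 0 0 1) 2 w.
have ef w := @bc_lin_br (sl2_of 0 1 0) (sl2_of 0 0 1) (sl2_of 1 0 0) 1 w.
have br x y z n : sl2_of x y z *+ n = sl2_of (x *+ n) (y *+ n) (z *+ n) :> sl2 rat.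
  apply/val_inj/matrixP => i j; rewrite raddfMn /= mulmxnE !mxE.
  by case: ifP; case: ifP => _ _; rewrite ?mulNrn.
move: he fh ef; rewrite !br !sl2_br_of => he fh ef.
have {}he w := he w erefl; have {}fh w := fh w erefl; have {}ef w := ef w erefl.
have lin3 (g : {linear bc R M -> bc R M}) x y z u1 u2 u3 :
    g (x *: u1 + y *: u2 + z *: u3) = x *: g u1 + y *: g u2 + z *: g u3.
  by rewrite !linearD !linearZ.
rewrite !lie_ext_of !lin3 /= !(he, fh, ef).
move: (bc_lin R (L (sl2_of 1 0 0))) (bc_lin R (L (sl2_of 0 1 0)))
  (bc_lin R (L (sl2_of 0 0 1))) => h e f.
pose w := [:: h (h v); h (f v); e (h v); e (e v); f (e v); f (f v);
  h v; e v; f v].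
pose lc (x : nat -> R) := \sum_(i < 9) x i *: w`_i.
have lcD x y : lc x + lc y = lc (fun i => x i + y i).
  by rewrite /lc -big_split; apply: eq_bigr => i _; rewrite scalerDl.
have lcZ t x : t *: lc x = lc (fun i => t * x i).
  by rewrite /lc scaler_sumr; apply: eq_bigr => i _; rewrite scalerA.
have lcN x : - lc x = lc (fun i => - x i).
  by rewrite /lc -sumrN; apply: eq_bigr => i _; rewrite scaleNr.
have lcM x n : lc x *+ n = lc (fun i => x i *+ n).
  by rewrite /lc -sumrMnl; apply: eq_bigr => i _; rewrite scalerMnl.
have lcw k : (k < 9)%N -> w`_k = lc (fun i => (i == k)%:R).
  move=> hk; rewrite /lc (bigD1 (Ordinal hk)) //= eqxx scale1r big1 ?addr0 //.
  by move=> i /negPf hi; rewrite -[_ == k]/(i == Ordinal hk) hi scale0r.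
rewrite -[h (h v)]/(w`_0) -[h (f v)]/(w`_1) -[e (h v)]/(w`_2) -[e (e v)]/(w`_3).
rewrite -[f (e v)]/(w`_4) -[f (f v)]/(w`_5) -[h v]/(w`_6) -[e v]/(w`_7).
rewrite -[f v]/(w`_8) !lcw // !(lcD, lcZ, lcM, lcN).
by apply: eq_bigr => -[[|[|[|[|[|[|[|[|[|//]]]]]]]]] hi] _ /=; congr (_ *: _); ring.
Qed.

End Extend.

Lemma bc_ring_lie_ext (M : lmodType rat) (L : sl2 rat -> {linear M -> M})
    (R S : comAlgType rat) (phi : {lrmorphism R -> S}) A v :
  bc_ring phi (lie_ext L A v) = lie_ext L (sl2_map phi A) (bc_ring phi v).
Proof.
by rewrite /lie_ext !bc_ringD !bc_ringZ !bc_ring_lin !mxE.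
Qed.

Lemma bc_lin_lie_ext (M N : lmodType rat) (L : sl2 rat -> {linear M -> M})
    (L' : sl2 rat -> {linear N -> N}) (R : comAlgType rat) (f : {linear M -> N})
    (A : sl2 R) v :
  (forall B m, f (L B m) = L' B (f m)) ->
  bc_lin R f (lie_ext L A v) = lie_ext L' A (bc_lin R f v).
Proof.
move=> hf; have h B w : bc_lin R f (bc_lin R (L B) w) =
                        bc_lin R (L' B) (bc_lin R f w).
  elim/bc_ind: w => [|u w hu hw|a m]; first by rewrite !linear0.
    by rewrite !linearD /= hu hw.
  by rewrite !bc_linE hf.
by rewrite /lie_ext !linearD !linearZ /= !h.
Qed.

#[local] Obligation Tactic := idtac.

Record category := Category {
  obj :> Type;
  mor : obj -> obj -> Type;
  idm : forall A, mor A A;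
  compm : forall A B C, mor B C -> mor A B -> mor A C;
  comp1m : forall A B (f : mor A B), compm (idm B) f = f;
  compm1 : forall A B (f : mor A B), compm f (idm A) = f;
  compmA : forall A B C D (f : mor C D) (g : mor B C) (h : mor A B),
    compm f (compm g h) = compm (compm f g) h
}.
Arguments mor {c}.
Arguments idm {c}.
Arguments compm {c A B C}.

Record functor (C D : category) := Functor {
  fob :> C -> D;
  fmap : forall A B, mor A B -> mor (fob A) (fob B);
  fmap1 : forall A, fmap (idm A) = idm (fob A);
  fmapM : forall A B E (f : mor B E) (g : mor A B),
    fmap (compm f g) = compm (fmap f) (fmap g)
}.
Arguments fmap {C D} _ {A B}.

Program Definition id_functor (C : category) : functor C C :=
  @Functor C C (fun A => A) (fun A B f => f) _ _.
Next Obligation. by []. Qed.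
Next Obligation. by []. Qed.

Program Definition comp_functor (C D E : category) (G : functor D E)
    (F : functor C D) : functor C E :=
  @Functor C E (fun A => G (F A)) (fun A B f => fmap G (fmap F f)) _ _.
Next Obligation. by move=> C D E G F A /=; rewrite !fmap1. Qed.
Next Obligation. by move=> C D E G F A B A1 f g /=; rewrite !fmapM. Qed.

Definition iso_hom (C : category) (A B : C) (f : mor A B) : Prop :=
  exists g : mor B A, compm g f = idm A /\ compm f g = idm B.

Definition nat_iso (C D : category) (F G : functor C D) : Prop :=
  exists t : forall A : C, mor (F A) (G A),
    (forall A, iso_hom (t A)) /\
    (forall A B (f : mor A B), compm (t B) (fmap F f) = compm (fmap G f) (t A)).

Definition is_equivalence (C D : category) (F : functor C D) : Prop :=
  exists G : functor D C,
    nat_iso (comp_functor G F) (id_functor C) /\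
    nat_iso (comp_functor F G) (id_functor D).

Program Definition full_subcategory (C : category) (P : C -> Prop) : category :=
  @Category {A : C | P A} (fun A B => mor (sval A) (sval B))
    (fun A => idm (sval A)) (fun A B D f g => compm f g) _ _ _.
Next Obligation. by move=> *; apply: comp1m. Qed.
Next Obligation. by move=> *; apply: compm1. Qed.
Next Obligation. by move=> *; apply: compmA. Qed.

Program Definition full_restrict (C D : category) (P : C -> Prop) (Q : D -> Prop)
    (F : functor C D) (wd : forall A, P A -> Q (F A)) :
    functor (full_subcategory P) (full_subcategory Q) :=
  @Functor (full_subcategory P) (full_subcategory Q)
    (fun A => exist Q (F (sval A)) (wd (sval A) (svalP A)))
    (fun A B f => fmap F f) _ _.
Next Obligation. by move=> *; apply: fmap1. Qed.
Next Obligation. by move=> *; apply: fmapM. Qed.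

Definition dual_numbers : comAlgType rat := {poly %/ ('X^2 : {poly rat})}.
Definition eps : dual_numbers := in_qpoly 'X^2 'X.

Fact eps2 : eps ^+ 2 = 0.
Proof.
rewrite /eps -rmorphXn /=; apply/val_inj => /=.
by rewrite mk_monic_Xn /= Pdiv.RingMonic.rmodpp ?monicXn.
Qed.

Fact so_tangent_eq (t : rat) : (1 : dual_numbers) ^+ 2 + (t *: eps) ^+ 2 = 1.
Proof. by rewrite exprZn eps2 scaler0 addr0 expr1n. Qed.

(* The point 1 + eps Z of SO(2) over Q[eps], where Z = [0, -t; t, 0]. *)
Definition so_tangent (t : rat) : SO2 dual_numbers := SO2Point (so_tangent_eq t).

(* A rational representation of the group scheme SO(2) is an R-linear action of
   SO(2)(R) on R (x) M, functorial in the commutative Q-algebra R (the zero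
   ring, which is not a [comAlgType], would add nothing since then
   R (x) M = 0).  Lie K consists of the matrices Z = [0, -t; t, 0]. *)
Record gKmodule := GKmodule {
  gK_space :> lmodType rat;
  lie : sl2 rat -> {linear gK_space -> gK_space};
  K_act : forall R : comAlgType rat,
    SO2 R -> {linear bc R gK_space -> bc R gK_space};
  lie_linear : forall a A B m, lie (a *: A + B) m = a *: lie A m + lie B m;
  lie_br : forall A B m, lie (sl2_br A B) m = lie A (lie B m) - lie B (lie A m);
  act_one : forall (R : comAlgType rat) u, K_act (so_one R) u = u;
  act_mul : forall (R : comAlgType rat) (g h : SO2 R) u,
    K_act (so_mul g h) u = K_act g (K_act h u);
  act_natural : forall (R S : comAlgType rat) (phi : {lrmorphism R -> S})
    (g : SO2 R) u, bc_ring phi (K_act g u) = K_act (so_map phi g) (bc_ring phi u);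
  act_Ad : forall (R : comAlgType rat) (g : SO2 R) (A : sl2 R) u,
    K_act g (lie_ext lie A u) = lie_ext lie (sl2_Ad g A) (K_act g u);
  act_differential : forall (t : rat) m,
    K_act (so_tangent t) (tens 1 m) =
    tens 1 m + tens eps (lie (sl2_of 0 (- t) t) m)
}.

Arguments lie : clear implicits.
Arguments K_act M {R} : rename.

Record gKhom (M N : gKmodule) := GKhom {
  gKhom_fun :> {linear M -> N};
  gKhom_lie : forall A m, gKhom_fun (lie M A m) = lie N A (gKhom_fun m);
  gKhom_act : forall (R : comAlgType rat) (g : SO2 R) u,
    bc_lin R gKhom_fun (K_act M g u) = K_act N g (bc_lin R gKhom_fun u)
}.

Lemma linear_eq (R : pzRingType) (U : lmodType R) (V : zmodType)
  (s : R -> V -> V) (f g : {linear U -> V | s}) : f =1 g -> f = g.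
Proof.
move: f g => [f [[fz] [fs]]] [g [[gz] [gs]]] /= /funext fg; subst g.
by rewrite (Prop_irrelevance fz gz) (Prop_irrelevance fs gs).
Qed.

Lemma gKhom_eq (M N : gKmodule) (f g : gKhom M N) : f =1 g -> f = g.
Proof.
move: f g => [f fl fa] [g gl ga] /= /linear_eq fg; subst g.
by rewrite (Prop_irrelevance fl gl) (Prop_irrelevance fa ga).
Qed.

Fact gK_id_lie (M : gKmodule) A m : idfun (lie M A m) = lie M A (idfun m).
Proof. by []. Qed.

Fact gK_id_act (M : gKmodule) (R : comAlgType rat) (g : SO2 R) u :
  bc_lin R (@idfun M) (K_act M g u) = K_act M g (bc_lin R (@idfun M) u).
Proof. by rewrite !bc_lin_id. Qed.

Definition gK_id (M : gKmodule) : gKhom M M :=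
  GKhom (@gK_id_lie M) (@gK_id_act M).

Section GKComp.
Variables (M N P : gKmodule) (f : gKhom N P) (g : gKhom M N).

Fact gK_comp_lie A m : (f \o g) (lie M A m) = lie P A ((f \o g) m).
Proof. by rewrite /= !gKhom_lie. Qed.

Fact gK_comp_act (R : comAlgType rat) (k : SO2 R) u :
  bc_lin R (f \o g) (K_act M k u) = K_act P k (bc_lin R (f \o g) u).
Proof. by rewrite !bc_lin_comp !gKhom_act. Qed.

Definition gK_comp : gKhom M P := GKhom gK_comp_lie gK_comp_act.

End GKComp.

Program Definition gKmod : category :=
  @Category gKmodule gKhom gK_id gK_comp _ _ _.
Next Obligation. by move=> *; apply: gKhom_eq. Qed.
Next Obligation. by move=> *; apply: gKhom_eq. Qed.
Next Obligation. by move=> *; apply: gKhom_eq. Qed.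

Section Eigen.
Variables (K : fieldType) (V : lmodType K) (f : {linear V -> V}) (a : K).

Definition eigen_pred : {pred V} := fun v => f v == a *: v.

Fact eigen_closed : submod_closed eigen_pred.
Proof.
split=> [|b u v /eqP hu /eqP hv]; rewrite /in_mem /= /eigen_pred.
  by rewrite linear0 scaler0.
by rewrite linearP hu hv scalerDr !scalerA mulrC.
Qed.

HB.instance Definition _ :=
  GRing.isSubmodClosed.Build K V eigen_pred eigen_closed.

Record eigen := Eigen { eigen_val : V; _ : eigen_val \in eigen_pred }.

HB.instance Definition _ := [isSub for eigen_val].
HB.instance Definition _ := [Choice of eigen by <:].
HB.instance Definition _ := [SubChoice_isSubLmodule of eigen by <:].

Lemma eigenP (u : eigen) : f (val u) = a *: val u.
Proof. by case: u => u /= /eqP. Qed.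

End Eigen.

Section EigenMap.
Variables (K : fieldType) (sigma : {rmorphism K -> K}) (V W : lmodType K).
Variables (f : {linear V -> V}) (a : K) (f' : {linear W -> W}) (b : K).
Variable g : V -> W.
Hypothesis gD : {morph g : u v / u + v}.
Hypothesis gZ : forall c u, g (c *: u) = sigma c *: g u.
Hypothesis g_eigen : forall u, f u = a *: u -> f' (g u) = b *: g u.

Fact eigen_map_subproof (u : eigen f a) : g (val u) \in eigen_pred f' b.
Proof. by apply/eqP/g_eigen/eigenP. Qed.

Definition eigen_map (u : eigen f a) : eigen f' b :=
  Eigen (eigen_map_subproof u).

Fact eigen_map_linear c u v :
  eigen_map (c *: u + v) = sigma c *: eigen_map u + eigen_map v.
Proof. by apply/val_inj; rewrite /= gD gZ. Qed.

End EigenMap.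

Definition sl2H : sl2 Qi := sl2_of 0 (- imag) imag.
Definition sl2X : sl2 Qi := 2^-1 *: sl2_of 1 imag imag.
Definition sl2Y : sl2 Qi := 2^-1 *: sl2_of 1 (- imag) (- imag).

Lemma sl2_scale (R : comNzRingType) (t a b c : R) :
  t *: sl2_of a b c = sl2_of (t * a) (t * b) (t * c).
Proof.
apply/val_inj/matrixP => i j; rewrite /= !mxE.
by case: ifP; case: ifP => _ _; rewrite ?mulrN.
Qed.

Lemma sl2_HX : sl2_br sl2H sl2X = 2 *: sl2X.
Proof. by rewrite /sl2X /sl2H !sl2_scale sl2_br_of; congr sl2_of. Qed.

Lemma sl2_HY : sl2_br sl2H sl2Y = (-2) *: sl2Y.
Proof. by rewrite /sl2Y /sl2H !sl2_scale sl2_br_of; congr sl2_of. Qed.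

Lemma sl2_XY : sl2_br sl2X sl2Y = sl2H.
Proof. by rewrite /sl2X /sl2Y /sl2H !sl2_scale sl2_br_of; congr sl2_of. Qed.

Lemma sl2_map_of (R S : comNzRingType) (phi : {rmorphism R -> S}) a b c :
  sl2_map phi (sl2_of a b c) = sl2_of (phi a) (phi b) (phi c).
Proof.
apply/val_inj/matrixP => i j; rewrite /= !mxE.
by case: ifP; case: ifP => _ _; rewrite ?rmorphN.
Qed.

Lemma conj_H : sl2_map conjQi sl2H = (-1) *: sl2H.
Proof. by rewrite sl2_map_of sl2_scale; congr sl2_of. Qed.

Lemma conj_X : sl2_map conjQi sl2X = sl2Y.
Proof. by rewrite /sl2X /sl2Y !sl2_scale sl2_map_of; congr sl2_of. Qed.

Lemma conj_Y : sl2_map conjQi sl2Y = sl2X.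
Proof. by rewrite /sl2X /sl2Y !sl2_scale sl2_map_of; congr sl2_of. Qed.

Section Weights.
Variable M : gKmodule.

Definition H_act : {linear bc Qi M -> bc Qi M} := lie_ext (lie M) sl2H.
Definition X_act : {linear bc Qi M -> bc Qi M} := lie_ext (lie M) sl2X.
Definition Y_act : {linear bc Qi M -> bc Qi M} := lie_ext (lie M) sl2Y.
Definition c_act : bc Qi M -> bc Qi M := bc_ring conjQi.

(* H, X, Y are defined over F only, so C acts here on M_F; it preserves the
   rational subspace 1 (x) M, on which its nilpotency is tested below. *)
Definition casimir (v : bc Qi M) : bc Qi M :=
  H_act (H_act v) - 2 *: H_act v + 4 *: X_act (Y_act v) + v.

Definition weight_space (n : int) : lmodType Qi := eigen H_act n%:~R.

Lemma H_X v : H_act (X_act v) = X_act (H_act v) + 2 *: X_act v.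
Proof.
have := lie_ext_br (@lie_linear M) (@lie_br M) sl2H sl2X v.
by rewrite sl2_HX lie_extZ => ->; rewrite addrC subrK.
Qed.

Lemma H_Y v : H_act (Y_act v) = Y_act (H_act v) + (-2) *: Y_act v.
Proof.
have := lie_ext_br (@lie_linear M) (@lie_br M) sl2H sl2Y v.
by rewrite sl2_HY lie_extZ => ->; rewrite addrC subrK.
Qed.

Lemma c_H v : H_act (c_act v) = (-1) *: c_act (H_act v).
Proof.
by rewrite /c_act bc_ring_lie_ext conj_H lie_extZ scalerA mulrNN mulr1 scale1r.
Qed.

Lemma c_X v : Y_act (c_act v) = c_act (X_act v).
Proof. by rewrite /c_act bc_ring_lie_ext conj_X. Qed.

Lemma c_Y v : X_act (c_act v) = c_act (Y_act v).
Proof. by rewrite /c_act bc_ring_lie_ext conj_Y. Qed.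

Lemma c_actK : involutive c_act.
Proof.
elim/bc_ind => [|u v hu hv|a m]; first by rewrite /c_act !bc_ring0.
  by rewrite /c_act !bc_ringD -!/(c_act _) hu hv.
rewrite /c_act !bc_ringE; congr (tens _ m); case: a => x y.
by apply/eqP; rewrite eq_complex /= opprK !eqxx.
Qed.

Lemma X_weight n v :
  H_act v = n%:~R *: v -> H_act (X_act v) = (n + 2)%:~R *: X_act v.
Proof. by move=> h; rewrite H_X h linearZ /= -scalerDl rmorphD. Qed.

Lemma Y_weight n v :
  H_act v = n%:~R *: v -> H_act (Y_act v) = (n - 2)%:~R *: Y_act v.
Proof. by move=> h; rewrite H_Y h linearZ /= -scalerDl rmorphB. Qed.

Lemma c_weight n v :
  H_act v = n%:~R *: v -> H_act (c_act v) = (- n)%:~R *: c_act v.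
Proof.
move=> h; rewrite c_H h /c_act bc_ringZ scalerA; congr (_ *: _).
by rewrite mulN1r rmorph_int rmorphN.
Qed.

End Weights.

Definition finite_dim (K : fieldType) (V : lmodType K) : Prop :=
  exists (n : nat) (e : 'I_n -> V),
    forall v, exists a : 'I_n -> K, v = \sum_i a i *: e i.

(* U(g) acts on M through the subalgebra of End(M) generated by g. *)
Inductive env_action (M : gKmodule) : (M -> M) -> Prop :=
  | env_scalar (a : rat) : env_action (fun m => a *: m)
  | env_lie (A : sl2 rat) : env_action (lie M A)
  | env_add u v : env_action u -> env_action v -> env_action (fun m => u m + v m)
  | env_mul u v : env_action u -> env_action v -> env_action (fun m => u (v m)).

Definition fg_over_U (M : gKmodule) : Prop :=
  exists (n : nat) (e : 'I_n -> M), forall m, exists u : 'I_n -> M -> M,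
    (forall i, env_action (u i)) /\ m = \sum_i u i (e i).

Definition harish_chandra (M : gKmodule) : Prop :=
  fg_over_U M /\ forall n : int, finite_dim (weight_space M n).

Definition HC0_pred (M : gKmod) : Prop :=
  [/\ harish_chandra M,
      exists k : nat, forall m : M, iter k (@casimir M) (tens 1 m) = 0
    & forall m : M, K_act M (so_neg_one rat^o) (tens 1 m) = - tens 1 m].

Definition HC0 : category := full_subcategory HC0_pred.

Notation "{ 'semilinear' U -> V }" := {linear U -> V | conjQi \; *:%R}
  (at level 0, U at level 98, V at level 99, format "{ 'semilinear'  U  ->  V }")
  : type_scope.

(* The suffixes m and p stand for the vertices - and +; the c-semi-linear maps
   vphi_m and vphi_p are the rational structure. *)
Record qrep := QRep {
  Vm : lmodType Qi;
  Vp : lmodType Qi;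
  phi_a : {linear Vm -> Vp};
  phi_b : {linear Vp -> Vm};
  vphi_m : {semilinear Vm -> Vp};
  vphi_p : {semilinear Vp -> Vm};
  vphi_mK : cancel vphi_m vphi_p;
  vphi_pK : cancel vphi_p vphi_m;
  vphi_a : forall v, phi_b (vphi_m v) = vphi_p (phi_a v);
  vphi_b : forall v, phi_a (vphi_p v) = vphi_m (phi_b v)
}.

Record qrep_hom (V W : qrep) := QRepHom {
  hom_m : {linear Vm V -> Vm W};
  hom_p : {linear Vp V -> Vp W};
  hom_a : forall v, hom_p (phi_a V v) = phi_a W (hom_m v);
  hom_b : forall v, hom_m (phi_b V v) = phi_b W (hom_p v);
  hom_vphi_m : forall v, hom_p (vphi_m V v) = vphi_m W (hom_m v);
  hom_vphi_p : forall v, hom_m (vphi_p V v) = vphi_p W (hom_p v)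
}.

Lemma qrep_hom_eq (V W : qrep) (f g : qrep_hom V W) :
  hom_m f =1 hom_m g -> hom_p f =1 hom_p g -> f = g.
Proof.
move: f g => [fm fp f1 f2 f3 f4] [gm gp g1 g2 g3 g4] /= /linear_eq hm /linear_eq hp.
by subst gm gp; congr QRepHom; apply: Prop_irrelevance.
Qed.

Definition qrep_id (V : qrep) : qrep_hom V V :=
  @QRepHom V V idfun idfun (fun=> erefl) (fun=> erefl) (fun=> erefl) (fun=> erefl).

Program Definition qrep_comp (U V W : qrep) (f : qrep_hom V W)
    (g : qrep_hom U V) : qrep_hom U W :=
  @QRepHom U W (hom_m f \o hom_m g) (hom_p f \o hom_p g) _ _ _ _.
Next Obligation. by move=> *; rewrite /= !hom_a. Qed.
Next Obligation. by move=> *; rewrite /= !hom_b. Qed.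
Next Obligation. by move=> *; rewrite /= !hom_vphi_m. Qed.
Next Obligation. by move=> *; rewrite /= !hom_vphi_p. Qed.

Program Definition qrepCat : category :=
  @Category qrep qrep_hom qrep_id qrep_comp _ _ _.
Next Obligation. by move=> *; apply: qrep_hom_eq. Qed.
Next Obligation. by move=> *; apply: qrep_hom_eq. Qed.
Next Obligation. by move=> *; apply: qrep_hom_eq. Qed.

(* Vertices are booleans, [true] for + and [false] for -, so that both arrows
   go from s to ~~ s, and there is one path of each length n from s. *)
Definition vertex_space (V : qrep) (s : bool) : lmodType Qi :=
  if s then Vp V else Vm V.

Definition arrow_map (V : qrep) (s : bool) :
    vertex_space V s -> vertex_space V (~~ s) :=
  if s return vertex_space V s -> vertex_space V (~~ s) then phi_b V else phi_a V.

Fixpoint quiver_path (V : qrep) (s : bool) (n : nat) :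
    vertex_space V s -> vertex_space V (iter n negb s) :=
  if n is n'.+1 return vertex_space V s -> vertex_space V (iter n negb s)
  then fun v => arrow_map (quiver_path n' v)
  else id.

Definition nilpotent_rep (V : qrep) : Prop :=
  exists N : nat, forall (n : nat) (s : bool) (v : vertex_space V s),
    (N <= n)%N -> quiver_path n v = 0.

Definition finite_nilpotent (V : qrepCat) : Prop :=
  [/\ finite_dim (Vm V), finite_dim (Vp V) & nilpotent_rep V].

Definition nilQRep : category := full_subcategory finite_nilpotent.

Definition linear_of (U V : lmodType Qi) (f : U -> V) (hf : linear f) :
    {linear U -> V} := HB.pack f (GRing.isLinear.Build Qi U V _ f hf).

Definition semilinear_of (U V : lmodType Qi) (f : U -> V)
    (hf : linear_for (conjQi \; *:%R) f) : {semilinear U -> V} :=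
  HB.pack f (GRing.isLinear.Build Qi U V (conjQi \; *:%R) f hf).

Section FunctorE.
Variable M : gKmodule.

Definition E_phi_a : {linear weight_space M (-1) -> weight_space M 1} :=
  linear_of (@eigen_map_linear Qi idfun _ _ _ _ _ _ (X_act M)
    (linearD (X_act M)) (linearZ_LR (X_act M)) (@X_weight M (-1))).

Definition E_phi_b : {linear weight_space M 1 -> weight_space M (-1)} :=
  linear_of (@eigen_map_linear Qi idfun _ _ _ _ _ _ (Y_act M)
    (linearD (Y_act M)) (linearZ_LR (Y_act M)) (@Y_weight M 1)).

Definition E_vphi_m : {semilinear weight_space M (-1) -> weight_space M 1} :=
  semilinear_of (@eigen_map_linear Qi conjQi _ _ _ _ _ _ (@c_act M)
    (@bc_ringD _ _ conjQi M) (@bc_ringZ _ _ conjQi M) (@c_weight M (-1))).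

Definition E_vphi_p : {semilinear weight_space M 1 -> weight_space M (-1)} :=
  semilinear_of (@eigen_map_linear Qi conjQi _ _ _ _ _ _ (@c_act M)
    (@bc_ringD _ _ conjQi M) (@bc_ringZ _ _ conjQi M) (@c_weight M 1)).

Program Definition E_ob : qrep :=
  @QRep (weight_space M (-1)) (weight_space M 1)
    E_phi_a E_phi_b E_vphi_m E_vphi_p _ _ _ _.
Next Obligation. by move=> u; apply/val_inj; apply: c_actK. Qed.
Next Obligation. by move=> u; apply/val_inj; apply: c_actK. Qed.
Next Obligation. by move=> u; apply/val_inj; apply: c_X. Qed.
Next Obligation. by move=> u; apply/val_inj; apply: c_Y. Qed.

End FunctorE.

Section FunctorEHom.
Variables (M N : gKmodule) (f : gKhom M N).

Fact E_weight (n : int) v :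
  H_act M v = n%:~R *: v ->
  H_act N (bc_lin Qi f v) = n%:~R *: bc_lin Qi f v.
Proof.
move=> h; rewrite -linearZ -h /=; apply/esym/bc_lin_lie_ext => *.
exact: gKhom_lie.
Qed.

Definition E_hom_n (n : int) : {linear weight_space M n -> weight_space N n} :=
  linear_of (@eigen_map_linear Qi idfun _ _ _ _ _ _ (bc_lin Qi f)
    (linearD (bc_lin Qi f)) (linearZ_LR (bc_lin Qi f)) (@E_weight n)).

Program Definition E_hom : qrep_hom (E_ob M) (E_ob N) :=
  @QRepHom (E_ob M) (E_ob N) (E_hom_n (-1)) (E_hom_n 1) _ _ _ _.
Next Obligation.
move=> v; apply/val_inj/bc_lin_lie_ext => *; exact: gKhom_lie.
Qed.
Next Obligation.
move=> v; apply/val_inj/bc_lin_lie_ext => *; exact: gKhom_lie.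
Qed.
Next Obligation. by move=> v; apply/val_inj/esym/bc_ring_lin. Qed.
Next Obligation. by move=> v; apply/val_inj/esym/bc_ring_lin. Qed.

End FunctorEHom.

Program Definition E_functor : functor gKmod qrepCat :=
  @Functor gKmod qrepCat E_ob E_hom _ _.
Next Obligation.
by move=> M; apply: qrep_hom_eq => v; apply/val_inj/bc_lin_id.
Qed.
Next Obligation.
by move=> M N P f g; apply: qrep_hom_eq => v; apply/val_inj/bc_lin_comp.
Qed.

(* Main.v *)
From HB Require Import structures.
From mathcomp Require Import all_boot all_order all_algebra.
From mathcomp Require Import boolp functions complex ring lra zify.
Require Import Defs.

(** Why the theorem holds.

Complex conjugation c exchanges the two vertices of the quiver, so a rational
representation amounts to one F-space W = V(+) with the c-semi-linear
endomorphism theta = c o phi_b, and it is nilpotent exactly when theta is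
([nilpotent_repP]).  For the representation attached to a module M this is
W = M_1 and theta v = c (Y v); since theta^2 = X Y = C / 4 on M_1, nilpotency of
C gives nilpotency of theta ([E_well_defined]).

Conjugation also exchanges M_n and M_(-n), so M itself, as a rational vector
space, is the sum of the M_n with n > 0 odd, embedded by w |-> Re w, where
2 Re w = w + c w.  On M_n one has 4 Y X = C - (n + 1)^2 and on M_(n+2) one has
4 X Y = C - (n + 1)^2, with C nilpotent, so X : M_n -> M_(n+2) is bijective for
n > 0, and M is the sum of the X^k M_1 with
  Y X^(k+1) v = X^k (theta^2 - (k + 1)^2) v,    Re (Y v) = Re (theta v).
These formulas involve only (W, theta).  They define, for any pair (W, theta), a
module of finitely supported sequences f : nat -> W, the k-th term standing for
X^k (f k) of weight 2 k + 1; the point (x, y) of SO(2) acts there by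
(x - i y)^(2 k + 1).  This is the inverse functor ([ladder_gK], [G_functor]).
The sum f |-> Re (sum_k X^k (f k)) is a natural morphism from the module built
on (M_1, theta) to M ([comparison_hom]), bijective by the above, and reading off
the term of weight 1 gives the other isomorphism ([counit]).

The input that is not formal is the decomposition of M into weights, which has
to be extracted from the functor of points of the representation of SO(2)
([isotypic_decomposition]).  Let (x_n, y_n) be the n-th power of (x, y).
Applying the universal point, whose coordinates lie in Q[x, y] / (x^2 + y^2 - 1),
to m gives an expression sum_n x_n (x) a_n + y_n (x) b_n valid at all points.
Since the functions x_n and y_n are linearly independent, already on the
F-points, the group law forces each pair (a_n, b_n) to rotate with speed n, and
the tangent vector at 1 turns this into Z a_n = n b_n, Z b_n = - n a_n for the
generator Z = - i H of Lie SO(2).  That -1 acts by -1 leaves only odd n.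

Throughout, P, S and Z denote the rational basis diag(1, -1) = X + Y,
[0, 1; 1, 0] = - i (X - Y) and [0, -1; 1, 0] = - i H of sl_2. *)

Set Implicit Arguments.
Unset Strict Implicit.
Unset Printing Implicit Defensive.

Import Order.TTheory GRing.Theory Num.Theory.

Local Open Scope ring_scope.

(** * Identities between linear combinations *)

(** Two formal linear combinations have the same value as soon as their
    coefficients at each atom agree; [module_with] reduces an identity in a
    module to such identities of scalars, left to [ring] or [field]. *)
Inductive modexpr (K : Type) :=
  | MVar of nat | MZero | MAdd of modexpr K & modexpr K | MOpp of modexpr K
  | MScale of K & modexpr K.
Arguments MVar {K}.
Arguments MZero {K}.

Section ModExpr.
Variables (K : pzRingType) (V : lmodType K).

Fixpoint meval (s : seq V) (e : modexpr K) : V :=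
  match e with
  | MVar i => s`_i
  | MZero => 0
  | MAdd e1 e2 => meval s e1 + meval s e2
  | MOpp e1 => - meval s e1
  | MScale a e1 => a *: meval s e1
  end.

Fixpoint mcoef (i : nat) (e : modexpr K) : K :=
  match e with
  | MVar j => if eqn i j then 1 else 0
  | MZero => 0
  | MAdd e1 e2 => mcoef i e1 + mcoef i e2
  | MOpp e1 => - mcoef i e1
  | MScale a e1 => a * mcoef i e1
  end.

Fixpoint all_coef (n : nat) (e1 e2 : modexpr K) : Prop :=
  if n is n'.+1 then mcoef n' e1 = mcoef n' e2 /\ all_coef n' e1 e2 else True.

Lemma mevalE s e : meval s e = \sum_(i < size s) mcoef i e *: s`_i.
Proof.
elim: e => /= [j||e1 -> e2 ->|e ->|a e ->].
- case: (ltnP j (size s)) => hj; last first.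
    rewrite nth_default // big1 // => i _.
    by rewrite eqnE (ltn_eqF (leq_trans (ltn_ord i) hj)) scale0r.
  rewrite (bigD1 (Ordinal hj)) //= eqnE eqxx scale1r big1 ?addr0 // => i.
  by rewrite -val_eqE /= => /negPf ->; rewrite scale0r.
- by rewrite big1 // => i _; rewrite scale0r.
- by rewrite -big_split; apply: eq_bigr => i _; rewrite scalerDl.
- by rewrite -sumrN; apply: eq_bigr => i _; rewrite scaleNr.
- by rewrite scaler_sumr; apply: eq_bigr => i _; rewrite scalerA.
Qed.

Lemma meval_eq s e1 e2 : all_coef (size s) e1 e2 -> meval s e1 = meval s e2.
Proof.
move=> h; rewrite !mevalE; apply: eq_bigr => i _; congr (_ *: _).
by elim: (size s) h i => [_ []//|n ih /= [h0 h1] i]; case: (unliftP ord_max i) =>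
  [j ->|-> //]; rewrite /= /bump leqNgt ltn_ord add0n; apply: ih.
Qed.

End ModExpr.

Ltac mod_index x s :=
  match s with
  | x :: _ => constr:(0%N)
  | _ :: ?s' => let n := mod_index x s' in constr:(S n)
  end.

Ltac mod_atoms s t :=
  match t with
  | GRing.zero => s
  | GRing.add ?a ?b => let s1 := mod_atoms s a in mod_atoms s1 b
  | GRing.opp ?a => mod_atoms s a
  | GRing.scale _ ?a => mod_atoms s a
  | _ => match goal with
         | _ => let n := mod_index t s in s
         | _ => constr:(cons t s)
         end
  end.

Ltac mod_reify K s t :=
  match t with
  | GRing.zero => constr:(@MZero K)
  | GRing.add ?a ?b => let x := mod_reify K s a in let y := mod_reify K s b in
      constr:(MAdd x y)
  | GRing.opp ?a => let x := mod_reify K s a in constr:(MOpp x)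
  | GRing.scale ?k ?a => let x := mod_reify K s a in constr:(@MScale K k x)
  | _ => let n := mod_index t s in constr:(@MVar K n)
  end.

Ltac module_with V :=
  lazymatch type of V with
  | GRing.Lmodule.type ?K =>
  lazymatch goal with
  | |- @eq ?T ?a ?b =>
    let s1 := mod_atoms (@nil T) a in
    let s := mod_atoms s1 b in
    let x := mod_reify (GRing.PzRing.sort K) s a in
    let y := mod_reify (GRing.PzRing.sort K) s b in
    change (@meval K V s x = @meval K V s y); apply: meval_eq;
    cbv [all_coef size mcoef eqn]; repeat split;
    rewrite ?(mulr0, mulr1, mul0r, mul1r, addr0, add0r, oppr0)
  end end.

(** * Finitely supported sequences *)

Section FinSeq.
Variable V : lmodType rat.

Definition fin_pred : {pred nat -> V} :=
  fun f => `[< exists N, forall k, (N <= k)%N -> f k = 0 >].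

Fact fin_closed : submod_closed fin_pred.
Proof.
split=> [|a f g /asboolP[N hf] /asboolP[N' hg]]; apply/asboolP.
  by exists 0%N.
exists (N + N')%N => k hk; rewrite -[LHS]/(a *: f k + g k) hf ?hg ?scaler0 ?addr0 //.
  exact: leq_trans (leq_addl _ _) hk.
exact: leq_trans (leq_addr _ _) hk.
Qed.

HB.instance Definition _ :=
  GRing.isSubmodClosed.Build rat (nat -> V) fin_pred fin_closed.

Record fseq := FSeq { fs_fun :> nat -> V; _ : fs_fun \in fin_pred }.

HB.instance Definition _ := [isSub for fs_fun].
HB.instance Definition _ := [Choice of fseq by <:].
HB.instance Definition _ := [SubChoice_isSubLmodule of fseq by <:].

Implicit Types f g : fseq.

Lemma fs_ext f g : f =1 g -> f = g.
Proof. by move=> h; apply/val_inj/funext. Qed.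

Lemma fs0E k : (0 : fseq) k = 0. Proof. by []. Qed.
Lemma fsDE f g k : (f + g) k = f k + g k. Proof. by []. Qed.
Lemma fsNE f k : (- f) k = - f k. Proof. by []. Qed.
Lemma fsZE a f k : (a *: f) k = a *: f k. Proof. by []. Qed.
Definition fsE := (fs0E, fsDE, fsNE, fsZE).

Lemma fs_bounded f : exists N, forall k, (N <= k)%N -> f k = 0.
Proof. by case: f => f /= /asboolP. Qed.

Definition fs_bound f : nat := sval (cid (fs_bounded f)).

Lemma fs_boundP f k : (fs_bound f <= k)%N -> f k = 0.
Proof. exact: (svalP (cid (fs_bounded f))). Qed.

Fact fs_fin (h : nat -> V) N : (forall k, (N <= k)%N -> h k = 0) -> h \in fin_pred.
Proof. by move=> hN; apply/asboolP; exists N. Qed.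

Fact single_fin k v : (fun j => if j == k then v else 0) \in fin_pred.
Proof. by apply: (@fs_fin _ k.+1) => j hj; rewrite gtn_eqF. Qed.

Definition single k v : fseq := FSeq (single_fin k v).

Lemma singleE k v j : single k v j = if j == k then v else 0.
Proof. by []. Qed.

Fact single_linear k : linear (single k).
Proof.
move=> a u v; apply: fs_ext => j; rewrite !fsE !singleE.
by case: eqP => // _; rewrite scaler0 addr0.
Qed.
HB.instance Definition _ k := GRing.isLinear.Build rat V fseq _ (single k)
  (single_linear k).

Section Sum.
Variables (W : zmodType) (phi : nat -> V -> W).
Hypothesis phiD : forall k, {morph phi k : u v / u + v}.

Let phi0 k : phi k 0 = 0.
Proof. by apply: (addIr (phi k 0)); rewrite -phiD !add0r. Qed.

(** The map out of the direct sum of copies of [V] with components [phi k]. *)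
Definition fs_sum f : W := \sum_(k < fs_bound f) phi k (f k).

Lemma fs_sumE N f : (forall k, (N <= k)%N -> f k = 0) ->
  fs_sum f = \sum_(k < N) phi k (f k).
Proof.
rewrite /fs_sum; move: (@fs_boundP f); move: (fs_bound f) => N' hN' hN.
pose S n := \sum_(k < n) phi k (f k).
have widen n n' : (forall k, (n <= k)%N -> f k = 0) -> S (maxn n n') = S n.
  move=> hn; rewrite maxnE /S big_split_ord /= [X in _ + X]big1 ?addr0 // => i _.
  by rewrite hn ?phi0 // leq_addr.
by rewrite -/(S N') -/(S N) -(widen N' N) // maxnC widen.
Qed.

Lemma fs_sumD : {morph fs_sum : f g / f + g}.
Proof.
move=> f g; pose N := maxn (fs_bound f) (fs_bound g).
have hf k : (N <= k)%N -> f k = 0.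
  by rewrite geq_max => /andP[h _]; apply: fs_boundP.
have hg k : (N <= k)%N -> g k = 0.
  by rewrite geq_max => /andP[_ h]; apply: fs_boundP.
rewrite !(@fs_sumE N) // => [|k hk]; last by rewrite fsE hf ?hg ?addr0.
by rewrite -big_split; apply: eq_bigr => k _; rewrite fsE phiD.
Qed.

Lemma fs_sum_single k v : fs_sum (single k v) = phi k v.
Proof.
rewrite (@fs_sumE k.+1) => [|j hj]; last by rewrite singleE gtn_eqF.
rewrite big_ord_recr /= eqxx big1 ?add0r // => j _.
by rewrite ltn_eqF ?phi0.
Qed.

End Sum.

Lemma fs_sum_singles f : f = \sum_(k < fs_bound f) single k (f k).
Proof.
apply: fs_ext => j.
have -> (N : nat) : (\sum_(k < N) single k (f k)) j = if (j < N)%N then f j else 0.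
  elim: N => [|N ih]; first by rewrite big_ord0.
  rewrite big_ord_recr fsE ih singleE ltnS; case: ltngtP => [||->] //=;
    by rewrite ?addr0 ?add0r.
by case: ltnP => // /fs_boundP.
Qed.

Lemma fs_ind (P : fseq -> Prop) :
  P 0 -> (forall f g, P f -> P g -> P (f + g)) ->
  (forall k v, P (single k v)) -> forall f, P f.
Proof.
move=> P0 PD Ps f; rewrite (fs_sum_singles f).
by elim/big_ind: _.
Qed.

End FinSeq.
Arguments single {V}.

(** * The operators of the ladder attached to (W, theta) *)

(** Here [V] is W with its multiplication [J] by i.  The sequence [f] stands for
    the sum of the X^k (f k). *)
Section Ladder.
Variables (V : lmodType rat) (J theta : {linear V -> V}).
Hypothesis JJ : forall v, J (J v) = - v.
Hypothesis thetaJ : forall v, theta (J v) = - J (theta v).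

Notation W := (fseq V).

Fact ladJ_fin (f : W) : (fun k => J (f k)) \in @fin_pred V.
Proof.
by have [N hN] := fs_bounded f; apply: (@fs_fin _ _ N) => k hk;
  rewrite hN // linear0.
Qed.
Definition ladJ (f : W) : W := FSeq (ladJ_fin f).

Fact ladX_fin (f : W) : (fun k => if k is k'.+1 then f k' else 0) \in @fin_pred V.
Proof.
by have [N hN] := fs_bounded f; apply: (@fs_fin _ _ N.+1) => -[|k] // hk; apply: hN.
Qed.
Definition ladX (f : W) : W := FSeq (ladX_fin f).

Fact ladY_fin (f : W) :
  (fun k => theta (theta (f k.+1)) - (k.+1 ^ 2)%:R *: f k.+1) \in @fin_pred V.
Proof.
have [N hN] := fs_bounded f; apply: (@fs_fin _ _ N) => k hk.
by rewrite hN ?(leq_trans hk) // !linear0 ?addr0.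
Qed.
(** Y X^(k+1) = X^k (theta^2 - (k+1)^2), because 4 Y X = C - (n+1)^2 on weight
    n = 2 k + 1 and C = 4 theta^2. *)
Definition ladY (f : W) : W := FSeq (ladY_fin f).

(** The part of Y that leaves the positive weights: it maps weight 1 to weight
    -1, which conjugation identifies with weight 1, and Y becomes theta. *)
Definition ladT (f : W) : W := single 0 (theta (f 0%N)).

Fact ladH_fin (f : W) : (fun k => k.*2.+1%:R *: f k) \in @fin_pred V.
Proof.
by have [N hN] := fs_bounded f; apply: (@fs_fin _ _ N) => k hk;
  rewrite hN // scaler0.
Qed.
Definition ladH (f : W) : W := FSeq (ladH_fin f).

Lemma ladJE f k : ladJ f k = J (f k). Proof. by []. Qed.
Lemma ladXE f k : ladX f k = if k is k'.+1 then f k' else 0. Proof. by []. Qed.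
Lemma ladYE f k : ladY f k = theta (theta (f k.+1)) - (k.+1 ^ 2)%:R *: f k.+1.
Proof. by []. Qed.
Lemma ladTE f k : ladT f k = if k is 0 then theta (f 0%N) else 0.
Proof. by case: k. Qed.
Lemma ladHE f k : ladH f k = k.*2.+1%:R *: f k. Proof. by []. Qed.

Fact ladJ_linear : linear ladJ.
Proof. by move=> a f g; apply: fs_ext => k; rewrite /= linearP. Qed.
HB.instance Definition _ := GRing.isLinear.Build rat W W _ ladJ ladJ_linear.

Fact ladX_linear : linear ladX.
Proof. by move=> a f g; apply: fs_ext => -[|k]; rewrite !fsE !ladXE ?linear0 ?addr0. Qed.
HB.instance Definition _ := GRing.isLinear.Build rat W W _ ladX ladX_linear.

Fact ladY_linear : linear ladY.
Proof.
move=> a f g; apply: fs_ext => k; rewrite !fsE !ladYE !fsE !(linearP theta).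
by module_with V; ring.
Qed.
HB.instance Definition _ := GRing.isLinear.Build rat W W _ ladY ladY_linear.

Fact ladT_linear : linear ladT.
Proof. by move=> a f g; rewrite /ladT fsE linearP /= linearP. Qed.
HB.instance Definition _ := GRing.isLinear.Build rat W W _ ladT ladT_linear.

Fact ladH_linear : linear ladH.
Proof.
by move=> a f g; apply: fs_ext => k; rewrite !(fsE, ladHE); module_with V; ring.
Qed.
HB.instance Definition _ := GRing.isLinear.Build rat W W _ ladH ladH_linear.

Lemma ladJJ f : ladJ (ladJ f) = - f.
Proof. by apply: fs_ext => k; apply: JJ. Qed.

Lemma ladXJ f : ladX (ladJ f) = ladJ (ladX f).
Proof. by apply: fs_ext => -[|k] //=; rewrite linear0. Qed.

Lemma ladYJ f : ladY (ladJ f) = ladJ (ladY f).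
Proof.
apply: fs_ext => k.
by rewrite ladJE !ladYE !ladJE !(thetaJ, linearN theta) opprK (linearD J) (linearN J) (linearZ_LR J).
Qed.

Lemma ladTJ f : ladT (ladJ f) = - ladJ (ladT f).
Proof.
apply: fs_ext => -[|k]; rewrite fsE ladJE !ladTE ?ladJE ?thetaJ //.
by rewrite linear0 oppr0.
Qed.

Lemma ladHJ f : ladH (ladJ f) = ladJ (ladH f).
Proof. by apply: fs_ext => k; rewrite ladJE !ladHE ladJE linearZ. Qed.

Lemma ladHX f : ladH (ladX f) = ladX (ladH f) + 2 *: ladX f.
Proof.
apply: fs_ext => -[|k]; rewrite !fsE !ladHE !ladXE ?scaler0 ?addr0 //.
by rewrite ladHE -scalerDl doubleS -addn2 natrD.
Qed.

Lemma ladHY f : ladH (ladY f) = ladY (ladH f) - 2 *: ladY f.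
Proof.
apply: fs_ext => k; rewrite !fsE !ladHE !ladYE ladHE !(linearZ_LR theta).
rewrite doubleS -[k.*2.+3]addn2 natrD.
module_with V; ring.
Qed.

Lemma ladHT f : ladH (ladT f) = ladT f.
Proof. by apply: fs_ext => -[|k]; rewrite ladHE ladTE ?scale1r ?scaler0. Qed.

Lemma ladTH f : ladT (ladH f) = ladT f.
Proof. by apply: fs_ext => -[|k]; rewrite !ladTE // ladHE scale1r. Qed.

Lemma ladTX f : ladT (ladX f) = 0.
Proof. by apply: fs_ext => -[|k]; rewrite !ladTE // ladXE linear0. Qed.

Lemma ladYT f : ladY (ladT f) = 0.
Proof. by apply: fs_ext => k; rewrite ladYE ladTE !linear0 addr0. Qed.

(** On the lowest step [ladX (ladY f)] vanishes and [ladT (ladT f)] supplies the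
    missing theta^2, so that the relation YX = XY - H takes this uniform form. *)
Lemma ladYX f : ladY (ladX f) = ladX (ladY f) + ladT (ladT f) - ladH f.
Proof.
apply: fs_ext => -[|k]; rewrite !fsE !(ladYE, ladXE, ladTE, ladHE).
  by rewrite add0r scale1r.
rewrite addr0 -addrA -opprD -scalerDl -natrD; congr (_ - _%:R *: _).
by rewrite -!mulnn; lia.
Qed.

Lemma ladJD f g : ladJ (f + g) = ladJ f + ladJ g. Proof. exact: linearD. Qed.
Lemma ladXD f g : ladX (f + g) = ladX f + ladX g. Proof. exact: linearD. Qed.
Lemma ladYD f g : ladY (f + g) = ladY f + ladY g. Proof. exact: linearD. Qed.
Lemma ladTD f g : ladT (f + g) = ladT f + ladT g. Proof. exact: linearD. Qed.
Lemma ladHD f g : ladH (f + g) = ladH f + ladH g. Proof. exact: linearD. Qed.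
Lemma ladJN f : ladJ (- f) = - ladJ f. Proof. exact: linearN. Qed.
Lemma ladXN f : ladX (- f) = - ladX f. Proof. exact: linearN. Qed.
Lemma ladYN f : ladY (- f) = - ladY f. Proof. exact: linearN. Qed.
Lemma ladTN f : ladT (- f) = - ladT f. Proof. exact: linearN. Qed.
Lemma ladHN f : ladH (- f) = - ladH f. Proof. exact: linearN. Qed.
Lemma ladJZ a f : ladJ (a *: f) = a *: ladJ f. Proof. exact: linearZ. Qed.

Definition ladder_lin := (ladJD, ladXD, ladYD, ladTD, ladHD, ladJN, ladXN, ladYN, ladTN, ladHN).
Definition ladder_J := (ladJJ, ladXJ, ladYJ, ladTJ, ladHJ).

(** X + Y, - i (X - Y) and - i H.  In [ladS] the sign of [ladT] is that of
    [ladX]: the component - i (- Y) in weight -1 is carried to weight 1 by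
    conjugation, which changes i into - i. *)
Definition ladP (f : W) : W := ladX f + ladY f + ladT f.
Definition ladS (f : W) : W := ladJ (ladY f - ladX f - ladT f).
Definition ladZ (f : W) : W := - ladJ (ladH f).

Fact ladP_linear : linear ladP.
Proof. by move=> a f g; rewrite /ladP !linearP /=; module_with (W : lmodType rat); ring. Qed.
HB.instance Definition _ := GRing.isLinear.Build rat W W _ ladP ladP_linear.

Fact ladS_linear : linear ladS.
Proof.
by move=> a f g; rewrite /ladS -linearP; congr ladJ; rewrite !linearP /=;
  module_with (W : lmodType rat); ring.
Qed.
HB.instance Definition _ := GRing.isLinear.Build rat W W _ ladS ladS_linear.

Fact ladZ_linear : linear ladZ.
Proof. by move=> a f g; rewrite /ladZ !linearP /=; module_with (W : lmodType rat); ring. Qed.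
HB.instance Definition _ := GRing.isLinear.Build rat W W _ ladZ ladZ_linear.

Lemma ladPS f : ladP (ladS f) = ladS (ladP f) - 2 *: ladZ f.
Proof.
rewrite /ladP /ladS /ladZ !(ladder_lin, ladder_J) !(ladYX, ladTX, ladYT) !(ladder_lin, ladder_J).
by module_with (W : lmodType rat); ring.
Qed.

Lemma ladZP f : ladZ (ladP f) = ladP (ladZ f) + 2 *: ladS f.
Proof.
rewrite /ladP /ladS /ladZ !(ladder_lin, ladder_J) !(ladHX, ladHY, ladHT, ladTH).
by rewrite ?(ladder_lin, ladder_J, ladJZ); module_with (W : lmodType rat); ring.
Qed.

Lemma ladZS f : ladZ (ladS f) = ladS (ladZ f) - 2 *: ladP f.
Proof.
rewrite /ladP /ladS /ladZ !(ladder_lin, ladder_J) !(ladHX, ladHY, ladHT, ladTH).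
by rewrite ?(ladder_lin, ladder_J, ladJZ); module_with (W : lmodType rat); ring.
Qed.

(** In terms of P, S, Z the Casimir element C is P^2 + S^2 - Z^2 + 1; the squares
    (2 k + 1)^2, k^2 and (k + 1)^2 cancel. *)
Lemma ladder_casimir f k :
  (ladP (ladP f) + ladS (ladS f) - ladZ (ladZ f) + f) k = 4 *: theta (theta (f k)).
Proof.
have -> : ladP (ladP f) + ladS (ladS f) - ladZ (ladZ f) + f =
    4 *: (ladX (ladY f) + ladT (ladT f)) - 2 *: ladH f + ladH (ladH f) + f.
  rewrite /ladP /ladS /ladZ !(ladder_lin, ladder_J) !(ladYX, ladTX, ladYT).
  by rewrite ?(ladder_lin, ladder_J, ladJZ); module_with (W : lmodType rat); ring.
case: k => [|k]; rewrite !fsE !(ladXE, ladTE, ladHE, ladYE); module_with V; first by [].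
by rewrite -mul2n; ring.
Qed.

Definition ladder_lie (A : sl2 rat) (f : W) : W :=
  sl2_mx A 0 0 *: ladP f + ((sl2_mx A 0 1 + sl2_mx A 1 0) / 2) *: ladS f
  + ((sl2_mx A 1 0 - sl2_mx A 0 1) / 2) *: ladZ f.

Fact ladder_lie_linear A : linear (ladder_lie A).
Proof.
by move=> a f g; rewrite /ladder_lie !linearP /=; module_with (W : lmodType rat); ring.
Qed.
HB.instance Definition _ A := GRing.isLinear.Build rat W W _ (ladder_lie A) (ladder_lie_linear A).

Fact ladder_lieD a A B f :
  ladder_lie (a *: A + B) f = a *: ladder_lie A f + ladder_lie B f.
Proof.
by rewrite /ladder_lie !mxE; module_with (W : lmodType rat); field.
Qed.

Lemma ladder_lie_of a b c f :
  ladder_lie (sl2_of a b c) f =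
  a *: ladP f + ((b + c) / 2) *: ladS f + ((c - b) / 2) *: ladZ f.
Proof. by rewrite /ladder_lie !mxE. Qed.

Lemma ladder_lie_br A B f :
  ladder_lie (sl2_br A B) f =
  ladder_lie A (ladder_lie B f) - ladder_lie B (ladder_lie A f).
Proof.
rewrite [A]sl2E [B]sl2E sl2_br_of; move: (sl2_mx A 0 0) (sl2_mx A 0 1)
  (sl2_mx A 1 0) (sl2_mx B 0 0) (sl2_mx B 0 1) (sl2_mx B 1 0) => a b c a' b' c'.
rewrite !ladder_lie_of !(linearD ladP, linearD ladS, linearD ladZ).
rewrite !(linearZ_LR ladP, linearZ_LR ladS, linearZ_LR ladZ) /= !(ladPS, ladZP, ladZS).
by module_with (W : lmodType rat); field.
Qed.
End Ladder.

(** * Extension of scalars and powers of points of SO(2) *)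

Section Tens.
Variables (R : comAlgType rat) (M : lmodType rat).
Implicit Types (a b : R) (m : M).

Lemma tensDl a b m : tens (a + b) m = tens a m + tens b m.
Proof. by case: (bc_balanced R M). Qed.
Lemma tensDr a m m' : tens a (m + m') = tens a m + tens a m'.
Proof. by case: (bc_balanced R M). Qed.
Lemma tensZ q a m : tens a (q *: m) = tens (q *: a) m.
Proof. by case: (bc_balanced R M). Qed.
Lemma tens0 a : tens a (0 : M) = 0.
Proof. by apply: (addrI (tens a 0)); rewrite -tensDr !addr0. Qed.
Lemma tens0l m : tens (0 : R) m = 0.
Proof. by apply: (addrI (tens 0 m)); rewrite -tensDl !addr0. Qed.
Lemma tensN a m : tens a (- m) = - tens a m.
Proof. by apply: (addrI (tens a m)); rewrite -tensDr !subrr tens0. Qed.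
Lemma tensNl a m : tens (- a) m = - tens a m.
Proof. by apply: (addrI (tens a m)); rewrite -tensDl !subrr tens0l. Qed.
Lemma tens1 a m : tens a m = a *: tens 1 m.
Proof. by rewrite scale_tens mulr1. Qed.

Lemma tens_nat n a m : tens a (n%:R *: m) = n%:R *: tens a m.
Proof. by rewrite tensZ scaler_nat scale_tens mulr_natl. Qed.

Lemma bc_lin_ext (N : lmodType R) (f g : {linear bc R M -> N}) :
  (forall m, f (tens 1 m) = g (tens 1 m)) -> f =1 g.
Proof.
move=> h; elim/bc_ind => [|u v hu hv|a m]; first by rewrite !linear0.
  by rewrite !linearD hu hv.
by rewrite tens1 !linearZ h.
Qed.

End Tens.

Section ScalarExtension.
Variables (R : comAlgType rat) (M : lmodType rat) (N : lmodType R) (k : M -> N).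
Hypothesis kD : {morph k : u v / u + v}.
Hypothesis kZ : forall q m, k (q *: m) = (q *: (1 : R)) *: k m.

(** The R-linear extension of a rational linear map into an R-module. *)
Definition sext (u : bc R M) : N := bc_lift (fun a m => a *: k m) u.

Fact sext_balanced : balanced (fun a m => a *: k m).
Proof.
split=> [a b m|a m m'|q a m]; first exact: scalerDl.
  by rewrite kD scalerDr.
by rewrite kZ scalerA -scalerAr mulr1.
Qed.

Lemma sextE a m : sext (tens a m) = a *: k m.
Proof. by rewrite /sext bc_liftE //; exact: sext_balanced. Qed.

Fact sext_linear : linear sext.
Proof.
move=> a u v; rewrite {1}/sext (bc_liftD _ _ sext_balanced); congr (_ + _).
rewrite -!/(sext _); elim/bc_ind: u => [|u w hu hw|b m].
- by rewrite scaler0 /sext bc_lift_zero ?scaler0 //; exact: sext_balanced.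
- rewrite scalerDr /sext !(bc_liftD _ _ sext_balanced) -!/(sext _) hu hw.
  by rewrite scalerDr.
- by rewrite scale_tens !sextE scalerA.
Qed.

End ScalarExtension.

Section SO2Powers.

Lemma so_ext (R : comNzRingType) (g h : SO2 R) :
  so_x g = so_x h -> so_y g = so_y h -> g = h.
Proof.
case: g h => x y e [x' y' e'] /= hx hy; subst x' y'.
by congr SO2Point; apply: Prop_irrelevance.
Qed.

Section Ring.
Variable R : comNzRingType.
Implicit Types g h : SO2 R.

Definition so_pow g n : SO2 R := iter n (so_mul g) (so_one R).
(** [powx g n] and [powy g n] play the roles of cos and sin of n times the angle
    of [g]. *)
Definition powx g n : R := so_x (so_pow g n).
Definition powy g n : R := so_y (so_pow g n).

Lemma powx0 g : powx g 0 = 1. Proof. by []. Qed.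
Lemma powy0 g : powy g 0 = 0. Proof. by []. Qed.
Lemma powxS g n : powx g n.+1 = so_x g * powx g n - so_y g * powy g n.
Proof. by []. Qed.
Lemma powyS g n : powy g n.+1 = so_x g * powy g n + so_y g * powx g n.
Proof. by []. Qed.
Lemma powx1 g : powx g 1 = so_x g.
Proof. by rewrite powxS powx0 powy0; ring. Qed.
Lemma powy1 g : powy g 1 = so_y g.
Proof. by rewrite powyS powx0 powy0; ring. Qed.
Definition powE := (powxS, powyS, powx0, powy0).

Lemma powx_one n : powx (so_one R) n = 1.
Proof. by elim: n => // n ih; rewrite powxS ih /=; ring. Qed.
Lemma powy_one n : powy (so_one R) n = 0.
Proof. by elim: n => // n ih; rewrite powyS ih /=; ring. Qed.

Lemma pow_mul g h n :
  powx (so_mul g h) n = powx g n * powx h n - powy g n * powy h n /\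
  powy (so_mul g h) n = powx g n * powy h n + powy g n * powx h n.
Proof.
elim: n => [|n [hx hy]]; first by rewrite !powE; split; ring.
by rewrite !(powxS _ n, powyS _ n) hx hy /=; split; ring.
Qed.

Lemma powx_neg_one n : powx (so_neg_one R) n = (-1) ^+ n.
Proof. by elim: n => // n ih; rewrite powxS ih /= mul0r subr0 exprS. Qed.
Lemma powy_neg_one n : powy (so_neg_one R) n = 0.
Proof. by elim: n => // n ih; rewrite powyS ih /=; ring. Qed.

Lemma so_y_sqr g : so_y g ^+ 2 = 1 - so_x g ^+ 2.
Proof. by rewrite -(so_eq g) addrC addKr. Qed.

End Ring.

Lemma pow_map (R S : comNzRingType) (phi : {rmorphism R -> S}) g n :
  powx (so_map phi g) n = phi (powx g n) /\ powy (so_map phi g) n = phi (powy g n).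
Proof.
elim: n => [|n [hx hy]]; first by rewrite !powE rmorph1 rmorph0.
by rewrite !(powxS _ n, powyS _ n) hx hy /= rmorphB rmorphD !rmorphM.
Qed.

Lemma pow_tangent t n :
  powx (so_tangent t) n = 1 /\ powy (so_tangent t) n = (n%:R * t) *: eps.
Proof.
elim: n => [|n [hx hy]]; first by rewrite !powE mul0r scale0r.
rewrite !(powxS _ n, powyS _ n) hx hy /= !mul1r mulr1.
rewrite -scalerAl -scalerAr -expr2 eps2 !scaler0 subr0; split=> //.
by rewrite -scalerDl; congr (_ *: _); rewrite -addn1 natrD; ring.
Qed.

End SO2Powers.

(** * The action of SO(2) on a ladder *)

Section LadderModule.
Variables (V : lmodType rat) (J theta : {linear V -> V}).
Hypothesis JJ : forall v, J (J v) = - v.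
Hypothesis thetaJ : forall v, theta (J v) = - J (theta v).

Notation W := (fseq V).
Notation Xl := (@ladX V).
Notation Jl := (ladJ J).
Notation Yl := (ladY theta).
Notation Tl := (ladT theta).
Notation Pl := (ladP theta).
Notation Sl := (ladS J theta).
Notation Zl := (ladZ J).

Lemma ladJ_single k v : Jl (single k v) = single k (J v).
Proof. by apply: fs_ext => j; rewrite ladJE !singleE; case: eqP; rewrite ?linear0. Qed.
Lemma ladX_single k (v : V) : Xl (single k v) = single k.+1 v.
Proof. by apply: fs_ext => -[|j]; rewrite ladXE !singleE. Qed.
Lemma ladY_single0 v : Yl (single 0 v) = 0.
Proof. by apply: fs_ext => j; rewrite ladYE singleE !linear0 addr0. Qed.
Lemma ladY_singleS k v :
  Yl (single k.+1 v) = single k (theta (theta v) - (k.+1 ^ 2)%:R *: v).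
Proof.
apply: fs_ext => j; rewrite ladYE !singleE eqSS; case: eqP => [->//|_].
by rewrite !linear0 addr0.
Qed.
Lemma ladT_single0 v : Tl (single 0 v) = single 0 (theta v).
Proof. by rewrite /ladT singleE. Qed.
Lemma ladT_singleS k v : Tl (single k.+1 v) = 0.
Proof. by rewrite /ladT singleE !linear0. Qed.
Lemma ladH_single k (v : V) : ladH (single k v) = k.*2.+1%:R *: single k v.
Proof.
by apply: fs_ext => j; rewrite ladHE !fsE !singleE; case: eqP => [->|] //; rewrite !linear0.
Qed.

Section Points.
Variable R : comAlgType rat.
Implicit Types (a b : R) (e f : W) (u : bc R W) (g : SO2 R).

(** The product of the scalar a + i b of R (x) F with the vector [e]. *)
Definition ctens : R -> R -> W -> bc R W :=
  locked (fun a b e => tens a e + tens b (Jl e)).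

Lemma ctensE a b e : ctens a b e = tens a e + tens b (Jl e).
Proof. by rewrite /ctens -lock. Qed.

Lemma ctens1 e : ctens 1 0 e = tens 1 e.
Proof. by rewrite !ctensE tens0l addr0. Qed.
Lemma ctensZ r a b e : r *: ctens a b e = ctens (r * a) (r * b) e.
Proof. by rewrite !ctensE scalerDr !scale_tens. Qed.
Lemma ctensDl a b a' b' e : ctens a b e + ctens a' b' e = ctens (a + a') (b + b') e.
Proof. by rewrite !ctensE !tensDl addrACA. Qed.
Lemma ctensD a b e f : ctens a b (e + f) = ctens a b e + ctens a b f.
Proof. by rewrite !ctensE (linearD Jl) !tensDr addrACA. Qed.
Lemma ctensN a b e : - ctens a b e = ctens (- a) (- b) e.
Proof. by rewrite -scaleN1r ctensZ !mulN1r. Qed.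
Lemma ctens0 a b : ctens a b 0 = 0.
Proof. by rewrite !ctensE (linear0 Jl) !tens0 addr0. Qed.
Lemma ctensJ a b e : ctens a b (Jl e) = ctens (- b) a e.
Proof. by rewrite !ctensE ladJJ // tensN tensNl addrC. Qed.

Lemma bc_ladX a b e : bc_lin R Xl (ctens a b e) = ctens a b (Xl e).
Proof. by rewrite !ctensE linearD /= !bc_linE /= ladXJ. Qed.
Lemma bc_ladJ a b e : bc_lin R Jl (ctens a b e) = ctens (- b) a e.
Proof. by rewrite -ctensJ !ctensE linearD /= !bc_linE. Qed.
Lemma bc_ladY a b e : bc_lin R Yl (ctens a b e) = ctens a b (Yl e).
Proof. by rewrite !ctensE linearD /= !bc_linE /= (ladYJ thetaJ). Qed.
Lemma bc_ladT a b e : bc_lin R Tl (ctens a b e) = ctens a (- b) (Tl e).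
Proof. by rewrite !ctensE linearD /= !bc_linE /= (ladTJ thetaJ) tensNl tensN. Qed.

Lemma bc_ladP a b e : bc_lin R Pl (ctens a b e) =
  ctens a b (Xl e) + ctens a b (Yl e) + ctens a (- b) (Tl e).
Proof.
rewrite -bc_ladX -bc_ladY -bc_ladT; move: (ctens a b e); elim/bc_ind => [|u v hu hv|r f].
- by rewrite !linear0 !addr0.
- by rewrite !linearD /= hu hv [LHS]addrACA; congr (_ + _); rewrite addrACA.
- by rewrite !bc_linE /= !tensDr.
Qed.

Lemma bc_ladS a b e : bc_lin R Sl (ctens a b e) =
  ctens (- b) a (Yl e) - ctens (- b) a (Xl e) - ctens b a (Tl e).
Proof.
have -> : ctens b a (Tl e) = ctens (- - b) a (Tl e) by rewrite opprK.
rewrite -!bc_ladJ -bc_ladX -bc_ladY -bc_ladT.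
move: (ctens a b e); elim/bc_ind => [|u v hu hv|r f].
- by rewrite !linear0 ?subr0 ?addr0.
- by rewrite !linearD /= hu hv ?opprD [LHS]addrACA; congr (_ + _); rewrite addrACA.
- by rewrite !bc_linE /= -!tensN -!tensDr /ladS !(linearB Jl).
Qed.

Lemma bc_ladZ a b k v : bc_lin R Zl (ctens a b (single k v)) =
  k.*2.+1%:R *: ctens b (- a) (single k v).
Proof.
rewrite !ctensE linearD /= !bc_linE /= /ladZ ladHJ ladH_single !ladJZ ladJJ //.
by rewrite scalerN opprK tensN !tens_nat addrC scalerDr tensNl scalerN.
Qed.

(** The generator Z = - i H acts on weight n by - i n, so the point (x, y) acts
    by (x - i y)^n. *)
Definition lrot_term g k (v : V) : bc R W :=
  ctens (powx g k.*2.+1) (- powy g k.*2.+1) (single k v).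

Fact lrot_termD g k : {morph lrot_term g k : u v / u + v}.
Proof. by move=> u v; rewrite /lrot_term (linearD (single _)) ctensD. Qed.

Definition lrot g (f : W) : bc R W := fs_sum (lrot_term g) f.

Fact lrotD g : {morph lrot g : e f / e + f}.
Proof. exact/fs_sumD/lrot_termD. Qed.

Lemma lrot_single g k v : lrot g (single k v) = lrot_term g k v.
Proof. exact/fs_sum_single/lrot_termD. Qed.

Lemma lrot0 g : lrot g 0 = 0.
Proof. by rewrite -(linear0 (single 0)) lrot_single /lrot_term linear0 ctens0. Qed.

Fact lrotZ g q f : lrot g (q *: f) = (q *: (1 : R)) *: lrot g f.
Proof.
elim/fs_ind: f => [|e f he hf|k v]; first by rewrite scaler0 lrot0 scaler0.
  by rewrite scalerDr !lrotD he hf scalerDr.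
rewrite -(linearZ_LR (single k)) !lrot_single /lrot_term ctensZ (linearZ_LR (single k)).
by rewrite !ctensE ladJZ !tensZ -!scalerAl !mul1r.
Qed.

Definition ladder_act g : bc R W -> bc R W := sext (lrot g).

Lemma ladder_actE g a f : ladder_act g (tens a f) = a *: lrot g f.
Proof. by apply: sextE; [apply: lrotD|apply: lrotZ]. Qed.

Fact ladder_act_linear g : linear (ladder_act g).
Proof. by apply: sext_linear; [apply: lrotD|apply: lrotZ]. Qed.
HB.instance Definition _ g := GRing.isLinear.Build R (bc R W) (bc R W) _
  (ladder_act g) (ladder_act_linear g).

Lemma ladder_actD g u v : ladder_act g (u + v) = ladder_act g u + ladder_act g v.
Proof. exact: linearD. Qed.
Lemma ladder_act0 g : ladder_act g 0 = 0.
Proof. exact: linear0. Qed.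

Lemma ladder_act_single g a b k v : ladder_act g (ctens a b (single k v)) =
  ctens (a * powx g k.*2.+1 + b * powy g k.*2.+1)
        (b * powx g k.*2.+1 - a * powy g k.*2.+1) (single k v).
Proof.
rewrite {1}ctensE (linearD (ladder_act g)) /= ladJ_single !ladder_actE !lrot_single.
rewrite /lrot_term -ladJ_single ctensJ !ctensZ ctensDl opprK.
by congr ctens; ring.
Qed.

Lemma fs_bc_lin_ext (N : lmodType R) (p q : {linear bc R W -> N}) :
  (forall k v, p (tens 1 (single k v)) = q (tens 1 (single k v))) -> p =1 q.
Proof.
move=> h; apply: bc_lin_ext; elim/fs_ind => [|e f he hf|//].
  by rewrite tens0 !linear0.
by rewrite tensDr !linearD he hf.
Qed.

(** Conjugation by (x, y) rotates the plane spanned by P and S by twice the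
    angle.  The two components of weight n + 2 and n - 2 of P, S are compared
    separately; on weight 1 the second one comes from [ladT]. *)
Lemma ladder_actP g u : ladder_act g (bc_lin R Pl u) =
  (so_x g ^+ 2 - so_y g ^+ 2) *: bc_lin R Pl (ladder_act g u)
  + (2 * so_x g * so_y g) *: bc_lin R Sl (ladder_act g u).
Proof.
pose p := ladder_act g \o bc_lin R Pl.
pose q := (so_x g ^+ 2 - so_y g ^+ 2) \*: (bc_lin R Pl \o ladder_act g)
  \+ (2 * so_x g * so_y g) \*: (bc_lin R Sl \o ladder_act g).
apply: (@fs_bc_lin_ext _ p q) => {u} k v; rewrite /p /q /= -ctens1.
rewrite ladder_act_single !bc_ladP !bc_ladS !ladder_actD.
case: k => [|k].
  rewrite ladY_single0 ladT_single0 ladX_single !ctens0 ladder_act0 !ladder_act_single.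
  rewrite !(addr0, add0r) !(ctensN, scalerDr, ctensZ).
  rewrite [RHS]addrACA !ctensDl; congr (ctens _ _ _ + ctens _ _ _);
    rewrite ?doubleS ?double0 !powE; ring: (so_y_sqr g).
rewrite ladY_singleS ladT_singleS ladX_single !ctens0 ladder_act0 !ladder_act_single.
rewrite !(addr0, subr0) !(ctensN, scalerDr, ctensZ) (addrC (ctens _ _ _) (ctens _ _ (single k.+2 _))).
rewrite [RHS]addrACA !ctensDl; congr (ctens _ _ _ + ctens _ _ _);
    rewrite ?doubleS ?double0 !powE; ring: (so_y_sqr g).
Qed.

Lemma ladder_actS g u : ladder_act g (bc_lin R Sl u) =
  - (2 * so_x g * so_y g) *: bc_lin R Pl (ladder_act g u)
  + (so_x g ^+ 2 - so_y g ^+ 2) *: bc_lin R Sl (ladder_act g u).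
Proof.
pose p := ladder_act g \o bc_lin R Sl.
pose q := (- (2 * so_x g * so_y g)) \*: (bc_lin R Pl \o ladder_act g)
  \+ (so_x g ^+ 2 - so_y g ^+ 2) \*: (bc_lin R Sl \o ladder_act g).
apply: (@fs_bc_lin_ext _ p q) => {u} k v; rewrite /p /q /= -ctens1.
rewrite ladder_act_single !bc_ladP !bc_ladS !ctensN !ladder_actD.
case: k => [|k].
  rewrite ladY_single0 ladT_single0 ladX_single !ctens0 ladder_act0 !ladder_act_single.
  rewrite !(addr0, add0r) !(ctensN, scalerDr, ctensZ).
  rewrite [RHS]addrACA !ctensDl; congr (ctens _ _ _ + ctens _ _ _);
    rewrite ?doubleS ?double0 !powE; ring: (so_y_sqr g).
rewrite ladY_singleS ladT_singleS ladX_single !ctens0 ladder_act0 !ladder_act_single.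
rewrite !(addr0, subr0) !(ctensN, scalerDr, ctensZ) [in LHS]addrC.
rewrite (addrC (ctens _ _ (single k _)) (ctens _ _ (single k.+2 _))).
rewrite [RHS]addrACA !ctensDl; congr (ctens _ _ _ + ctens _ _ _);
    rewrite ?doubleS ?double0 !powE; ring: (so_y_sqr g).
Qed.

Lemma ladder_actZ g u : ladder_act g (bc_lin R Zl u) = bc_lin R Zl (ladder_act g u).
Proof.
apply: (@fs_bc_lin_ext _ (ladder_act g \o bc_lin R Zl) (bc_lin R Zl \o ladder_act g)).
move=> {u} k v /=; rewrite -ctens1 ladder_act_single !bc_ladZ linearZ /=.
by rewrite ladder_act_single; congr (_ *: ctens _ _ _); ring.
Qed.

Let half : R := 2^-1 *: 1.
Let half2 : half * 2 = 1.
Proof. by rewrite -scalerAl mul1r -[X in _ *: X]scaler_nat scalerA mulVf ?scale1r. Qed.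

Lemma lie_ext_ladder (A : sl2 R) u : lie_ext (ladder_lie J theta) A u =
  sl2_mx A 0 0 *: bc_lin R Pl u
  + (half * (sl2_mx A 0 1 + sl2_mx A 1 0)) *: bc_lin R Sl u
  + (half * (sl2_mx A 1 0 - sl2_mx A 0 1)) *: bc_lin R Zl u.
Proof.
have hP : bc_lin R (ladder_lie J theta (sl2_of 1 0 0)) u = bc_lin R Pl u.
  apply: (@bc_lin_ext _ _ _ (bc_lin R _) (bc_lin R Pl)) => m /=.
  rewrite !bc_linE /= ladder_lie_of.
  by rewrite !(oppr0, addr0, mul0r, scale0r, scale1r).
have hE : bc_lin R (ladder_lie J theta (sl2_of 0 1 0)) u =
    half *: bc_lin R Sl u - half *: bc_lin R Zl u.
  apply: (@bc_lin_ext _ _ _ (bc_lin R _) (half \*: bc_lin R Sl \- half \*: bc_lin R Zl)).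
  move=> m /=; rewrite !bc_linE /= ladder_lie_of !scale_tens mulr1 /half -!tensZ.
  rewrite !(oppr0, addr0, add0r, mul0r, scale0r, mul1r, mulN1r, scaleNr).
  by rewrite -tensN -tensDr.
have hF : bc_lin R (ladder_lie J theta (sl2_of 0 0 1)) u =
    half *: bc_lin R Sl u + half *: bc_lin R Zl u.
  apply: (@bc_lin_ext _ _ _ (bc_lin R _) (half \*: bc_lin R Sl \+ half \*: bc_lin R Zl)).
  move=> m /=; rewrite !bc_linE /= ladder_lie_of !scale_tens mulr1 /half -!tensZ.
  by rewrite !(oppr0, addr0, add0r, mul0r, scale0r, mul1r) -tensDr.
rewrite /lie_ext hP hE hF.
by module_with (bc R W : lmodType R); ring.
Qed.

Fact ladder_act_Ad g (A : sl2 R) u :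
  ladder_act g (lie_ext (ladder_lie J theta) A u) =
  lie_ext (ladder_lie J theta) (sl2_Ad g A) (ladder_act g u).
Proof.
rewrite [A]sl2E; move: (sl2_mx A 0 0) (sl2_mx A 0 1) (sl2_mx A 1 0) => a b c.
rewrite !lie_ext_ladder /= !mulmx2 !mxE /=.
rewrite !(linearD (ladder_act g)) !(linearZ_LR (ladder_act g)) /=.
rewrite ladder_actP ladder_actS ladder_actZ.
have e x : x = half * 2 * x by rewrite half2 mul1r.
module_with (bc R W : lmodType R); last by ring: (so_y_sqr g).
  by rewrite [X in X + _ = _]e [RHS]e; ring.
by rewrite [X in X + _ = _]e; ring.
Qed.

Fact ladder_act_one u : ladder_act (so_one R) u = u.
Proof.
apply: (@fs_bc_lin_ext _ (ladder_act (so_one R)) idfun) => {u} k v /=.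
rewrite -ctens1 ladder_act_single powx_one powy_one.
by congr ctens; ring.
Qed.

Fact ladder_act_mul g h u :
  ladder_act (so_mul g h) u = ladder_act g (ladder_act h u).
Proof.
apply: (@fs_bc_lin_ext _ (ladder_act (so_mul g h)) (ladder_act g \o ladder_act h)).
move=> {u} k v /=; rewrite -ctens1 !ladder_act_single.
have [-> ->] := pow_mul g h k.*2.+1.
by congr ctens; ring.
Qed.

Lemma ladder_act_neg_one f : ladder_act (so_neg_one R) (tens 1 f) = - tens 1 f.
Proof.
elim/fs_ind: f => [|e f he hf|k v]; first by rewrite !tens0 linear0 oppr0.
  by rewrite tensDr linearD /= he hf opprD.
rewrite -ctens1 ladder_act_single powx_neg_one powy_neg_one ctensN.
by rewrite exprS -mul2n exprM sqrrN !expr1n; congr ctens; ring.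
Qed.

End Points.

Fact ladder_act_natural (R S : comAlgType rat) (phi : {lrmorphism R -> S})
    (g : SO2 R) u :
  bc_ring phi (ladder_act g u) = ladder_act (so_map phi g) (bc_ring phi u).
Proof.
elim/bc_ind: u => [|u v hu hv|a f]; first by rewrite !(bc_ring0, linear0).
  by rewrite linearD !bc_ringD hu hv linearD.
elim/fs_ind: f => [|e f he hf|k v].
- by rewrite !tens0 bc_ring0 !linear0 bc_ring0.
- by rewrite tensDr linearD !bc_ringD he hf linearD.
rewrite bc_ringE !ladder_actE bc_ringZ; congr (_ *: _).
rewrite !lrot_single /lrot_term !ctensE bc_ringD !bc_ringE rmorphN.
by have [-> ->] := pow_map phi g k.*2.+1.
Qed.

(** At the point 1 + eps t of the tangent line, x_n = 1 and y_n = n t eps. *)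
Fact ladder_act_differential (t : rat) f :
  ladder_act (so_tangent t) (tens 1 f) =
  tens 1 f + tens eps (ladder_lie J theta (sl2_of 0 (- t) t) f).
Proof.
elim/fs_ind: f => [|e f he hf|k v].
- by rewrite (linear0 (ladder_lie _ _ _)) !tens0 ladder_act0 addr0.
- by rewrite (tensDr 1 e f) ladder_actD he hf (linearD (ladder_lie _ _ _)) [LHS]addrACA -!tensDr.
rewrite -ctens1 ladder_act_single; have [-> ->] := pow_tangent t k.*2.+1.
rewrite ladder_lie_of addNr mul0r !scale0r !add0r.
have -> : (t - - t) / 2 = t by field.
rewrite /ladZ ladH_single ladJZ -scalerN scalerA tensZ tensN -tensNl.
by rewrite ctens1 ctensE; congr (tens _ _ + tens _ _); [ring|rewrite mul0r mul1r sub0r (mulrC t)].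
Qed.

Definition ladder_gK : gKmodule :=
  @GKmodule W (fun A => ladder_lie J theta A) (fun R g => @ladder_act R g)
    (ladder_lieD J theta) (ladder_lie_br JJ thetaJ) ladder_act_one ladder_act_mul
    ladder_act_natural ladder_act_Ad ladder_act_differential.

End LadderModule.

(** * The coordinate ring of SO(2) *)

(** Q[x, y] / (x^2 + y^2 - 1) is free over Q[x] with basis 1, y; the pair (p, q)
    is p(x) + q(x) y. *)
Definition coord : Type := ({poly rat} * {poly rat})%type.

HB.instance Definition _ := GRing.Lmodule.copy coord ({poly rat} * {poly rat})%type.

Section CoordRing.
Implicit Types u v w : coord.

Definition coord_one : coord := (1, 0).
Definition coord_mul u v : coord :=
  (u.1 * v.1 + u.2 * v.2 * (1 - 'X ^+ 2), u.1 * v.2 + u.2 * v.1).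

Fact coord_mulA : associative coord_mul.
Proof. by move=> u v w; congr pair => /=; ring. Qed.
Fact coord_mulC : commutative coord_mul.
Proof. by move=> u v; congr pair => /=; ring. Qed.
Fact coord_mul1 : left_id coord_one coord_mul.
Proof. by case=> p q; congr pair => /=; ring. Qed.
Fact coord_mulD : left_distributive coord_mul +%R.
Proof. by move=> [p q] [p' q'] [r s]; congr pair => /=; ring. Qed.
Fact coord_one_neq0 : coord_one != 0.
Proof. by apply/eqP => -[/eqP]; rewrite oner_eq0. Qed.

HB.instance Definition _ := GRing.Zmodule_isComNzRing.Build coord
  coord_mulA coord_mulC coord_mul1 coord_mulD coord_one_neq0.

Fact coord_scaleAl a u v : a *: (u * v) = (a *: u : coord) * v.
Proof.
case: u v => p q [r s]; by congr pair => /=; rewrite scalerDr -!scalerAl.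
Qed.

HB.instance Definition _ := GRing.Lmodule_isLalgebra.Build rat coord coord_scaleAl.
HB.instance Definition _ := GRing.Lalgebra_isComAlgebra.Build rat coord.

Definition coord_x : coord := ('X, 0).
Definition coord_y : coord := (0, 1).

Fact coord_point_eq : coord_x ^+ 2 + coord_y ^+ 2 = 1.
Proof. by congr pair => /=; ring. Qed.

Definition coord_point : SO2 coord := SO2Point coord_point_eq.

Lemma coordE (p q : {poly rat}) :
  ((p, q) : coord) = (p, 0) + coord_y * (q, 0).
Proof. by congr pair => /=; ring. Qed.

Section Eval.
Variables (R : comAlgType rat) (g : SO2 R).

(** The ring morphism sending the universal point to [g]. *)
Definition coord_eval u : R :=
  horner_alg (so_x g) u.1 + horner_alg (so_x g) u.2 * so_y g.

Fact coord_eval_linear : linear coord_eval.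
Proof.
move=> a [p q] [r s]; rewrite /coord_eval /= !linearP /= !mulr_algl.
by rewrite mulrDl scalerDr scalerAl [LHS]addrACA.
Qed.

Fact coord_eval_monoid : monoid_morphism coord_eval.
Proof.
split=> [|[p q] [r s]]; rewrite /coord_eval /=.
  by rewrite rmorph1 rmorph0 mul0r addr0.
have hX : horner_alg (so_x g) (1 - 'X ^+ 2) = 1 - so_x g ^+ 2.
  by rewrite rmorphB rmorph1 rmorphXn /= horner_algX.
move: (1 - 'X ^+ 2) hX => t hX.
rewrite !(rmorphD (horner_alg _)) !(rmorphM (horner_alg _)) [X in _ + _ * X + _ * _ = _]hX.
ring: (so_y_sqr g).
Qed.

HB.instance Definition _ := GRing.isLinear.Build rat coord R _ coord_eval coord_eval_linear.
HB.instance Definition _ := GRing.isMonoidMorphism.Build coord R coord_eval coord_eval_monoid.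

Lemma coord_eval_point : so_map coord_eval coord_point = g.
Proof.
by apply: so_ext; rewrite /= /coord_eval /= ?rmorph0 ?rmorph1 ?horner_algX; ring.
Qed.
End Eval.
End CoordRing.

(** * Linear independence of the functions x_n and y_n on SO(2) *)

Section Coefficient.
Variables (R : comAlgType rat) (lam : {linear R -> rat^o}) (M : lmodType rat).

(** The map lam (x) 1 : R (x) M -> Q (x) M = M. *)
Definition bc_coef (u : bc R M) : M := bc_lift (fun a m => (lam a : rat) *: m) u.

Fact bc_coef_balanced : balanced (fun a (m : M) => (lam a : rat) *: m).
Proof.
split=> [a b m|a m m'|q a m]; rewrite ?linearD ?scalerDl ?scalerDr //.
by rewrite (linearZ_LR lam) /= scalerA mulrC.
Qed.

Lemma bc_coefE a m : bc_coef (tens a m) = (lam a : rat) *: m.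
Proof. by rewrite /bc_coef bc_liftE //; exact: bc_coef_balanced. Qed.

Lemma bc_coefD u v : bc_coef (u + v) = bc_coef u + bc_coef v.
Proof. exact/bc_liftD/bc_coef_balanced. Qed.

Lemma bc_coef0 : bc_coef 0 = 0.
Proof. by rewrite -(tens0l R (0 : M)) bc_coefE scaler0. Qed.

End Coefficient.

Definition reQi (z : Qi) : rat^o := complex.Re z.
Fact reQi_linear : linear reQi.
Proof. by move=> a [x y] [x' y']. Qed.
HB.instance Definition _ := GRing.isLinear.Build rat Qi rat^o _ reQi reQi_linear.

(** It satisfies 2 Re w = w + c w in F (x) M. *)
Definition bc_Re (M : lmodType rat) : bc Qi M -> M := bc_coef reQi (M := M).

Lemma tens1_inj (M : lmodType rat) : injective (fun m : M => tens (1 : Qi) m).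
Proof.
move=> m m' /(congr1 (@bc_Re M)); rewrite /bc_Re !bc_coefE.
by rewrite !scale1r.
Qed.

(** Subtracting z_N times the relation of index j from the one of index j + 1
    removes the last term and multiplies the others by z_n - z_N. *)
Lemma vandermonde (F : fieldType) (U : lmodType F) (z : nat -> F) (w : nat -> U) N :
  injective z -> (forall j, \sum_(n < N) z n ^+ j *: w n = 0) ->
  forall n, (n < N)%N -> w n = 0.
Proof.
move=> zI; elim: N w => [//|N ih] w hw.
have hN n : (n < N)%N -> w n = 0.
  move=> hn; have /eqP : (z n - z N) *: w n = 0.
    apply: (ih (fun n => (z n - z N) *: w n)) hn => j.
    have := hw j.+1; rewrite big_ord_recr /= => h1.
    have h2 : z N *: (\sum_(i < N) z i ^+ j *: w i) = \sum_(i < N) z i ^+ j.+1 *: w i.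
      apply: (addIr (z N ^+ j.+1 *: w N)); rewrite h1 exprS -scalerA -scalerDr.
      by have := hw j; rewrite big_ord_recr /= => ->; rewrite scaler0.
    rewrite scaler_sumr in h2.
    rewrite (eq_bigr (fun n : 'I_N => z n ^+ j.+1 *: w n - z N *: (z n ^+ j *: w n))).
      by rewrite sumrB h2 subrr.
    by move=> i _; rewrite exprSr -scalerA scalerBl scalerBr !scalerA (mulrC (z N)).
  rewrite scaler_eq0 subr_eq0 => /orP[/eqP/zI h|/eqP //].
  by move: hn; rewrite h ltnn.
move=> n; rewrite ltnS leq_eqVlt => /predU1P[->|]; last exact: hN.
have := hw 0%N; rewrite big_ord_recr big1 /= ?add0r ?scale1r // => i _.
by rewrite hN ?scaler0.
Qed.

(** The F-point with x + i y = 2 and x - i y = 1/2: the coordinates of its n-th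
    power are x_n = (2^n + 2^-n) / 2 and y_n = - i (2^n - 2^-n) / 2, and the x_n
    are pairwise distinct. *)

Section HyperbolicPoint.

Lemma mulQi (a b c d : rat) :
  (Complex a b : Qi) * Complex c d = Complex (a * c - b * d) (a * d + b * c).
Proof. by []. Qed.
Lemma addQi (a b c d : rat) :
  (Complex a b : Qi) + Complex c d = Complex (a + c) (b + d).
Proof. by []. Qed.
Lemma oppQi (a b : rat) : - (Complex a b : Qi) = Complex (- a) (- b).
Proof. by []. Qed.

Let c54 : Qi := Complex (5 / 4) 0.
Let s34 : Qi := Complex 0 (- (3 / 4)).

Fact hyp_eq : c54 ^+ 2 + s34 ^+ 2 = 1.
Proof. by apply/eqP; rewrite eq_complex. Qed.

Definition hyp_point : SO2 Qi := SO2Point hyp_eq.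

Fixpoint hyp_xy n : rat * rat :=
  if n is n'.+1 then
    let: (r, s) := hyp_xy n' in (5 / 4 * r + 3 / 4 * s, 5 / 4 * s + 3 / 4 * r)
  else (1, 0).

Lemma hyp_pow n : powx hyp_point n = Complex (hyp_xy n).1 0 /\
  powy hyp_point n = Complex 0 (- (hyp_xy n).2).
Proof.
elim: n => [|n [hx hy]]; first by rewrite !powE oppr0.
have -> : hyp_xy n.+1 = (5 / 4 * (hyp_xy n).1 + 3 / 4 * (hyp_xy n).2,
    5 / 4 * (hyp_xy n).2 + 3 / 4 * (hyp_xy n).1) by rewrite [LHS]/=; case: (hyp_xy n).
rewrite powxS powyS hx hy -[so_x _]/c54 -[so_y _]/s34 !mulQi oppQi !addQi.
by split; congr Complex; rewrite /fst /snd; ring.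
Qed.

Lemma hyp_xy_pos n : 0 < (hyp_xy n).1 /\ 0 <= (hyp_xy n).2.
Proof. by elim: n => [//|n]; rewrite /=; case: (hyp_xy n) => r s /=; lra. Qed.

Lemma hyp_x_inj : injective (fun n => (hyp_xy n).1).
Proof.
have hS n : (hyp_xy n).1 < (hyp_xy n.+1).1.
  have := hyp_xy_pos n; rewrite [hyp_xy n.+1]/=; case: (hyp_xy n) => r s.
  by rewrite /fst /snd; lra.
have mono := homo_ltn lt_trans hS.
by move=> m n /= e; case: (ltngtP m n) => // /mono; rewrite e ltxx.
Qed.

Lemma hyp_y_neq0 n : (0 < n)%N -> powy hyp_point n != 0.
Proof.
case: n => // n _; have [_ ->] := hyp_pow n.+1; rewrite eq_complex negb_and.
apply/orP; right; rewrite [complex.Im _]/(- _) oppr_eq0.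
have := hyp_xy_pos n; rewrite [hyp_xy n.+1]/=; case: (hyp_xy n) => r s.
by rewrite /fst /snd => h; rewrite gt_eqF //; lra.
Qed.

Variable U : lmodType Qi.

(** Each function u_n = x_n c_n + y_n d_n satisfies
    u_n(g h) + u_n(g^-1 h) = 2 x_n(g) u_n(h).  At the point g above the factors
    2 x_n(g) are distinct, so the operator on the left separates the u_n. *)
Lemma harmonic_independence (c d : nat -> U) N :
  (forall h : SO2 Qi, \sum_(n < N) (powx h n *: c n + powy h n *: d n) = 0) ->
  forall n, (n < N)%N -> c n = 0 /\ ((0 < n)%N -> d n = 0).
Proof.
move=> hcd; pose u h n := powx h n *: c n + powy h n *: d n.
pose lam n := 2 * powx hyp_point n.
have lamI : injective lam.
  move=> n n'; rewrite /lam; have [-> _] := hyp_pow n; have [-> _] := hyp_pow n'.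
  move/(mulfI _) => h; have {h}/h[] : (2 : Qi) != 0 by [].
  by move/hyp_x_inj.
have shift h n : u (so_mul hyp_point h) n + u (so_mul (so_inv hyp_point) h) n =
    lam n *: u h n.
  rewrite /u /lam; have [-> ->] := pow_mul hyp_point h n.
  have [-> ->] := pow_mul (so_inv hyp_point) h n.
  have [-> ->] : powx (so_inv hyp_point) n = powx hyp_point n /\
                 powy (so_inv hyp_point) n = - powy hyp_point n.
    elim: n => [|n [hx hy]]; first by rewrite !powE oppr0.
    by rewrite !(powxS _ n, powyS _ n) hx hy /=; split; ring.
  by module_with U; ring.
have hlam j h : \sum_(n < N) lam n ^+ j *: u h n = 0.
  elim: j h => [|j ih] h.
    by rewrite (eq_bigr (fun n : 'I_N => u h n)) ?hcd // => n _; rewrite scale1r.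
  rewrite (eq_bigr (fun n : 'I_N => lam n ^+ j *: u (so_mul hyp_point h) n +
     lam n ^+ j *: u (so_mul (so_inv hyp_point) h) n)) ?big_split /= ?ih ?addr0 //.
  by move=> n _; rewrite -scalerDr shift scalerA -exprSr.
have u0 h n : (n < N)%N -> u h n = 0.
  exact: (vandermonde lamI (fun j => hlam j h)).
move=> n hn; have c0 : c n = 0.
  by have := u0 (so_one _) n hn; rewrite /u powx_one powy_one scale1r scale0r addr0.
split=> // n0; have /eqP := u0 hyp_point n hn.
rewrite /u c0 scaler0 add0r scaler_eq0 (negPf (hyp_y_neq0 n0)).
by move/eqP.
Qed.

End HyperbolicPoint.

(** * Decomposition of a rational representation of SO(2) *)

Section Harmonic.
Variable M : lmodType rat.
Implicit Types f e : fseq M.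

Section Ring.
Variables (R : comAlgType rat) (g : SO2 R).

Definition harmx f : bc R M := fs_sum (fun n m => tens (powx g n) m) f.
Definition harmy f : bc R M := fs_sum (fun n m => tens (powy g n) m) f.
Definition harm f e : bc R M := harmx f + harmy e.

Lemma harmxD : {morph harmx : f e / f + e}.
Proof. by apply: fs_sumD => n u v; apply: tensDr. Qed.
Lemma harmyD : {morph harmy : f e / f + e}.
Proof. by apply: fs_sumD => n u v; apply: tensDr. Qed.
Lemma harmx_single n m : harmx (single n m) = tens (powx g n) m.
Proof. by apply: fs_sum_single => k u v; apply: tensDr. Qed.
Lemma harmy_single n m : harmy (single n m) = tens (powy g n) m.
Proof. by apply: fs_sum_single => k u v; apply: tensDr. Qed.
Lemma harmx0 : harmx 0 = 0.
Proof. by apply: (addIr (harmx 0)); rewrite -harmxD !add0r. Qed.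
Lemma harmy0 : harmy 0 = 0.
Proof. by apply: (addIr (harmy 0)); rewrite -harmyD !add0r. Qed.
Lemma harmD f e f' e' : harm (f + f') (e + e') = harm f e + harm f' e'.
Proof. by rewrite /harm harmxD harmyD addrACA. Qed.

Lemma harmE f e N : (forall n, (N <= n)%N -> f n = 0) ->
  (forall n, (N <= n)%N -> e n = 0) ->
  harm f e = \sum_(n < N) (tens (powx g n) (f n) + tens (powy g n) (e n)).
Proof.
move=> hf he; rewrite big_split /harm /harmx /harmy; congr (_ + _);
  by apply: fs_sumE => // k u v; apply: tensDr.
Qed.

Definition harmonic u := exists f e, u = harm f e.

Lemma harmonicD u v : harmonic u -> harmonic v -> harmonic (u + v).
Proof.
by move=> [f [e ->]] [f' [e' ->]]; exists (f + f'), (e + e'); rewrite harmD.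
Qed.
Lemma harmonicx n m : harmonic (tens (powx g n) m).
Proof. by exists (single n m), 0; rewrite /harm harmx_single harmy0 addr0. Qed.
Lemma harmonicy n m : harmonic (tens (powy g n) m).
Proof. by exists 0, (single n m); rewrite /harm harmy_single harmx0 add0r. Qed.
Lemma harmonic0 : harmonic 0.
Proof. by rewrite -(tens0 M (powx g 0)); apply: harmonicx. Qed.

Lemma tens_half (a : R) (m : M) : tens a m = tens (2 * a) (2^-1 *: m).
Proof.
rewrite tensZ; congr tens; rewrite mulr_natl -[a *+ 2]scaler_nat scalerA.
by rewrite mulVf ?scale1r.
Qed.

Lemma harmonic_mul (a : R) : (forall n m, harmonic (tens (a * powx g n) m)) ->
  (forall n m, harmonic (tens (a * powy g n) m)) ->
  forall u, harmonic u -> harmonic (a *: u).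
Proof.
move=> hx hy u [f [e ->]]; rewrite /harm scalerDr; apply: harmonicD.
  elim/fs_ind: f {e} => [|f f' hf hf'|n m]; first by rewrite harmx0 scaler0; apply: harmonic0.
    by rewrite harmxD scalerDr; apply: harmonicD.
  by rewrite harmx_single scale_tens; apply: hx.
elim/fs_ind: e {f} => [|f f' hf hf'|n m]; first by rewrite harmy0 scaler0; apply: harmonic0.
  by rewrite harmyD scalerDr; apply: harmonicD.
by rewrite harmy_single scale_tens; apply: hy.
Qed.

(** The identity 2 cos t cos nt = cos (n+1)t + cos (n-1)t and its analogues. *)
Lemma harmonic_x u : harmonic u -> harmonic (so_x g *: u).
Proof.
apply: harmonic_mul => -[|n] m.
- by rewrite powx0 mulr1 -powx1; apply: harmonicx.
- rewrite tens_half (_ : 2 * _ = powx g n.+2 + powx g n).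
    by rewrite tensDl; apply: harmonicD; apply: harmonicx.
  by rewrite !(powxS _ n.+1, powxS _ n, powyS _ n); ring: (so_y_sqr g).
- by rewrite powy0 mulr0 tens0l; apply: harmonic0.
- rewrite tens_half (_ : 2 * _ = powy g n.+2 + powy g n).
    by rewrite tensDl; apply: harmonicD; apply: harmonicy.
  by rewrite !(powyS _ n.+1, powxS _ n, powyS _ n); ring: (so_y_sqr g).
Qed.

Lemma harmonic_y u : harmonic u -> harmonic (so_y g *: u).
Proof.
apply: harmonic_mul => -[|n] m.
- by rewrite powx0 mulr1 -powy1; apply: harmonicy.
- rewrite tens_half (_ : 2 * _ = powy g n.+2 - powy g n).
    rewrite tensDl tensNl -tensN; apply: harmonicD; exact: harmonicy.
  by rewrite !(powyS _ n.+1, powxS _ n, powyS _ n); ring: (so_y_sqr g).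
- by rewrite powy0 mulr0 tens0l; apply: harmonic0.
- rewrite tens_half (_ : 2 * _ = powx g n - powx g n.+2).
    rewrite tensDl tensNl -tensN; apply: harmonicD; exact: harmonicx.
  by rewrite !(powxS _ n.+1, powxS _ n, powyS _ n); ring: (so_y_sqr g).
Qed.

End Ring.

(** Multiplication by x and y preserves the combinations of the x_n and y_n, so
    these exhaust the coordinate ring. *)
Lemma harmonic_coord (u : bc coord M) : harmonic coord_point u.
Proof.
elim/bc_ind: u => [|u v hu hv|[p q] m]; first exact: harmonic0.
  exact: harmonicD.
have hp (r : {poly rat}) k : harmonic coord_point (tens ((r, 0) : coord) k).
  elim/poly_ind: r k => [|r c ih] k; first by rewrite (tens0l coord); apply: harmonic0.
  have -> : ((r * 'X + c%:P, 0) : coord) = coord_x * (r, 0) + c *: 1.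
    by congr pair => /=; rewrite ?alg_polyC; ring.
  rewrite tensDl -scale_tens -tensZ; apply: harmonicD; first exact: harmonic_x.
  exact: (harmonicx coord_point 0).
rewrite coordE tensDl -scale_tens; apply: harmonicD => //.
exact: harmonic_y.
Qed.

Lemma bc_ring_harm (R S : comAlgType rat) (phi : {lrmorphism R -> S}) g f e :
  bc_ring phi (harm g f e) = harm (so_map phi g) f e.
Proof.
rewrite /harm bc_ringD; congr (_ + _).
  elim/fs_ind: f {e} => [|f f' hf hf'|n m]; first by rewrite !harmx0 bc_ring0.
    by rewrite !harmxD bc_ringD hf hf'.
  by rewrite !harmx_single bc_ringE; have [-> _] := pow_map phi g n.
elim/fs_ind: e {f} => [|f f' hf hf'|n m]; first by rewrite !harmy0 bc_ring0.
  by rewrite !harmyD bc_ringD hf hf'.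
by rewrite !harmy_single bc_ringE; have [_ ->] := pow_map phi g n.
Qed.

Lemma harm_unique f e : e 0%N = 0 ->
  (forall h : SO2 Qi, harm h f e = 0) -> f = 0 /\ e = 0.
Proof.
move=> e0 h0; pose N := maxn (fs_bound f) (fs_bound e).
have hf n : (N <= n)%N -> f n = 0.
  by rewrite geq_max => /andP[h _]; apply: fs_boundP.
have he n : (N <= n)%N -> e n = 0.
  by rewrite geq_max => /andP[_ h]; apply: fs_boundP.
have hi := @harmonic_independence (bc Qi M) (fun n => tens 1 (f n)) (fun n => tens 1 (e n)) N.
have {hi}hi n : (n < N)%N -> tens (1 : Qi) (f n) = 0 /\ ((0 < n)%N -> tens (1 : Qi) (e n) = 0).
  apply: hi => h; rewrite -[RHS](h0 h) (harmE h hf he); apply: eq_bigr => k _.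
  by rewrite !scale_tens !mulr1.
split; apply: fs_ext => n; case: (ltnP n N) => [hn|]; [|exact: hf| |exact: he].
  by have [h _] := hi n hn; apply: tens1_inj; rewrite h tens0.
case: n hn => // n hn; have [_ /(_ isT) h] := hi _ hn.
by apply: tens1_inj; rewrite h tens0.
Qed.

End Harmonic.

Section Isotypic.
Variable M : gKmodule.
Implicit Types m a b : M.

(** Every point is the image of the universal one, and the action is natural.
    The coefficient of y_0 = 0 is normalised to 0. *)
Lemma harmonic_expansion m : exists f e : fseq M, e 0%N = 0 /\
  forall (R : comAlgType rat) (g : SO2 R), K_act M g (tens 1 m) = harm g f e.
Proof.
have [f [e he]] := harmonic_coord (K_act M coord_point (tens 1 m)).
exists f, (e - single 0 (e 0%N)); split; first by rewrite !fsE singleE subrr.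
move=> R g; have := act_natural [the {lrmorphism coord -> R} of coord_eval g]
    coord_point (tens 1 m : bc coord M).
rewrite bc_ringE rmorph1 coord_eval_point => <-.
rewrite he bc_ring_harm coord_eval_point /harm; congr (_ + _).
by rewrite harmyD -(linearN (single 0)) harmy_single powy0 tens0l addr0.
Qed.

Definition isotypic n a b := forall (R : comAlgType rat) (g : SO2 R),
  K_act M g (tens 1 a) = tens (powx g n) a + tens (powy g n) b.

(** The two expansions of the action of g h = g . h on [m] are compared as
    functions of h: independence gives the action of the F-points g on each
    coefficient.  A second use of independence, for the expansion of the
    coefficient itself, extends the formula from F-points to all points. *)
Lemma isotypic_decomposition m : exists N0 (a b : nat -> M),
  (forall N, (N0 <= N)%N -> m = \sum_(n < N) a n) /\
  forall n, isotypic n (a n) (b n) /\ isotypic n (b n) (- a n).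
Proof.
have [f [e [e0 hm]]] := harmonic_expansion m.
pose N := maxn (fs_bound f) (fs_bound e).
have hf n : (N <= n)%N -> f n = 0.
  by rewrite geq_max => /andP[h _]; apply: fs_boundP.
have he n : (N <= n)%N -> e n = 0.
  by rewrite geq_max => /andP[_ h]; apply: fs_boundP.
have hQi n (g : SO2 Qi) :
    K_act M g (tens 1 (f n)) = tens (powx g n) (f n) + tens (powy g n) (e n) /\
    K_act M g (tens 1 (e n)) = tens (powx g n) (e n) - tens (powy g n) (f n).
  case: (ltnP n N) => hn; last first.
    by rewrite hf ?he // !tens0 linear0 subr0 addr0.
  (* The defects of the two formulas, as coefficients of x_n(h) and y_n(h). *)
  pose c k := K_act M g (tens 1 (f k)) - (tens (powx g k) (f k) + tens (powy g k) (e k)).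
  pose d k := K_act M g (tens 1 (e k)) - (tens (powx g k) (e k) - tens (powy g k) (f k)).
  have hcd : forall h : SO2 Qi, \sum_(k < N) (powx h k *: c k + powy h k *: d k) = 0.
    move=> h; rewrite -[RHS](subrr (K_act M (so_mul g h) (tens 1 m))).
    rewrite {1}act_mul !hm !(harmE _ hf he) linear_sum /= -sumrB.
    apply: eq_bigr => k _; rewrite (linearD (K_act M g)).
    have [-> ->] := pow_mul g h k.
    rewrite [tens (powx h k) _]tens1 [tens (powy h k) _]tens1.
    rewrite !(linearZ_LR (K_act M g)) /c /d.
    move: (K_act M g (tens 1 (f k))) (K_act M g (tens 1 (e k))) => u v.
    rewrite [tens (powx g k) (f k)]tens1 [tens (powx g k) (e k)]tens1.
    rewrite [tens (powy g k) (f k)]tens1 [tens (powy g k) (e k)]tens1.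
    rewrite [tens (_ - _) _]tens1 [tens (_ + _) _]tens1.
    by module_with (bc Qi M : lmodType Qi); ring.
  have [/subr0_eq hc hd] := harmonic_independence hcd hn; split=> //.
  case: n hn hc hd => [|n] hn hc hd; last exact/subr0_eq/hd.
  by rewrite e0 !tens0 linear0 powy0 tens0l subr0.
(* A formula that holds at the F-points determines the expansion of [a]. *)
have lift n a b : (n = 0%N -> b = 0) -> (forall g : SO2 Qi,
    K_act M g (tens 1 a) = tens (powx g n) a + tens (powy g n) b) -> isotypic n a b.
  move=> b0 hab R g; have [f' [e' [e'0 ha]]] := harmonic_expansion a.
  have [|h|hf' he'] := @harm_unique M (f' - single n a) (e' - single n b).
  - rewrite !fsE e'0 singleE sub0r; case: eqP => [/esym/b0->|_]; exact: oppr0.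
  - have : harm h f' e' = harm h (single n a) (single n b).
      by rewrite -ha hab /harm harmx_single harmy_single.
    move=> hh; apply: (addIr (harm h (single n a) (single n b))).
    by rewrite -harmD !subrK hh add0r.
  by rewrite ha (subr0_eq hf') (subr0_eq he') /harm harmx_single harmy_single.
exists N, f, e; split.
  move=> N' hN; apply: tens1_inj; rewrite -[LHS]act_one hm.
  rewrite (@harmE _ _ _ _ _ N') => [|n hn|n hn]; last 2 first.
  - by rewrite hf ?(leq_trans hN).
  - by rewrite he ?(leq_trans hN).
  rewrite (eq_bigr (fun n : 'I_N' => tens (1 : Qi) (f n))).
    by elim/big_rec2: _ => [|i u v _ ->]; rewrite ?tens0 ?tensDr.
  by move=> n _; rewrite powx_one powy_one tens0l addr0.
move=> n; split; first by apply: lift => [->//|g]; have [] := hQi n g.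
case: n => [|n]; first by move=> R g; rewrite e0 !tens0 linear0 powy0 tens0l addr0.
by apply: lift => // g; have [_ ->] := hQi n.+1 g; rewrite tensN.
Qed.

(** The coefficient of eps in a dual number. *)
Definition eps_coef (z : dual_numbers) : rat^o := (val z : {poly rat})`_1.
Fact eps_coef_linear : linear eps_coef.
Proof. by move=> a u v; rewrite /eps_coef /= coefD coefZ. Qed.
HB.instance Definition _ := GRing.isLinear.Build rat dual_numbers rat^o _
  eps_coef eps_coef_linear.

Lemma eps_coef_eps : eps_coef eps = 1.
Proof.
rewrite /eps_coef /eps /= mk_monic_Xn Pdiv.CommonRing.rmodp_small ?coefX //.
by rewrite size_polyX size_polyXn.
Qed.

Definition so2_gen (a : M) : M := lie M (sl2_of 0 (-1) 1) a.

(** The formula at the point 1 + eps, compared in the coefficients of eps. *)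
Lemma isotypic_Z n a b : isotypic n a b -> so2_gen a = n%:R *: b.
Proof.
move=> /(_ _ (so_tangent 1)); have [-> ->] := pow_tangent 1 n.
rewrite act_differential mulr1 => /addrI /(congr1 (@bc_coef _ eps_coef M)).
rewrite !bc_coefE (linearZ_LR eps_coef) /= eps_coef_eps scale1r /so2_gen => ->.
by congr (_ *: _); apply: mulr1.
Qed.

(** The components [a' l] of [a] are eigenvectors of Z^2 with the distinct
    eigenvalues - l^2, and [a] is one with eigenvalue - n^2; so [a] is its own
    component of index n. *)
Lemma Z_isotypic n a b : (0 < n)%N -> so2_gen a = n%:R *: b ->
  so2_gen b = - (n%:R *: a) -> isotypic n a b.
Proof.
move=> n0 hab hba; have [N0 [a' [b' [ha hi]]]] := isotypic_decomposition a.
pose N := maxn N0 n.+1.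
have {}ha := ha N (leq_maxl _ _); have hn : (n < N)%N by rewrite leq_maxr.
pose w l := a' l - (if l == n then a else 0).
pose z l : rat := - (l ^ 2)%:R.
have zI : injective z.
  by move=> k l /oppr_inj/eqP; rewrite eqr_nat eqn_exp2r // => /eqP.
have Z2 l (c d : M) : so2_gen c = l%:R *: d -> so2_gen d = - (l%:R *: c) ->
    so2_gen (so2_gen c) = z l *: c.
  move=> -> hd; rewrite /so2_gen linearZ_LR -/(so2_gen d) hd scalerN scalerA.
  by rewrite -natrM mulnn scaleNr.
have Z2l l : so2_gen (so2_gen (a' l)) = z l *: a' l.
  have [h1 h2] := hi l; apply: (Z2 _ _ _ (isotypic_Z h1)).
  by rewrite (isotypic_Z h2) scalerN.
have w0 : forall l, (l < N)%N -> w l = 0.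
  apply: (vandermonde zI) => j.
  have -> : \sum_(l < N) z l ^+ j *: w l = \sum_(l < N) z l ^+ j *: a' l - z n ^+ j *: a.
    rewrite -[X in _ - X](_ : \sum_(l < N) z l ^+ j *: (if l == n :> nat then a else 0) = _).
      by rewrite -sumrB; apply: eq_bigr => l _; rewrite scalerBr.
    rewrite (bigD1 (Ordinal hn)) //= eqxx big1 ?addr0 // => l.
    by rewrite -val_eqE /= => /negPf ->; rewrite scaler0.
  apply/eqP; rewrite subr_eq0; apply/eqP.
  elim: j => [|j ih]; first by rewrite scale1r [RHS]ha; apply: eq_bigr => l _; rewrite scale1r.
  have := congr1 (fun x => so2_gen (so2_gen x)) ih.
  rewrite /so2_gen !linear_sum /= (linearZ_LR (lie M _)) (linearZ_LR (lie M _)) -!/(so2_gen _).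
  rewrite (Z2 _ _ _ hab hba) scalerA -exprSr => <-; apply: eq_bigr => l _.
  by rewrite (linearZ_LR (lie M _)) (linearZ_LR (lie M _)) -!/(so2_gen _) Z2l scalerA -exprSr.
have := w0 n hn; rewrite /w eqxx => /subr0_eq ha'.
have [hi1 _] := hi n; have := isotypic_Z hi1; rewrite ha' hab => /(scalerI _) hb.
by move: hi1; rewrite ha' -hb // pnatr_eq0 -lt0n.
Qed.

(** -1 acts on the n-th isotypic part by (-1)^n. *)
Lemma odd_decomposition m :
  (forall m, K_act M (so_neg_one rat^o) (tens 1 m) = - tens 1 m) ->
  exists N (a b : nat -> M), m = \sum_(k < N) a k /\
    forall k, so2_gen (a k) = k.*2.+1%:R *: b k /\ so2_gen (b k) = - (k.*2.+1%:R *: a k).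
Proof.
move=> hneg; have [N [a [b [hm hi]]]] := isotypic_decomposition m.
have a0 n : ~~ odd n -> a n = 0.
  move=> hn; have [h _] := hi n; have := h _ (so_neg_one rat^o).
  rewrite hneg powx_neg_one powy_neg_one tens0l addr0 -signr_odd (negPf hn) expr0.
  move/(congr1 (@bc_coef _ [the {linear rat^o -> rat^o} of idfun] M)).
  rewrite -tensNl !bc_coefE /= scaleNr scale1r => /eqP.
  rewrite eq_sym -addr_eq0 -mulr2n -scaler_nat scaler_eq0 pnatr_eq0 /=.
  by move/eqP.
exists N, (fun k => a k.*2.+1), (fun k => b k.*2.+1); split; last first.
  move=> k; have [h1 h2] := hi k.*2.+1; split; first exact: isotypic_Z.
  by rewrite (isotypic_Z h2) scalerN.
rewrite (hm N.*2) -?addnn ?leq_addr //; elim: N {hm} => [|N ih]; first by rewrite !big_ord0.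
by rewrite addSn addnS !big_ord_recr /= ih addnn a0 ?odd_double // addr0.
Qed.

End Isotypic.

(** * The pair (W, theta) of a rational representation of the quiver *)

Lemma imag2 : imag * imag = -1.
Proof. by apply/eqP; rewrite eq_complex. Qed.
Lemma conj_imag : conjQi imag = - imag.
Proof. by apply/eqP; rewrite eq_complex /= !eqxx. Qed.
Lemma conj_rat (a : rat) : conjQi (a *: 1) = a *: 1.
Proof. by apply/eqP; rewrite eq_complex /= mulr0 oppr0 !eqxx. Qed.

Section Restriction.
Variable V : lmodType Qi.

Definition resQ : Type := V.
HB.instance Definition _ := GRing.Zmodule.on resQ.

Definition resQ_scale (q : rat) (v : resQ) : resQ := (q *: (1 : Qi)) *: (v : V).

Fact resQ_scaleA a b v : resQ_scale a (resQ_scale b v) = resQ_scale (a * b) v.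
Proof. by rewrite /resQ_scale scalerA -scalerAl mul1r scalerA. Qed.
Fact resQ_scale1 : left_id 1 resQ_scale.
Proof. by move=> v; rewrite /resQ_scale !scale1r. Qed.
Fact resQ_scaleDr : right_distributive resQ_scale +%R.
Proof. by move=> a u v; apply: scalerDr. Qed.
Fact resQ_scaleDl v : {morph resQ_scale^~ v : a b / a + b}.
Proof. by move=> a b; rewrite /resQ_scale !scalerDl. Qed.
HB.instance Definition _ := GRing.Zmodule_isLmodule.Build rat resQ
  resQ_scaleA resQ_scale1 resQ_scaleDr resQ_scaleDl.

Lemma resQE (q : rat) (v : resQ) : q *: v = (q *: (1 : Qi)) *: (v : V).
Proof. by []. Qed.

Definition res_i (v : resQ) : resQ := imag *: (v : V).
Fact res_i_linear : linear res_i.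
Proof.
move=> a u v; rewrite -[RHS]/(((a *: (1 : Qi)) *: (imag *: (u : V)) : V) + imag *: v).
by rewrite /res_i scalerDr resQE !scalerA mulrC.
Qed.
HB.instance Definition _ := GRing.isLinear.Build rat resQ resQ _ res_i res_i_linear.

Lemma res_iZ (q : rat) v : res_i (q *: v) = q *: res_i v.
Proof. exact: linearZ. Qed.

Lemma res_iK v : res_i (res_i v) = - v.
Proof. by rewrite /res_i scalerA imag2; apply: scaleN1r. Qed.
End Restriction.

Section Rep.
Variable V : qrep.

Definition theta (v : resQ (Vp V)) : resQ (Vp V) := vphi_m V (phi_b V v).

Lemma thetaZ (a : Qi) (v : Vp V) : theta (a *: v) = conjQi a *: (theta v : Vp V).
Proof. by rewrite /theta linearZ_LR linearZ_LR. Qed.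

Fact theta_linear : linear theta.
Proof.
move=> a u v; rewrite -[RHS]/(((a *: (1 : Qi)) *: (theta u : Vp V) : Vp V) + theta v).
by rewrite /theta linearD linearD -!/(theta _) resQE thetaZ conj_rat.
Qed.
HB.instance Definition _ := GRing.isLinear.Build rat (resQ (Vp V)) (resQ (Vp V)) _
  theta theta_linear.

Lemma theta_i v : theta (res_i v) = - res_i (theta v).
Proof. by rewrite /res_i thetaZ conj_imag; exact: (@scaleNr _ (Vp V) imag (theta v)). Qed.

Definition G_ob : gKmodule := ladder_gK (@res_iK (Vp V)) theta_i.

End Rep.

(** * The operators X, Y, H in the rational basis P, S, Z *)

Section RealForm.
Variable M : gKmodule.
Implicit Types (w : bc Qi M) (m : M).

Definition opP : {linear M -> M} := lie M (sl2_of 1 0 0).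
Definition opS : {linear M -> M} := lie M (sl2_of 0 1 1).
Definition opZ : {linear M -> M} := lie M (sl2_of 0 (-1) 1).

Lemma lie_PSZ (A : sl2 rat) m : lie M A m =
  sl2_mx A 0 0 *: opP m + ((sl2_mx A 0 1 + sl2_mx A 1 0) / 2) *: opS m
  + ((sl2_mx A 1 0 - sl2_mx A 0 1) / 2) *: opZ m.
Proof.
rewrite /opP /opS /opZ.
rewrite [A in LHS]sl2E.
move: (sl2_mx A 0 0) (sl2_mx A 0 1) (sl2_mx A 1 0) => a b c.
have l0 : lie M 0 m = 0.
  have := lie_linear 1 0 0 m; rewrite !scale1r addr0 => h.
  by apply: (addIr (lie M 0 m)); rewrite add0r -h.
have ladZ r B : lie M (r *: B) m = r *: lie M B m.
  by rewrite -[r *: B]addr0 lie_linear l0 addr0.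
have -> : sl2_of a b c = a *: sl2_of 1 0 0 + (((b + c) / 2) *: sl2_of 0 1 1
    + ((c - b) / 2) *: sl2_of 0 (-1) 1).
  rewrite !sl2_scale; apply/val_inj/matrixP => i j; rewrite !mxE.
  by case: ifP; case: ifP => _ _; field.
by rewrite lie_linear lie_linear ladZ addrA.
Qed.

Let bE := bc_lin Qi (lie M (sl2_of 0 1 0)).
Let bF := bc_lin Qi (lie M (sl2_of 0 0 1)).

Let lie_EF a b m :
  lie M (sl2_of 0 a b) m = a *: lie M (sl2_of 0 1 0) m + b *: lie M (sl2_of 0 0 1) m.
Proof.
rewrite [LHS]lie_PSZ [lie M (sl2_of 0 1 0) m]lie_PSZ [lie M (sl2_of 0 0 1) m]lie_PSZ.
by rewrite !mxE /=; module_with (gK_space M); field.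
Qed.

Let bc_EF a b w : bc_lin Qi (lie M (sl2_of 0 a b)) w =
  (a *: (1 : Qi)) *: bE w + (b *: (1 : Qi)) *: bF w.
Proof.
apply: (@bc_lin_ext _ _ _ (bc_lin Qi _) ((a *: (1 : Qi)) \*: bE \+ (b *: (1 : Qi)) \*: bF)).
move=> m; rewrite /= /bE /bF !bc_linE /= !scale_tens lie_EF tensDr !tensZ.
by rewrite -!scalerAl !mul1r.
Qed.

Lemma X_actE w : X_act M w = (2^-1 : Qi) *: (bc_lin Qi opP w + imag *: bc_lin Qi opS w).
Proof.
rewrite -[X_act M w]/(lie_ext (lie M) sl2X w) /sl2X lie_extZ lie_ext_of; congr (_ *: _).
by rewrite (bc_EF 1 1) !scale1r scalerDr addrA.
Qed.

Lemma Y_actE w : Y_act M w = (2^-1 : Qi) *: (bc_lin Qi opP w - imag *: bc_lin Qi opS w).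
Proof.
rewrite -[Y_act M w]/(lie_ext (lie M) sl2Y w) /sl2Y lie_extZ lie_ext_of; congr (_ *: _).
by rewrite (bc_EF 1 1) !scale1r scalerDr opprD !scaleNr addrA.
Qed.

Lemma H_actE w : H_act M w = imag *: bc_lin Qi opZ w.
Proof.
rewrite -[H_act M w]/(lie_ext (lie M) sl2H w) /sl2H lie_ext_of scale0r add0r.
rewrite (bc_EF (-1) 1) scalerDr !scalerA; congr (_ *: _ + _ *: _);
  by apply/eqP; rewrite eq_complex.
Qed.

Lemma bc_opP w : bc_lin Qi opP w = X_act M w + Y_act M w.
Proof.
rewrite X_actE Y_actE; by module_with (bc Qi M : lmodType Qi).
Qed.

Lemma bc_opS w : bc_lin Qi opS w = - (imag *: (X_act M w - Y_act M w)).
Proof.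
rewrite X_actE Y_actE; by module_with (bc Qi M : lmodType Qi); apply/eqP; rewrite eq_complex.
Qed.

Lemma bc_opZ w : bc_lin Qi opZ w = - (imag *: H_act M w).
Proof. by rewrite H_actE scalerA imag2 scaleN1r opprK. Qed.

Lemma bc_Re_lin (N : lmodType rat) (f : {linear M -> N}) w :
  bc_Re (bc_lin Qi f w) = f (bc_Re w).
Proof.
elim/bc_ind: w => [|u v hu hv|a m].
- by rewrite linear0 /bc_Re !bc_coef0 linear0.
- by rewrite linearD /bc_Re !bc_coefD linearD; congr (_ + _).
- by rewrite bc_linE /bc_Re !bc_coefE linearZ.
Qed.

Lemma bc_Re_c w : bc_Re (c_act w) = bc_Re w.
Proof.
rewrite /c_act; elim/bc_ind: w => [|u v hu hv|a m].
- by rewrite bc_ring0.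
- by rewrite bc_ringD /bc_Re !bc_coefD; congr (_ + _).
- by rewrite bc_ringE /bc_Re !bc_coefE; case: a.
Qed.

Lemma bc_ReE w : w = tens 1 (bc_Re w) - tens imag (bc_Re (imag *: w)).
Proof.
elim/bc_ind: w => [|u v hu hv|a m].
- by rewrite scaler0 /bc_Re bc_coef0 !tens0 subr0.
- rewrite {1}hu {1}hv scalerDr /bc_Re !bc_coefD !tensDr.
  by rewrite [LHS]addrACA -opprD.
- rewrite scale_tens /bc_Re !bc_coefE !tensZ -tensNl -tensDl; congr tens.
  case: a => x y; apply/eqP; rewrite eq_complex /=.
  by rewrite !(mul0r, mulr0, mul1r, mulr1, sub0r, addr0, add0r, opprK, oppr0) !eqxx.
Qed.

End RealForm.

(** * The comparison map from the ladder of M_1 to M *)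

Section Comparison.
Variable M : gKmodule.

Notation V := (E_ob M).
Notation V1 := (resQ (Vp V)).
Notation X := (X_act M).
Notation Y := (Y_act M).
Notation H := (H_act M).
Implicit Types (v : V1) (f : G_ob V).

(** A vector of M_1, with M_1 seen as the space V(+) of the representation
    attached to M. *)
Definition wt1 v : bc Qi M := val (v : weight_space M 1).

Lemma wt1D u v : wt1 (u + v) = wt1 u + wt1 v. Proof. by []. Qed.
Lemma wt1_theta v : wt1 (theta v) = c_act (Y (wt1 v)). Proof. by []. Qed.
Lemma wt1_theta2 v : wt1 (theta (theta v)) = X (Y (wt1 v)).
Proof. by rewrite !wt1_theta -c_Y c_actK. Qed.
Lemma wt1_H v : H (wt1 v) = wt1 v.
Proof. by rewrite /wt1 (eigenP (v : weight_space M 1)) scale1r. Qed.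

Definition Xpow k v : bc Qi M := iter k X (wt1 v).

Lemma XpowS k v : Xpow k.+1 v = X (Xpow k v). Proof. by []. Qed.

Lemma XpowD k : {morph Xpow k : u v / u + v}.
Proof. by move=> u v; rewrite /Xpow wt1D; elim: k => //= k ->; rewrite linearD. Qed.
Lemma XpowZ k (a : Qi) (v : Vp V) : Xpow k (a *: v) = a *: Xpow k v.
Proof. by rewrite /Xpow; elim: k => //= k ->; rewrite linearZ. Qed.

Lemma Xpow_H k v : H (Xpow k v) = k.*2.+1%:R *: Xpow k v.
Proof.
elim: k => [|k ih]; first by rewrite scale1r; apply: wt1_H.
rewrite -[Xpow k.+1 v]/(X (Xpow k v)) H_X ih linearZ_LR -scalerDl.
by rewrite -natrD addn2 doubleS.
Qed.

Lemma Xpow_nat k n v : Xpow k (n%:R *: v) = n%:R *: Xpow k v.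
Proof. by rewrite resQE XpowZ; congr (_ *: _); apply: scaler_nat. Qed.

Lemma XpowB k u v : Xpow k (u - v) = Xpow k u - Xpow k v.
Proof. by apply/eqP; rewrite eq_sym subr_eq -XpowD subrK. Qed.

Lemma XY_YX w : X (Y w) = Y (X w) + H w.
Proof.
have := lie_ext_br (@lie_linear M) (@lie_br M) sl2X sl2Y w.
rewrite sl2_XY -[lie_ext _ sl2H w]/(H w) -[lie_ext _ sl2X _]/(X (Y w)).
by rewrite -[lie_ext _ sl2Y _]/(Y (X w)) => ->; rewrite addrC subrK.
Qed.

(** Y X = X Y - H, and X Y = theta^2 on M_1; the weights 1 + 3 + ... + (2 k + 1)
    add up to (k + 1)^2. *)
Lemma Y_XpowS k v :
  Y (Xpow k.+1 v) = Xpow k (theta (theta v) - (k.+1 ^ 2)%:R *: v).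
Proof.
rewrite XpowB Xpow_nat; elim: k => [|k ih].
  rewrite XpowS -[LHS](addrK (H (wt1 v))) -XY_YX -wt1_theta2 wt1_H.
  by rewrite scale1r.
have := XY_YX (Xpow k.+1 v); rewrite ih Xpow_H -XpowS => /eqP.
rewrite -subr_eq => /eqP <-.
rewrite (linearB X) (linearZ_LR X) -!XpowS.
rewrite -addrA -opprD -scalerDl -natrD; congr (_ - _%:R *: _).
by rewrite -!mulnn; lia.
Qed.

Definition tau f : bc Qi M := fs_sum Xpow f.

Lemma tauD : {morph tau : f g / f + g}. Proof. exact/fs_sumD/XpowD. Qed.
Lemma tau_single k v : tau (single k v) = Xpow k v.
Proof. exact/fs_sum_single/XpowD. Qed.
Lemma tau0 : tau 0 = 0.
Proof. by apply: (addIr (tau 0)); rewrite -tauD !add0r. Qed.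

Lemma tau_X f : tau (ladX f) = X (tau f).
Proof.
elim/fs_ind: f => [|f g hf hg|k v]; first by rewrite (linear0 (@ladX V1)) tau0 linear0.
  by rewrite ladXD !tauD linearD hf hg.
by rewrite ladX_single !tau_single.
Qed.

Lemma tau_J f : tau (ladJ (@res_i (Vp V)) f) = imag *: tau f.
Proof.
elim/fs_ind: f => [|f g hf hg|k v]; first by rewrite (linear0 (ladJ _)) tau0 scaler0.
  by rewrite ladJD !tauD scalerDr hf hg.
by rewrite ladJ_single !tau_single -XpowZ.
Qed.

Lemma tau_H f : tau (ladH f) = H (tau f).
Proof.
elim/fs_ind: f => [|f g hf hg|k v]; first by rewrite (linear0 (@ladH V1)) tau0 linear0.
  by rewrite ladHD !tauD linearD hf hg.
by rewrite ladH_single -(linearZ_LR (single k)) !tau_single Xpow_H Xpow_nat.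
Qed.

Lemma tau_Y f : tau (ladY (@theta V) f) = Y (tau f) - Y (wt1 (f 0%N)).
Proof.
elim/fs_ind: f => [|f g hf hg|[|k] v].
- by rewrite (linear0 (ladY _)) tau0 !linear0 addr0.
- by rewrite ladYD !tauD hf hg fsDE wt1D !(linearD Y) [LHS]addrACA -opprD.
- by rewrite ladY_single0 tau0 tau_single subrr.
- by rewrite ladY_singleS !tau_single Y_XpowS singleE linear0 subr0.
Qed.

Lemma tau_T f : tau (ladT (@theta V) f) = c_act (Y (wt1 (f 0%N))).
Proof. by rewrite /ladT tau_single. Qed.

Lemma tauZ (q : rat) f : tau (q *: f) = (q *: (1 : Qi)) *: tau f.
Proof.
elim/fs_ind: f => [|f g hf hg|k v]; first by rewrite scaler0 tau0 scaler0.
  by rewrite scalerDr !tauD scalerDr hf hg.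
by rewrite -(linearZ_LR (single k)) !tau_single -XpowZ.
Qed.

Lemma bc_ReZ (q : rat) (w : bc Qi M) : bc_Re ((q *: (1 : Qi)) *: w) = q *: bc_Re w.
Proof.
elim/bc_ind: w => [|u v hu hv|a m].
- by rewrite scaler0 /bc_Re bc_coef0 scaler0.
- by rewrite scalerDr /bc_Re !bc_coefD scalerDr; congr (_ + _).
- rewrite scale_tens -scalerAl mul1r /bc_Re !bc_coefE scalerA.
  by congr (_ *: _); case: a.
Qed.

Lemma bc_ReD (u w : bc Qi M) : bc_Re (u + w) = bc_Re u + bc_Re w.
Proof. exact: bc_coefD. Qed.

Lemma bc_ReN (w : bc Qi M) : bc_Re (- w) = - bc_Re w.
Proof. by apply: (addrI (bc_Re w)); rewrite -bc_ReD !subrr /bc_Re bc_coef0. Qed.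

(** Up to the factor 2 this is w + c w for w = tau f, hence it lands in the
    rational form M. *)
Definition comparison f : M := bc_Re (tau f).

Fact comparison_linear : linear comparison.
Proof. by move=> a f g; rewrite /comparison tauD tauZ bc_ReD bc_ReZ. Qed.
HB.instance Definition _ := GRing.isLinear.Build rat (G_ob V) M _ comparison
  comparison_linear.

Lemma comparisonZ (q : rat) (f : fseq V1) : comparison (q *: f) = q *: comparison f.
Proof. exact: linearZ. Qed.
Lemma comparisonN (f : fseq V1) : comparison (- f) = - comparison f.
Proof. exact: linearN. Qed.

(** The discrepancy between [tau_Y] and Y is the vector Y (f 0) of weight -1,
    which has the same Re as its conjugate [tau_T]. *)
Lemma comparison_P f : comparison (ladP (@theta V) f) = opP M (comparison f).
Proof.
rewrite /comparison -bc_Re_lin bc_opP /ladP !tauD tau_X tau_Y tau_T.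
move: (X (tau f)) (Y (tau f)) (Y (wt1 (f 0%N))) => x y z.
by rewrite !bc_ReD bc_Re_c bc_ReN -addrA subrK.
Qed.

Lemma tauN f : tau (- f) = - tau f.
Proof. by apply: (addrI (tau f)); rewrite -tauD !subrr tau0. Qed.

Lemma comparison_S f :
  comparison (ladS (@res_i (Vp V)) (@theta V) f) = opS M (comparison f).
Proof.
rewrite /comparison -bc_Re_lin bc_opS /ladS tau_J !tauD !tauN tau_X tau_Y tau_T.
move: (X (tau f)) (Y (tau f)) (Y (wt1 (f 0%N))) => x y z.
have e : bc_Re (imag *: c_act z) = - bc_Re (imag *: z).
  rewrite -bc_ReN -[in RHS]bc_Re_c -scaleNr /c_act bc_ringZ.
  by congr (bc_Re (_ *: _)); apply/eqP; rewrite eq_complex.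
rewrite !scalerDr !scalerN !(bc_ReD, bc_ReN) e.
set a := bc_Re (imag *: x); set b := bc_Re (imag *: y).
set d := bc_Re (imag *: z); clearbody a b d.
by module_with (gK_space M); ring.
Qed.

Lemma comparison_Z f : comparison (ladZ (@res_i (Vp V)) f) = opZ M (comparison f).
Proof.
by rewrite /comparison -bc_Re_lin bc_opZ /ladZ tauN tau_J tau_H.
Qed.

Fact comparison_lie A f : comparison (lie (G_ob V) A f) = lie M A (comparison f).
Proof.
rewrite [RHS]lie_PSZ -comparison_P -comparison_S -comparison_Z.
by rewrite -!(linearZ_LR comparison) -!(linearD comparison).
Qed.

Lemma comparison_isotypic k v :
  isotypic k.*2.+1 (comparison (single k v)) (- comparison (single k (res_i v))).
Proof.
have Zc j u : so2_gen (comparison (single j u)) =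
    - (j.*2.+1%:R *: comparison (single j (res_i u))).
  rewrite /so2_gen -/(opZ M) -comparison_Z /ladZ ladH_single ladJZ ladJ_single.
  by rewrite comparisonN comparisonZ.
apply: Z_isotypic => //; first by rewrite Zc scalerN.
rewrite /so2_gen (linearN (lie M _)) -/(so2_gen _) Zc opprK res_iK.
by rewrite (linearN (single k)) comparisonN scalerN.
Qed.

(** SO(2) acts on both sides through the action of Z, by [Z_isotypic]. *)
Fact comparison_act (R : comAlgType rat) (g : SO2 R) u :
  bc_lin R comparison (K_act (G_ob V) g u) = K_act M g (bc_lin R comparison u).
Proof.
apply: (@fs_bc_lin_ext _ _ _ (bc_lin R comparison \o K_act (G_ob V) g)
  (K_act M g \o bc_lin R comparison)) => {u} k v /=.
rewrite bc_linE comparison_isotypic ladder_actE scale1r lrot_single /lrot_term ctensE.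
by rewrite linearD /= !bc_linE ladJ_single tensN tensNl.
Qed.

Definition comparison_hom : gKhom (G_ob V) M :=
  GKhom (comparison_lie) comparison_act.

End Comparison.

(** * Bijectivity of X for a nilpotent Casimir element *)

Section Sl2Triple.
Variables (K : fieldType) (U : lmodType K) (H X Y : {linear U -> U}).
Hypothesis HX : forall w, H (X w) = X (H w) + 2 *: X w.
Hypothesis HY : forall w, H (Y w) = Y (H w) + (- 2) *: Y w.
Hypothesis XY : forall w, X (Y w) = Y (X w) + H w.

Definition sl2_casimir w : U := H (H w) - 2 *: H w + 4 *: X (Y w) + w.
Notation C := sl2_casimir.

Fact sl2_casimir_linear : linear C.
Proof.
by move=> a u v; rewrite /C !(linearP H, linearP X, linearP Y); module_with U; ring.
Qed.
HB.instance Definition _ := GRing.isLinear.Build K U U _ C sl2_casimir_linear.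

Lemma sl2_casimirB u v : C (u - v) = C u - C v. Proof. exact: linearB. Qed.
Lemma sl2_casimirZ b u : C (b *: u) = b *: C u. Proof. exact: linearZ. Qed.

Hypothesis C_nilp : exists k, forall w, iter k C w = 0.

Variable a : K.

Lemma casimir_weight w : H w = a *: w -> C w = (a - 1) ^+ 2 *: w + 4 *: X (Y w).
Proof.
move=> hw; rewrite /C hw (linearZ_LR H) hw.
by module_with U; ring.
Qed.

Lemma H_Y_weight w : H w = a *: w -> H (Y w) = (a - 2) *: Y w.
Proof. by move=> hw; rewrite HY hw (linearZ_LR Y) -scalerDl. Qed.

Lemma H_XY_weight w : H w = a *: w -> H (X (Y w)) = a *: X (Y w).
Proof. by move/H_Y_weight => hw; rewrite HX hw (linearZ_LR X) -scalerDl subrK. Qed.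

Lemma H_casimir w : H w = a *: w -> H (C w) = a *: C w.
Proof.
move=> hw; rewrite (casimir_weight hw) (linearD H) !(linearZ_LR H) (H_XY_weight hw) hw.
by module_with U; ring.
Qed.

(** C - l is invertible for l != 0, and C preserves the weight space.  For the
    induction, w' = (w'' - w) / l where (C - l) w'' = C w. *)
Lemma casimir_sub_invertible (l : K) w : l != 0 -> H w = a *: w ->
  exists2 w', H w' = a *: w' & C w' - l *: w' = w.
Proof.
move=> l0; have [k hk] := C_nilp; have {hk} := hk w.
elim: k w => [|k ih] w /=.
  by move=> -> _; exists 0; rewrite ?(linear0 H) ?(linear0 sl2_casimir) scaler0 ?subr0.
rewrite -[C (iter k C w)]/(iter k.+1 C w) iterSr => hk hw.
have [w' hw' e] := ih _ hk (H_casimir hw).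
exists (l^-1 *: (w' - w)).
  by rewrite (linearZ_LR H) (linearB H) hw hw' -scalerBr !scalerA mulrC.
rewrite sl2_casimirZ sl2_casimirB -e; by module_with U; field.
Qed.

(** If X w = 0 then C w = (a + 1)^2 w, and C is nilpotent. *)
Lemma X_injective w : a + 1 != 0 -> H w = a *: w -> X w = 0 -> w = 0.
Proof.
move=> a1 hw hX; have hC : C w = (a + 1) ^+ 2 *: w.
  rewrite (casimir_weight hw) XY hX (linear0 Y) add0r hw.
  by module_with U; ring.
have [k hk] := C_nilp; have := hk w.
have -> : iter k C w = ((a + 1) ^+ 2) ^+ k *: w.
  elim: k {hk} => [|k ih]; first by rewrite scale1r.
  by rewrite /= ih sl2_casimirZ hC scalerA -exprSr.
by move/eqP; rewrite scaler_eq0 !expf_eq0 (negPf a1) !andbF => /eqP.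
Qed.

(** 4 X Y = C - (a - 1)^2 is onto on the weight space. *)
Lemma X_surjective w : a != 1 -> H w = a *: w ->
  exists2 u, H u = (a - 2) *: u & X u = w.
Proof.
move=> a1 hw; have l0 : (a - 1) ^+ 2 != 0 by rewrite expf_neq0 ?subr_eq0.
have [w' hw' <-] := casimir_sub_invertible l0 hw.
exists (4 *: Y w'); first by rewrite (linearZ_LR H) (H_Y_weight hw') !scalerA mulrC.
by rewrite (linearZ_LR X) (casimir_weight hw') addrC addKr.
Qed.

End Sl2Triple.

(** * Bijectivity of the comparison map *)

Lemma natQi_eq0 n : ((n%:R : Qi) == 0) = (n == 0%N).
Proof.
have -> : (n%:R : Qi) = Complex n%:R 0.
  by elim: n => // n ih; rewrite -addn1 !natrD ih addQi addr0.
by rewrite eq_complex /= eqxx andbT pnatr_eq0.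
Qed.

Section ComparisonBijective.
Variable M : gKmodule.
Hypothesis C_nilp : exists k, forall m : M, iter k (@casimir M) (tens 1 m) = 0.
Notation V := (E_ob M).
Notation V1 := (resQ (Vp V)).
Notation X := (X_act M).
Notation H := (H_act M).

Lemma casimir_nilpotent : exists k, forall w : bc Qi M, iter k (@casimir M) w = 0.
Proof.
have [k hk] := C_nilp; exists k.
elim/bc_ind => [|u v hu hv|a m].
- by elim: k {hk} => //= k ->; exact: (linear0 (sl2_casimir H X (Y_act M))).
- have D j : iter j (@casimir M) (u + v) = iter j (@casimir M) u + iter j (@casimir M) v.
    by elim: j => //= j ->; exact: (linearD (sl2_casimir H X (Y_act M))).
  by rewrite D hu hv addr0.
- have Z j : iter j (@casimir M) (a *: tens 1 m) = a *: iter j (@casimir M) (tens 1 m).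
    by elim: j => //= j ->; exact: (linearZ_LR (sl2_casimir H X (Y_act M))).
  by rewrite tens1 Z hk scaler0.
Qed.

Let sl2_casimir_nilpotent : exists k, forall w, iter k (sl2_casimir H X (Y_act M)) w = 0.
Proof. exact: casimir_nilpotent. Qed.

Lemma Xpow_injective k (v : V1) : Xpow k v = 0 -> v = 0.
Proof.
elim: k => [|k ih].
  by rewrite /Xpow /= => h; apply/val_inj.
rewrite XpowS => h; apply: ih; apply: (X_injective (@XY_YX M) sl2_casimir_nilpotent _ (Xpow_H k v) h).
by rewrite natr1 natQi_eq0.
Qed.

Lemma Xpow_surjective k w : H w = k.*2.+1%:R *: w -> exists v : V1, Xpow k v = w.
Proof.
elim: k w => [|k ih] w hw.
  have hw' : w \in eigen_pred H 1%:~R by apply/eqP.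
  by exists (Eigen hw').
have [|u hu <-] := X_surjective (@H_X M) (@H_Y M) sl2_casimir_nilpotent _ hw.
  by rewrite -subr_eq0 -[1]/(1%:R) -natrB // natQi_eq0.
have [|v <-] := ih u.
  by rewrite hu; congr (_ *: _); rewrite doubleS -addn2 natrD addrK.
by exists v.
Qed.

Lemma so2_gen_comparison k (v : V1) :
  so2_gen (comparison (single k v)) = - (k.*2.+1%:R *: comparison (single k (res_i v))).
Proof. by rewrite (isotypic_Z (comparison_isotypic k v)) scalerN. Qed.

Lemma comparison_single_eq0 k (v : V1) : comparison (single k v) = 0 -> v = 0.
Proof.
move=> h; have := so2_gen_comparison k v; rewrite h /so2_gen linear0 => /esym/eqP.
rewrite oppr_eq0 scaler_eq0 pnatr_eq0 /= => /eqP hi.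
apply: (@Xpow_injective k); rewrite [LHS]bc_ReE -XpowZ.
move: h hi; rewrite /comparison !tau_single => -> ->.
by rewrite !tens0 subr0.
Qed.

(** The terms Re (X^k (f k)) are eigenvectors of Z^2 for the distinct eigenvalues
    - (2 k + 1)^2, so all of them vanish if their sum does. *)
Lemma comparison_injective f : @comparison M f = 0 -> f = 0.
Proof.
move=> hf; pose z k : rat := - (k.*2.+1 ^ 2)%:R.
have zI : injective z.
  move=> k l /oppr_inj/eqP; rewrite eqr_nat eqn_exp2r // eqSS -!mul2n eqn_mul2l.
  by move/eqP.
pose Z2 (m : M) := so2_gen (so2_gen m).
have Z2k k (v : V1) : Z2 (comparison (single k v)) = z k *: comparison (single k v).
  rewrite /Z2 so2_gen_comparison /so2_gen (linearN (lie M _)) (linearZ_LR (lie M _)).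
  rewrite -!/(so2_gen _) so2_gen_comparison res_iK (linearN (single k)) comparisonN.
  by rewrite !(scalerN, opprK) scalerA -natrM mulnn scaleNr.
pose N := fs_bound f.
have w0 : forall k, (k < N)%N -> comparison (single k (f k)) = 0.
  apply: (vandermonde zI) => j; elim: j => [|j ih].
    rewrite -[RHS]hf [in RHS](fs_sum_singles f) (linear_sum (@comparison M)).
    by apply: eq_bigr => k _; rewrite scale1r.
  have e : Z2 (\sum_(k < N) z k ^+ j *: comparison (single k (f k))) = 0.
    by rewrite ih /Z2 /so2_gen !linear0.
  rewrite -[RHS]e /Z2 /so2_gen (linear_sum (lie M _)) (linear_sum (lie M _)).
  apply: eq_bigr => k _; rewrite !(linearZ_LR (lie M _)) -[X in _ = _ *: X]/(Z2 _) Z2k.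
  by rewrite scalerA -exprSr.
apply: fs_ext => k; case: (ltnP k N) => hk; last exact: fs_boundP.
exact/comparison_single_eq0/w0.
Qed.

Hypothesis neg_one : forall m : M, K_act M (so_neg_one rat^o) (tens 1 m) = - tens 1 m.

(** If Z a = n b and Z b = - n a with n = 2 k + 1, then a + i b has weight n and
    real part a, and it is some X^k v. *)
Lemma comparison_surjective m : exists f, @comparison M f = m.
Proof.
have [N [a [b [-> hab]]]] := odd_decomposition m neg_one.
elim: N => [|N [f hf]]; first by exists 0; rewrite big_ord0 linear0.
have [hA hB] := hab N; pose w := tens (1 : Qi) (a N) + tens imag (b N).
have hw : H w = N.*2.+1%:R *: w.
  have opZE m' : opZ M m' = so2_gen m' by [].
  rewrite H_actE /w linearD /= !bc_linE /= !opZE hA hB.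
  rewrite tensN !tens_nat [tens imag (a N)]tens1 [tens imag (b N)]tens1.
  move: (tens 1 (a N)) (tens 1 (b N)) => u u'.
  by module_with (bc Qi M : lmodType Qi); ring: imag2.
have [v hv] := Xpow_surjective hw.
exists (f + single N v); rewrite linearD /= hf big_ord_recr /=; congr (_ + _).
rewrite /comparison tau_single hv bc_ReD /bc_Re !bc_coefE scale1r.
by rewrite scale0r addr0.
Qed.

End ComparisonBijective.

(** * The inverse functor on morphisms *)

Section Inverse.
Variables (M N : gKmodule) (f : gKhom M N).
Hypothesis f_inj : forall m, f m = 0 -> m = 0.
Hypothesis f_surj : forall n, exists m, f m = n.

Let inj : injective f.
Proof.
by move=> m m' e; apply/subr0_eq/f_inj; rewrite linearB e subrr.
Qed.

Definition gK_inv (n : N) : M := sval (cid (f_surj n)).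

Lemma gK_invK n : f (gK_inv n) = n.
Proof. exact: (svalP (cid (f_surj n))). Qed.

Lemma gK_Kinv m : gK_inv (f m) = m.
Proof. by apply: inj; rewrite gK_invK. Qed.

Fact gK_inv_linear : linear gK_inv.
Proof. by move=> a u v; apply: inj; rewrite linearP !gK_invK. Qed.
HB.instance Definition _ := GRing.isLinear.Build rat N M _ gK_inv gK_inv_linear.

Fact gK_inv_lie A n : gK_inv (lie N A n) = lie M A (gK_inv n).
Proof. by apply: inj; rewrite gKhom_lie !gK_invK. Qed.

Fact gK_inv_act (R : comAlgType rat) (g : SO2 R) u :
  bc_lin R gK_inv (K_act N g u) = K_act M g (bc_lin R gK_inv u).
Proof.
have fK : forall w, bc_lin R f (bc_lin R gK_inv w) = w.
  apply: (@bc_lin_ext _ _ _ (bc_lin R f \o bc_lin R gK_inv) idfun) => n /=.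
  by rewrite !bc_linE /= gK_invK.
have Kf : forall w, bc_lin R gK_inv (bc_lin R f w) = w.
  apply: (@bc_lin_ext _ _ _ (bc_lin R gK_inv \o bc_lin R f) idfun) => m /=.
  by rewrite !bc_linE /= gK_Kinv.
by rewrite -[LHS]Kf -[u in LHS]fK -gKhom_act !Kf.
Qed.

Lemma gKhom_iso : @iso_hom gKmod M N f.
Proof.
exists (GKhom gK_inv_lie gK_inv_act); split; apply: gKhom_eq => x /=.
  exact: gK_Kinv.
exact: gK_invK.
Qed.
End Inverse.

Section LadderMap.
Variables (V W : lmodType rat) (J theta : {linear V -> V}) (J' theta' : {linear W -> W}).
Hypothesis JJ : forall v, J (J v) = - v.
Hypothesis thetaJ : forall v, theta (J v) = - J (theta v).
Hypothesis JJ' : forall v, J' (J' v) = - v.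
Hypothesis thetaJ' : forall v, theta' (J' v) = - J' (theta' v).
Variable h : {linear V -> W}.
Hypothesis hJ : forall v, h (J v) = J' (h v).
Hypothesis htheta : forall v, h (theta v) = theta' (h v).

Notation GV := (ladder_gK JJ thetaJ).
Notation GW := (ladder_gK JJ' thetaJ').

Fact fs_map_fin (f : fseq V) : (fun k => h (f k)) \in @fin_pred W.
Proof.
by have [N hN] := fs_bounded f; apply: (@fs_fin _ _ N) => k hk; rewrite hN // linear0.
Qed.
Definition fs_map (f : GV) : GW := FSeq (fs_map_fin f).

Fact fs_map_linear : linear fs_map.
Proof. by move=> a f g; apply: fs_ext => k; rewrite /= linearP. Qed.
HB.instance Definition _ := GRing.isLinear.Build rat GV GW _ fs_map fs_map_linear.

Lemma fs_map_single k v : fs_map (single k v) = single k (h v).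
Proof.
apply: fs_ext => j; rewrite -[LHS]/(h (single k v j)) !singleE.
by case: eqP; rewrite ?linear0.
Qed.

Fact fs_map_lie A f : fs_map (lie GV A f) = lie GW A (fs_map f).
Proof.
have hP : fs_map (ladP theta f) = ladP theta' (fs_map f).
  apply: fs_ext => k; rewrite /ladP !fsE !(ladXE, ladYE, ladTE).
  rewrite -[LHS]/(h (ladP theta f k)) /ladP !fsE !(ladXE, ladYE, ladTE) !linearD linearN linearZ_LR.
  by rewrite !htheta; case: k => [|k]; rewrite ?htheta ?linear0.
have hS : fs_map (ladS J theta f) = ladS J' theta' (fs_map f).
  apply: fs_ext => k; rewrite -[LHS]/(h (ladS J theta f k)) /ladS !ladJE hJ; congr (J' _).
  rewrite !fsE !(ladXE, ladYE, ladTE) !(linearB h) (linearZ_LR h) !htheta.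
  by case: k => [|k]; rewrite ?htheta ?(linear0 h).
have hZ : fs_map (ladZ J f) = ladZ J' (fs_map f).
  apply: fs_ext => k; rewrite -[LHS]/(h (ladZ J f k)) /ladZ !fsE !ladJE !ladHE.
  by rewrite (linearN h) hJ (linearZ_LR h).
rewrite -[lie GV A f]/(ladder_lie J theta A f) -[RHS]/(ladder_lie J' theta' A (fs_map f)).
by rewrite /ladder_lie -hP -hS -hZ -!(linearZ_LR fs_map) -!(linearD fs_map).
Qed.

Fact fs_map_act (R : comAlgType rat) (g : SO2 R) u :
  bc_lin R fs_map (K_act GV g u) = K_act GW g (bc_lin R fs_map u).
Proof.
apply: (@fs_bc_lin_ext _ _ _ (bc_lin R fs_map \o K_act GV g)
  (K_act GW g \o bc_lin R fs_map)) => {u} k v /=.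
rewrite bc_linE /= !ladder_actE !scale1r fs_map_single !lrot_single /lrot_term !ctensE.
rewrite linearD /= !bc_linE /= !ladJ_single.
by rewrite !fs_map_single hJ.
Qed.

Definition ladder_hom : gKhom GV GW := GKhom fs_map_lie fs_map_act.

End LadderMap.

Section GMor.
Variables (V W : qrep) (h : qrep_hom V W).

Definition hom_pQ (v : resQ (Vp V)) : resQ (Vp W) := hom_p h v.
Fact hom_pQ_linear : linear hom_pQ.
Proof. by move=> a u v; rewrite /hom_pQ resQE linearP. Qed.
HB.instance Definition _ := GRing.isLinear.Build rat (resQ (Vp V)) (resQ (Vp W)) _
  hom_pQ hom_pQ_linear.

Lemma hom_pQ_i v : hom_pQ (res_i v) = res_i (hom_pQ v).
Proof. by rewrite /hom_pQ /res_i linearZ. Qed.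

Lemma hom_pQ_theta v : hom_pQ (theta v) = theta (hom_pQ v).
Proof. by rewrite /hom_pQ /theta hom_vphi_m hom_b. Qed.

Definition G_mor : gKhom (G_ob V) (G_ob W) :=
  ladder_hom _ _ _ _ hom_pQ_i hom_pQ_theta.

End GMor.

Program Definition G_functor : functor qrepCat gKmod :=
  @Functor qrepCat gKmod G_ob G_mor _ _.
Next Obligation. by apply: gKhom_eq => f; apply: fs_ext. Qed.
Next Obligation. by apply: gKhom_eq => f'; apply: fs_ext. Qed.

(** Carrying both vertices to + by the rational structure turns every arrow into
    theta, and a path of length n into theta^n. *)

Section Nilpotent.
Variable V : qrep.

Definition to_plus (s : bool) : vertex_space V s -> resQ (Vp V) :=
  if s return vertex_space V s -> resQ (Vp V) then id else vphi_m V.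

Lemma to_plus_arrow s (v : vertex_space V s) :
  to_plus (arrow_map v) = theta (to_plus v).
Proof. by case: s v => v //=; rewrite -[in LHS](vphi_mK (q := V) v) vphi_b. Qed.

Lemma to_plus_path s n (v : vertex_space V s) :
  to_plus (quiver_path n v) = iter n (@theta V) (to_plus v).
Proof. by elim: n => //= n ih; rewrite to_plus_arrow ih. Qed.

Lemma to_plus_eq0 s (v : vertex_space V s) : to_plus v = 0 -> v = 0.
Proof. by case: s v => v //= h; rewrite -(vphi_mK (q := V) v) h linear0. Qed.

Lemma nilpotent_repP :
  nilpotent_rep V <-> exists N, forall v : resQ (Vp V), iter N (@theta V) v = 0.
Proof.
split=> -[N hN]; exists N.
  move=> v; have := hN N true v (leqnn _) => /(congr1 (@to_plus _)).
  by rewrite to_plus_path => ->; case: (iter N negb true); rewrite /= ?linear0.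
move=> n s v hn; apply: to_plus_eq0; rewrite to_plus_path -(subnK hn) iterD hN.
by elim: (n - N)%N => //= k ->; rewrite linear0.
Qed.

End Nilpotent.

(** * Finiteness properties of the inverse functor *)

(** C = P^2 + S^2 - Z^2 + 1, since [P, S] = - 2 Z. *)
Lemma casimir_tens (M : gKmodule) (a : Qi) (m : M) : casimir (tens a m) =
  tens a (opP M (opP M m) + opS M (opS M m) - opZ M (opZ M m) + m).
Proof.
have PS x : opP M (opS M x) = opS M (opP M x) - 2 *: opZ M x.
  have := lie_br (sl2_of 1 0 0) (sl2_of 0 1 1) x; rewrite sl2_br_of.
  rewrite [lie M (sl2_of _ _ _) x]lie_PSZ !mxE /= -/(opP M) -/(opS M) => e.
  rewrite -[LHS](subrK (opS M (opP M x))) -e addrC; congr (_ + _).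
  by module_with (gK_space M); field.
have Xt x : X_act M (tens 1 x) =
    (2^-1 : Qi) *: (tens 1 (opP M x) + imag *: tens 1 (opS M x)).
  by rewrite X_actE !bc_linE.
have Yt x : Y_act M (tens 1 x) =
    (2^-1 : Qi) *: (tens 1 (opP M x) - imag *: tens 1 (opS M x)).
  by rewrite Y_actE !bc_linE.
have Ht x : H_act M (tens 1 x) = imag *: tens 1 (opZ M x).
  by rewrite H_actE bc_linE.
rewrite /casimir; move: (X_act M) (Y_act M) (H_act M) Xt Yt Ht => X Y H Xt Yt Ht.
rewrite [tens a m]tens1 !(linearZ_LR H) !(linearZ_LR Y) !(linearZ_LR X) Yt.
rewrite (linearZ_LR X) (linearB X) (linearZ_LR X) !Xt PS Ht (linearZ_LR H) Ht.
rewrite [RHS]tens1 !tensDr !tensN tens_nat.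
move: (tens 1 (opP M (opP M m))) (tens 1 (opS M (opS M m))) (tens 1 (opZ M (opZ M m)))
  (tens 1 (opZ M m)) (tens 1 (opS M (opP M m))) (tens 1 m) => p s z z1 sp t.
by module_with (bc Qi M : lmodType Qi); field: imag2.
Qed.

Lemma finite_dim_surj (U W : lmodType Qi) (sigma : Qi -> Qi) (g : U -> W) :
  {morph g : u v / u + v} -> (forall a u, g (a *: u) = sigma a *: g u) ->
  (forall w, exists u, g u = w) -> finite_dim U -> finite_dim W.
Proof.
move=> gD gZ gS [n [e he]]; exists n, (g \o e) => w.
have [u <-] := gS w; have [a ->] := he u; exists (sigma \o a).
have g0 : g 0 = 0 by apply: (addrI (g 0)); rewrite -gD !addr0.
by rewrite (big_morph g gD g0); apply: eq_bigr => i _; rewrite gZ.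
Qed.

Lemma Qi_ReIm (a : Qi) : a = complex.Re a *: 1 + (complex.Im a *: 1) * imag.
Proof.
by case: a => x y; apply/eqP; rewrite eq_complex /=; apply/andP; split; apply/eqP; ring.
Qed.

Section GFinite.
Variable V : qrep.
Notation W := (resQ (Vp V)).
Notation G := (G_ob V).

Lemma G_opP (f : G) : opP G f = ladP (@theta V) f.
Proof.
rewrite -[LHS]/(ladder_lie _ _ _ f) ladder_lie_of.
by rewrite scale1r !(addr0, oppr0) mul0r !scale0r !addr0.
Qed.
Lemma G_opS (f : G) : opS G f = ladS (@res_i _) (@theta V) f.
Proof.
rewrite -[LHS]/(ladder_lie _ _ _ f) ladder_lie_of subrr mul0r !scale0r addr0 add0r.
exact: scale1r.
Qed.
Lemma G_opZ (f : G) : opZ G f = ladZ (@res_i _) f.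
Proof.
rewrite -[LHS]/(ladder_lie _ _ _ f) ladder_lie_of addNr mul0r !scale0r !add0r.
exact: scale1r.
Qed.

Lemma G_Z_single k (v : W) :
  opZ G (single k v) = - (k.*2.+1%:R *: (single k (res_i v) : fseq W)).
Proof. by rewrite G_opZ /ladZ ladH_single ladJZ ladJ_single. Qed.

Lemma G_casimir_nilpotent : nilpotent_rep V ->
  exists k, forall f : G, iter k (@casimir G) (tens 1 f) = 0.
Proof.
move/nilpotent_repP => [N hN]; exists N => f.
pose Q (f : fseq W) : fseq W := ladP (@theta V) (ladP (@theta V) f) +
  ladS (@res_i _) (@theta V) (ladS (@res_i _) (@theta V) f) -
  ladZ (@res_i _) (ladZ (@res_i _) f) + f.
have cQ f' : casimir (tens 1 f' : bc Qi G) = tens 1 (Q f' : G).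
  by rewrite casimir_tens !G_opP !G_opS !G_opZ.
have -> k : iter k (@casimir G) (tens 1 f) = tens 1 (iter k Q f : G).
  by elim: k => //= k ->; rewrite cQ.
rewrite (_ : iter N Q f = 0) ?tens0 //; apply: fs_ext => j.
have -> k : (iter k Q f) j = 4 ^+ k *: iter k (fun v => theta (theta v)) (f j).
  elim: k => [|k ih]; first by rewrite scale1r.
  rewrite !iterS {1}/Q (ladder_casimir (@res_iK _) (@theta_i V)) ih.
  by rewrite !(linearZ_LR (@theta V)) scalerA -exprS.
have -> v : iter N (fun v : W => theta (theta v)) v = iter N.*2 (@theta V) v.
  by elim: N {hN} => //= k ->.
by rewrite -addnn iterD hN scaler0.
Qed.

Definition generated n (e : 'I_n -> G) (m : G) := exists u : 'I_n -> G -> G,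
  (forall i, env_action (u i)) /\ m = \sum_i u i (e i).

Lemma generatedD n (e : 'I_n -> G) m m' :
  generated e m -> generated e m' -> generated e (m + m').
Proof.
move=> [u [hu ->]] [u' [hu' ->]]; exists (fun i x => u i x + u' i x); split.
  by move=> i; apply: env_add.
by rewrite -big_split.
Qed.

Lemma generated_lie n (e : 'I_n -> G) A m : generated e m -> generated e (lie G A m).
Proof.
move=> [u [hu ->]]; exists (fun i x => lie G A (u i x)); split.
  by move=> i; apply: env_mul => //; apply: env_lie.
by rewrite linear_sum.
Qed.

Lemma generatedN n (e : 'I_n -> G) m : generated e m -> generated e (- m).
Proof.
move=> [u [hu ->]]; exists (fun i x => (-1) *: (u i x)); split.
  by move=> i; apply: env_mul => //; apply: env_scalar.
by rewrite -sumrN; apply: eq_bigr => i _; rewrite scaleN1r.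
Qed.

(** The vectors of weight 1 are combinations of generators and of their images
    under Z, and P X^k v = X^(k+1) v + (lower terms). *)
Lemma G_fg : finite_dim (Vp V) -> fg_over_U G.
Proof.
move=> [n [e he]]; pose E i : G := single 0 (e i : W); exists n, E.
have g0 (v : W) : generated E (single 0 v).
  have [a ->] := he v.
  exists (fun i m => complex.Re (a i) *: m + (- complex.Im (a i)) *: opZ G m); split.
    move=> i; apply: env_add; first exact: env_scalar.
    by apply: env_mul; [exact: env_scalar|exact: env_lie].
  rewrite (big_morph (single 0) (@linearD _ _ _ _ (single 0)) (linear0 (single 0))).
  apply: eq_bigr => i _; rewrite /E G_Z_single scale1r scaleNr scalerN opprK.
  rewrite -!(linearZ_LR (single 0)) -(linearD (single 0)); congr (single 0 _).
  rewrite /res_i !resQE scalerA -[RHS]/(_ *: _ + _ *: _ : Vp V) -scalerDl.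
  by rewrite -Qi_ReIm.
have gk k : forall v : W, generated E (single k v) /\ generated E (single k.+1 v).
  elim: k => [|k ih] v.
    split=> //; have := generatedD (generated_lie (sl2_of 1 0 0) (g0 v))
      (generatedN (g0 (theta v))).
    rewrite -[lie _ _ _]/(opP G (single 0 v)) G_opP /ladP ladX_single ladY_single0 ladT_single0.
    by rewrite addr0 addrK.
  split; first by have [] := ih v.
  have := generatedD (generated_lie (sl2_of 1 0 0) (ih v).2)
      (generatedN (ih (theta (theta v) - (k.+1 ^ 2)%:R *: v)).1).
  rewrite -[lie _ _ _]/(opP G (single k.+1 v)) G_opP /ladP ladX_single ladY_singleS ladT_singleS.
  by rewrite addr0 addrK.
elim/fs_ind => [|f g hf hg|k v]; last by have [] := gk k v.
  by have := g0 0; rewrite linear0.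
exact: generatedD.
Qed.

(** The element of F (x) G of weight 2 k + 1 with real part v in degree k: its
    imaginary part is Z v / (2 k + 1) = - i v. *)
Definition weight_vector k (v : Vp V) : bc Qi G :=
  tens 1 (single k (v : W) : G) - tens imag (single k (res_i v) : G).

Lemma weight_vector_H k v :
  H_act G (weight_vector k v) = (k.*2.+1)%:~R *: weight_vector k v.
Proof.
rewrite H_actE /weight_vector (linearB (bc_lin Qi _)) /= !bc_linE !G_Z_single res_iK.
rewrite (linearN (single k)) scalerN opprK tensN !tens_nat.
rewrite [tens imag (single k (v : W))]tens1 [tens imag (single k (@res_i (Vp V) v))]tens1.
move: (tens 1 (single k (v : W) : G)) (tens 1 (single k (@res_i (Vp V) v) : G)) => x y.
rewrite -[_%:~R]/(_%:R).
by module_with (bc Qi G : lmodType Qi); ring: imag2.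
Qed.

Lemma weight_vectorD k : {morph weight_vector k : u v / u + v}.
Proof.
move=> u v; rewrite /weight_vector (linearD (@res_i (Vp V))) !(linearD (single k)).
by rewrite !tensDr opprD addrACA.
Qed.

Lemma weight_vectorZ k (a : Qi) v : weight_vector k (a *: v) = a *: weight_vector k v.
Proof.
have hi : weight_vector k (imag *: v) = imag *: weight_vector k v.
  rewrite /weight_vector -[imag *: v]/(res_i v) res_iK (linearN (single k)) tensN opprK.
  by rewrite scalerBr !scale_tens imag2 mulr1 tensNl opprK addrC.
have hq (q : rat) u : weight_vector k ((q *: (1 : Qi)) *: u) =
    (q *: (1 : Qi)) *: weight_vector k u.
  rewrite /weight_vector -[_ *: u]/(q *: (u : W)) res_iZ.
  by rewrite !(linearZ_LR (single k)) !tensZ scalerBr !scale_tens -!scalerAl !mul1r.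
rewrite (Qi_ReIm a); move: (complex.Re a) (complex.Im a) => x y.
by rewrite scalerDl weight_vectorD -scalerA !hq hi scalerA scalerDl.
Qed.

(** Let a + i b' be the decomposition of [w], with b' = - b.  Then Z a = - n b and
    Z b = n a, so (2 k + 1)^2 a_k = n^2 a_k in degree k, and only the degree k
    with 2 k + 1 = n survives. *)
Lemma weight_vector_surj (n : nat) (w : bc Qi G) : H_act G w = n%:R *: w ->
  exists v, w = weight_vector n./2 v.
Proof.
move=> hw; pose a := bc_Re w; pose b := bc_Re (imag *: w).
have Ren (u : bc Qi G) : bc_Re (n%:R *: u) = n%:R *: bc_Re u.
  by rewrite -bc_ReZ; congr (bc_Re (_ *: _)); rewrite scaler_nat.
have hZa : opZ G a = - (n%:R *: b).
  by rewrite /a -bc_Re_lin bc_opZ hw bc_ReN scalerA mulrC -scalerA Ren.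
have hZb : opZ G b = n%:R *: a.
  rewrite /b -bc_Re_lin bc_opZ (linearZ_LR (H_act G)) hw !scalerA mulrA imag2.
  by rewrite mulN1r scaleNr opprK Ren.
move: hZa hZb; rewrite !G_opZ => hZa hZb.
have ha k : k.*2.+1%:R *: res_i (a k : W) = n%:R *: (b k : W).
  have := congr1 (fun f : fseq W => f k) hZa; rewrite fsNE ladJE ladHE fsNE fsZE.
  by rewrite (linearZ_LR (@res_i (Vp V))) => /oppr_inj.
have hb k : k.*2.+1%:R *: res_i (b k : W) = - (n%:R *: (a k : W)).
  have := congr1 (fun f : fseq W => f k) hZb; rewrite fsNE ladJE ladHE fsZE => <-.
  by rewrite (linearZ_LR (@res_i (Vp V))) opprK.
have scal0 (q : rat) (v : W) : q != 0 -> q *: v = 0 -> v = 0.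
  by move=> q0 /eqP; rewrite scaler_eq0 (negPf q0) => /eqP.
have a0 k : k.*2.+1 != n -> (a k : W) = 0.
  move=> hk; apply: (@scal0 ((n ^ 2)%:R - (k.*2.+1 ^ 2)%:R)).
    by rewrite subr_eq0 eqr_nat eqn_exp2r // eq_sym.
  have := congr1 (fun v => k.*2.+1%:R *: res_i v) (ha k).
  rewrite /= !res_iZ res_iK !scalerN scalerA -natrM mulnn.
  rewrite scalerA mulrC -scalerA hb scalerN scalerA -natrM mulnn => /oppr_inj e.
  by rewrite scalerBl e subrr.
have b0 k : k.*2.+1 != n -> (b k : W) = 0.
  move=> hk; have := hb k; rewrite a0 // scaler0 oppr0 => /scal0.
  rewrite pnatr_eq0 => /(_ isT) h.
  by apply: oppr_inj; rewrite -res_iK h linear0 oppr0.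
have bi k : k.*2.+1 = n -> (b k : W) = res_i (a k : W).
  move=> hk; have := ha k; rewrite hk => /scalerI -> //.
  by rewrite -hk pnatr_eq0.
have half k : k != n./2 -> k.*2.+1 != n.
  by apply: contraNneq => <-; rewrite -[k.*2.+1]/(true + k.*2)%N half_bit_double.
exists (a n./2); rewrite [LHS]bc_ReE /weight_vector; congr (tens 1 _ - tens imag _).
  apply: fs_ext => k; rewrite singleE; case: eqP => [->|/eqP hk] //.
  exact/a0/half.
apply: fs_ext => k; rewrite singleE; case: eqP => [->|/eqP hk]; last exact/b0/half.
have [/bi //|hn] := eqVneq n./2.*2.+1 n.
by rewrite [LHS](b0 _ hn) (a0 _ hn) linear0.
Qed.

Lemma G_weight_odd k : finite_dim (Vp V) -> finite_dim (weight_space G k.*2.+1).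
Proof.
have hv v : weight_vector k v \in eigen_pred (H_act G) (k.*2.+1)%:~R.
  exact/eqP/weight_vector_H.
pose g v : weight_space G k.*2.+1 := Eigen (hv v).
apply: (@finite_dim_surj _ _ idfun g).
- by move=> u v; apply/val_inj; apply: weight_vectorD.
- by move=> a v; apply/val_inj; apply: weight_vectorZ.
- move=> w; have [v e] := weight_vector_surj (eigenP w).
  exists v; apply/val_inj; rewrite /= e; congr (weight_vector _ _).
  by rewrite -[k.*2.+1]/(true + k.*2)%N half_bit_double.
Qed.

(** There are no even weights: [weight_vector_surj] makes a vector of even weight
    n one of weight n + 1 as well. *)
Lemma G_weight_nat (n : nat) : finite_dim (Vp V) -> finite_dim (weight_space G n).
Proof.
case: (boolP (odd n)) => hn.
  by rewrite -[n]odd_double_half hn; apply: G_weight_odd.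
move=> _; exists 0%N, (fun=> 0) => w; exists (fun=> 0); rewrite big_ord0.
apply/val_inj; have [v e] := weight_vector_surj (eigenP w).
have := eigenP w; rewrite e weight_vector_H => /eqP; rewrite -subr_eq0 -scalerBl.
rewrite -[in X in _ - X](odd_double_half n) (negPf hn) add0n -!pmulrn -natrB // subSnn.
by rewrite scale1r => /eqP ->.
Qed.

(** Conjugation exchanges the weights n and - n. *)
Lemma G_weight (n : int) : finite_dim (Vp V) -> finite_dim (weight_space G n).
Proof.
move=> fp; case: (intP n) => [|k|k]; [exact: G_weight_nat|exact: G_weight_nat|].
pose g := eigen_map (@c_weight G k.+1).
apply: (@finite_dim_surj (weight_space G k.+1) _ conjQi g); last exact: G_weight_nat.
- by move=> u v; apply/val_inj; apply: bc_ringD.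
- by move=> a v; apply/val_inj; apply: bc_ringZ.
- move=> w; have hw : c_act (val w) \in eigen_pred (H_act G) (k.+1)%:~R.
    by apply/eqP; have := c_weight (eigenP w); rewrite opprK.
  by exists (Eigen hw); apply/val_inj; apply: c_actK.
Qed.

Lemma G_HC0 : finite_nilpotent V -> HC0_pred G.
Proof.
move=> [_ fp nil]; split; [split| |].
- exact: G_fg.
- by move=> n; apply: G_weight.
- exact: G_casimir_nilpotent.
- by move=> m; exact: (ladder_act_neg_one (@res_iK (Vp V)) rat^o m).
Qed.

End GFinite.

(** * The equivalence of categories *)

Section WellDefined.
Variable M : gKmodule.

(** On M_1 the Casimir element is 4 X Y = 4 theta^2. *)
Lemma E_well_defined : HC0_pred M -> finite_nilpotent (E_ob M).
Proof.
move=> [[_ fd] C_nilp _]; split; [exact: fd|exact: fd|apply/nilpotent_repP].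
have [k hk] := casimir_nilpotent C_nilp; exists k.*2 => v.
have hC u : casimir (wt1 u) = 4 *: wt1 (theta (theta u)) :> bc Qi M.
  rewrite /casimir; move: (wt1_H u) (wt1_theta2 u).
  move: (X_act M) (Y_act M) (H_act M) (wt1 u) (wt1 _) => X Y H x y hx ->.
  by rewrite !hx; move: (X _) => z; module_with (bc Qi M : lmodType Qi); ring.
have hiter j : iter j (@casimir M) (wt1 v) = 4 ^+ j *: wt1 (iter j.*2 (@theta (E_ob M)) v).
  elim: j => [|j ih]; first by rewrite scale1r.
  have casZ a w : casimir (a *: w) = a *: casimir w :> bc Qi M.
    exact: (linearZ_LR (sl2_casimir (H_act M) (X_act M) (Y_act M))).
  by rewrite iterS ih casZ hC scalerA -exprSr doubleS.
have := hk (wt1 v); rewrite hiter.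
move/(congr1 (fun x => (4 ^+ k)^-1 *: x)); rewrite scalerA mulVf ?expf_neq0 ?natQi_eq0 //.
by rewrite scale1r scaler0 => h; apply/val_inj.
Qed.

End WellDefined.

(** A morphism of representations is determined by its component at +, which may
    be any linear map commuting with theta. *)

Section PlusPart.
Variables (V W : qrep) (f : {linear Vp V -> Vp W}).
Hypothesis f_theta : forall v, f (theta v) = theta (f v).

Definition minus_part (v : Vm V) : Vm W := vphi_p W (f (vphi_m V v)).

Fact minus_part_linear : linear minus_part.
Proof.
move=> a u v; rewrite /minus_part !(linearD, linearZ_LR) /=.
congr (_ *: _ + _); case: a => x y.
by apply/eqP; rewrite eq_complex /= opprK !eqxx.
Qed.
HB.instance Definition _ := GRing.isLinear.Build Qi (Vm V) (Vm W) _ minus_part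
  minus_part_linear.

Fact plus_hom_a v : f (phi_a V v) = phi_a W (minus_part v).
Proof.
rewrite -[v in LHS](vphi_mK (q := V)) vphi_b -/(theta _) f_theta.
by rewrite /minus_part vphi_b.
Qed.
Fact plus_hom_b v : minus_part (phi_b V v) = phi_b W (f v).
Proof. by rewrite /minus_part -/(theta _) f_theta /theta vphi_mK. Qed.
Fact plus_hom_vm v : f (vphi_m V v) = vphi_m W (minus_part v).
Proof. by rewrite /minus_part vphi_pK. Qed.
Fact plus_hom_vp v : minus_part (vphi_p V v) = vphi_p W (f v).
Proof. by rewrite /minus_part vphi_pK. Qed.

Definition plus_hom : qrep_hom V W :=
  QRepHom plus_hom_a plus_hom_b plus_hom_vm plus_hom_vp.

End PlusPart.

Lemma qrep_hom_plus_eq (V W : qrep) (f g : qrep_hom V W) : hom_p f =1 hom_p g -> f = g.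
Proof.
move=> h; apply: qrep_hom_eq => // v; rewrite -[LHS](vphi_mK (q := W)).
by rewrite -hom_vphi_m h hom_vphi_m vphi_mK.
Qed.

Lemma qrep_hom_iso (V W : qrep) (f : qrep_hom V W) (g : Vp W -> Vp V) :
  cancel (hom_p f) g -> cancel g (hom_p f) -> @iso_hom qrepCat V W f.
Proof.
move=> fK gK; have fI := can_inj fK.
have g_lin : linear g by move=> a u v; apply: fI; rewrite linearP !gK.
have g_theta v : linear_of g_lin (theta v) = theta (linear_of g_lin v).
  by apply: fI; rewrite /= gK /theta hom_vphi_m hom_b gK.
exists (plus_hom g_theta); split; apply: qrep_hom_plus_eq => v /=; [exact: fK|exact: gK].
Qed.

Section Counit.
Variable V : qrep.
Notation G := (G_ob V).

(** By [weight_space1P] a vector of weight 1 is determined by the term of degree 0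
    of its real part. *)
Definition counit_fun (w : weight_space G 1) : Vp V := (bc_Re (val w) : fseq _) 0%N.

Lemma bc_Re_weight_vector k v : bc_Re (weight_vector k v) = single k (v : resQ (Vp V)).
Proof.
by rewrite /weight_vector bc_ReD bc_ReN /bc_Re !bc_coefE scale1r scale0r subr0.
Qed.

Lemma weight_space1P (w : weight_space G 1) : val w = weight_vector 0 (counit_fun w).
Proof.
have [v e] := @weight_vector_surj V 1 _ (eigenP w).
by rewrite /counit_fun e bc_Re_weight_vector.
Qed.

Fact counit_linear : linear counit_fun.
Proof.
move=> a u w; have e : val (a *: u + w) = weight_vector 0 (a *: counit_fun u + counit_fun w).
  by rewrite weight_vectorD weight_vectorZ -!weight_space1P.
by rewrite {1}/counit_fun e bc_Re_weight_vector.
Qed.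

(** Re (Y w) = (P a - S b) / 2 for a = Re w and b = Re (i w). *)
Fact counit_theta (w : Vp (E_ob G)) :
  linear_of counit_linear (theta w) = theta (linear_of counit_linear w).
Proof.
rewrite -[LHS]/((bc_Re (c_act (Y_act G (val (w : weight_space G 1)))) : fseq _) 0%N) bc_Re_c.
rewrite weight_space1P -[RHS]/(theta (counit_fun w)); move: (counit_fun w) => v.
have Ti (u : bc Qi G) : bc_Re ((2^-1 : Qi) *: u) = (2^-1 : rat) *: bc_Re u.
  by rewrite -bc_ReZ; congr (bc_Re (_ *: _)); apply/eqP; rewrite eq_complex.
rewrite Y_actE Ti bc_ReD bc_ReN -(linearZ_LR (bc_lin Qi (opS G))) !bc_Re_lin.
rewrite -weight_vectorZ !bc_Re_weight_vector G_opP G_opS /ladP /ladS ladX_single ladY_single0.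
rewrite ladT_single0 ladX_single ladY_single0 ladT_single0 !fsE ladJE !fsE !singleE /=.
rewrite -[imag *: v]/(@res_i (Vp V) v) theta_i subr0 sub0r opprK res_iK opprK.
by rewrite addr0 add0r -mulr2n -scaler_nat scalerA mulVf ?scale1r.
Qed.

Definition counit : qrep_hom (E_ob G) V := plus_hom counit_theta.

Lemma counit_iso : @iso_hom qrepCat (E_ob G) V counit.
Proof.
have hv v : weight_vector 0 v \in eigen_pred (H_act G) 1%:~R.
  exact/eqP/(weight_vector_H 0).
pose g (v : Vp V) : weight_space G 1 := Eigen (hv v).
apply: (@qrep_hom_iso (E_ob G) V counit g) => [w|v].
  by apply/val_inj; rewrite /= weight_space1P.
by rewrite /= /counit_fun /= bc_Re_weight_vector.
Qed.

End Counit.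

Lemma counit_natural (V W : qrep) (f : qrep_hom V W) :
  qrep_comp (counit W) (E_hom (G_mor f)) = qrep_comp f (counit V).
Proof.
apply: qrep_hom_plus_eq => w /=.
rewrite /counit_fun /=.
by rewrite -[bc_lin Qi _ _]/(bc_lin Qi (G_mor f) (val (w : weight_space (G_ob V) 1))) bc_Re_lin.
Qed.

Lemma comparison_natural (M N : gKmodule) (f : gKhom M N) :
  gK_comp (comparison_hom N) (G_mor (E_hom f)) = gK_comp f (comparison_hom M).
Proof.
apply: gKhom_eq => x /=; rewrite /comparison -bc_Re_lin; congr bc_Re.
have X_lin w : bc_lin Qi f (X_act M w) = X_act N (bc_lin Qi f w).
  by apply: bc_lin_lie_ext => B m; apply: gKhom_lie.
have G0 : G_mor (E_hom f) 0 = 0 by exact: linear0.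
have GD x' y' : G_mor (E_hom f) (x' + y') = G_mor (E_hom f) x' + G_mor (E_hom f) y'.
  exact: linearD.
have GS k v : G_mor (E_hom f) (single k v) = single k (hom_pQ (E_hom f) v).
  exact: fs_map_single.
elim/fs_ind: x => [|x y hx hy|k v].
- by rewrite G0 !tau0 linear0.
- by rewrite GD !tauD (linearD (bc_lin Qi f)) hx hy.
rewrite GS !tau_single /Xpow.
by elim: k => //= k ->; rewrite X_lin.
Qed.

Lemma iso_hom_full (C : category) (P : C -> Prop) (A B : full_subcategory P)
  (f : @mor C (sval A) (sval B)) : @iso_hom C _ _ f -> @iso_hom (full_subcategory P) A B f.
Proof. by []. Qed.

Theorem theorem5p3 :
  exists wd : forall M : gKmod, HC0_pred M -> finite_nilpotent (E_functor M),
    is_equivalence (full_restrict wd : functor HC0 nilQRep).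
Proof.
exists E_well_defined.
exists (full_restrict (F := G_functor) G_HC0 : functor nilQRep HC0); split.
- exists (fun M : HC0 => comparison_hom (sval M)); split=> [[M hM]|M N f].
    apply: iso_hom_full; apply: gKhom_iso.
      by have [_ C_nilp _] := hM => f; apply: comparison_injective.
    by have [_ C_nilp neg1] := hM; apply: comparison_surjective.
  exact: comparison_natural.
- exists (fun V : nilQRep => counit (sval V)); split=> [V|V W f].
    exact/iso_hom_full/counit_iso.
  exact: counit_natural.
Qed.
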